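(* Let $k\ge 1$ and let $F:P_k\to\mathscr E'(\mathbb R)$ be a mapping that does not vanish identically and satisfies the support, span, translation invariance and dilation invariance conditions. Suppose that $\max(k_\ell,\,k-k_r)\le 2$. Then there is a non-negative integer $n$ such that for all $(a_0,\ldots,a_k)\in P_k$, $F(a_0,\ldots,a_k)$ is a constant, non-zero multiple of the $n$th distributional derivative of the B-spline function $N(a_{k_\ell},a_{k_\ell+1},\ldots,a_{k_r})$ of order $k_r-k_\ell$ with respect to the points $a_{k_\ell},a_{k_\ell+1},\ldots,a_{k_r}$.
   Context: $\mathscr E'(\mathbb R)$ is the space of compactly supported (complex-valued) distributions on $\mathbb R$, the dual of $\mathscr E(\mathbb R)=C^\infty(\mathbb R)$; $D$ is the distributional derivative. For a distribution $T$, $T(\cdot-\tau)$ and $T(\cdot/\delta)$ are the translated and dilated distributions (extending the usual operations on functions). For an integer $k\ge1$, $P_k=\{(a_0,\ldots,a_k)\in\mathbb Q^{k+1}:a_0<a_1<\cdots<a_k\}$. A mapping $F:P_k\to\mathscr E'(\mathbb R)$ satisfies, for all $(a_0,\ldots,a_k)\in P_k$: - the support condition if $\operatorname{supp}F(a_0,\ldots,a_k)\subseteq[a_0,a_k]$; - the span condition if for all $a\in\bigcup_{j=0}^{k-1}(a_j,a_{j+1})\cap\mathbb Q$, with $(\alpha_0,\ldots,\alpha_{k+1})$ the increasing rearrangement of $\{a_0,\ldots,a_k,a\}$, one has $F(a_0,\ldots,a_k)\in\operatorname{span}\{F(\alpha_0,\ldots,\alpha_k),F(\alpha_1,\ldots,\alpha_{k+1})\}$;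 - translation invariance if $F(a_0+\tau,\ldots,a_k+\tau)\in\operatorname{span}\{F(a_0,\ldots,a_k)(\cdot-\tau)\}$ for all $\tau\in\mathbb Q$; - dilation invariance if $F(\delta a_0,\ldots,\delta a_k)\in\operatorname{span}\{F(a_0,\ldots,a_k)(\cdot/\delta)\}$ for all positive $\delta\in\mathbb Q$. If such an $F$ satisfies all four conditions and is not identically zero, then $F(0,1,\ldots,k)\ne0$, and one defines $k_\ell$ as the largest integer $i$ such that $F(0,1,\ldots,k)$ vanishes identically on $(-\infty,i)$, and $k_r$ as the smallest integer $i$ such that $F(0,1,\ldots,k)$ vanishes identically on $(i,\infty)$; one has $0\le k_\ell\le k_r\le k$. B-splines: $N(a)=\delta_a$ (Dirac distribution at $a$) is the B-spline of order $0$; $N(a_0,a_1)$ is the characteristic function of $(a_0,a_1]$ (order $1$); and for $\rho\ge2$ and $a_0<\cdots<a_\rho$ the B-spline of order $\rho$ is $N(a_0,\ldots,a_\rho;t)=\frac{t-a_0}{a_{\rho-1}-a_0}N(a_0,\ldots,a_{\rho-1};t)+\frac{a_\rho-t}{a_\rho-a_1}N(a_1,\ldots,a_\rho;t)$, identified with the distribution it induces. *)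

(* Defs.v *)
From HB Require Import structures.
From mathcomp Require Import all_boot all_order all_algebra.
From mathcomp Require Import all_classical all_reals all_analysis.
From mathcomp Require Export complex.
Set Implicit Arguments.
Unset Strict Implicit.
Unset Printing Implicit Defensive.
Import Order.TTheory GRing.Theory Num.Theory.
Import numFieldNormedType.Exports.
Local Open Scope classical_set_scope.
Local Open Scope ring_scope.
Local Open Scope complex_scope.

Section RealSmooth.
Variable R : realType.

Definition rsmooth (f : R -> R) : Prop :=
  forall (n : nat) (x : R), derivable (derive1n n f) x 1.

Lemma rsmooth_derive1 (f : R -> R) : rsmooth f -> rsmooth (derive1 f).
Proof. by move=> sf n x; rewrite /derive1n -iterSr; exact: (sf n.+1). Qed.

Lemma derive1nD (f g : R -> R) n : rsmooth f -> rsmooth g ->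
  derive1n n (fun x => f x + g x) = fun x => derive1n n f x + derive1n n g x.
Proof.
move=> sf sg; elim: n => // n IH; rewrite derive1nS IH; apply/funext => x.
by rewrite 2!derive1nS !derive1E; apply: deriveD; [exact: sf|exact: sg].
Qed.

Lemma derive1nZ (c : R) (f : R -> R) n : rsmooth f ->
  derive1n n (fun x => c * f x) = fun x => c * derive1n n f x.
Proof.
move=> sf; elim: n => // n IH; rewrite derive1nS IH; apply/funext => x.
by rewrite derive1nS !derive1E; apply: (@deriveZ _ _ _ _ c); exact: sf.
Qed.

Lemma is_derive_affine (c d x : R) : is_derive x 1 (fun y : R => c * y + d) c.
Proof.
have := is_deriveD (is_deriveZ c (is_derive_id x (1 : R))) (is_derive_cst d x (1 : R)).
by rewrite addr0 /GRing.scale/= mulr1.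
Qed.

Lemma derive1n_affine (c d : R) (f : R -> R) n : rsmooth f ->
  derive1n n (fun x => f (c * x + d)) =
  fun x => c ^+ n * derive1n n f (c * x + d).
Proof.
move=> sf; elim: n => [|n IH]; first by apply/funext => x; rewrite mul1r.
rewrite derive1nS IH; apply/funext => x; rewrite derive1E.
have Da : is_derive x 1 (fun y : R => c * y + d) c.
  exact: is_derive_affine.
have Df : is_derive (c * x + d) 1 (derive1n n f) (derive1n n.+1 f (c * x + d)).
  by split; [exact: sf|rewrite -derive1E -derive1nS].
have Dc := @is_derive1_comp _ (derive1n n f) (fun y : R => c * y + d) _ _ _ Df Da.
have := @is_deriveZ _ _ _ _ (c ^+ n) _ _ _ Dc.
move=> D; have := @derive_val _ _ _ _ _ _ _ D; rewrite /GRing.scale/= => E.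
by rewrite [LHS]E exprSr -[RHS]mulrA; congr (_ * _); exact: mulrC.
Qed.

Lemma rsmooth0 : rsmooth (fun=> 0).
Proof.
have E n : derive1n n (fun=> 0 : R) = fun=> (0 : R).
  by elim: n => // n IH; rewrite derive1nS IH; apply/funext => x; rewrite derive1E derive_cst.
by move=> n x; rewrite E; exact: derivable_cst.
Qed.

Lemma rsmoothD (f g : R -> R) :
  rsmooth f -> rsmooth g -> rsmooth (fun x => f x + g x).
Proof. by move=> sf sg n x; rewrite derive1nD//; apply: derivableD; [exact: sf|exact: sg]. Qed.

Lemma rsmoothZ (c : R) (f : R -> R) : rsmooth f -> rsmooth (fun x => c * f x).
Proof. by move=> sf n x; rewrite derive1nZ//; apply: (@derivableZ _ _ _ _ c); exact: sf. Qed.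

Lemma rsmooth_affine (c d : R) (f : R -> R) :
  rsmooth f -> rsmooth (fun x => f (c * x + d)).
Proof.
move=> sf n x; rewrite derive1n_affine//.
apply: (@derivableZ _ _ _ (fun x => derive1n n f (c * x + d)) (c ^+ n)).
have Da : is_derive x 1 (fun y : R => c * y + d) c.
  exact: is_derive_affine.
have Df : is_derive (c * x + d) 1 (derive1n n f) (derive1 (derive1n n f) (c * x + d)).
  by split; [exact: sf|rewrite -derive1E].
have Dc := @is_derive1_comp _ (derive1n n f) (fun y : R => c * y + d) _ _ _ Df Da.
exact: (@ex_derive _ _ _ _ _ _ _ Dc).
Qed.

End RealSmooth.

Section TestFunctions.
Variable R : realType.

(* The codomain is [R[i]^o] so that functions form a vector space over [R[i]]. *)
Definition smooth (phi : R -> R[i]^o) : Prop :=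
  rsmooth (fun x => complex.Re (phi x)) /\ rsmooth (fun x => complex.Im (phi x)).

Definition cderiven (n : nat) (phi : R -> R[i]^o) : R -> R[i]^o := fun x =>
  derive1n n (fun y => complex.Re (phi y)) x
    +i* derive1n n (fun y => complex.Im (phi y)) x.

Definition smooth_fun : {pred R -> R[i]^o} := fun phi => `[< smooth phi >].

Lemma smooth_funP (f : R -> R[i]^o) : reflect (smooth f) (f \in smooth_fun).
Proof. exact: (@asboolP (smooth f)). Qed.

Lemma smooth_submod_closed : submod_closed smooth_fun.
Proof.
split; first by apply/smooth_funP; split; exact: rsmooth0.
move=> [a b] f g /smooth_funP[fr fi] /smooth_funP[gr gi].
have hr := rsmoothD (rsmoothD (@rsmoothZ _ a _ fr) (@rsmoothZ _ (- b) _ fi)) gr.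
have hi := rsmoothD (rsmoothD (@rsmoothZ _ a _ fi) (@rsmoothZ _ b _ fr)) gi.
apply/smooth_funP; split.
- apply: (eq_ind _ (@rsmooth R) hr); apply/funext => x; rewrite [RHS]/=.
  by rewrite /GRing.add/= /GRing.scale/=; case: (f x) (g x) => [? ?] [? ?] /=; rewrite mulNr.
- apply: (eq_ind _ (@rsmooth R) hi); apply/funext => x; rewrite [RHS]/=.
  by rewrite /GRing.add/= /GRing.scale/=; case: (f x) (g x) => [? ?] [? ?].
Qed.

HB.instance Definition _ :=
  GRing.isSubmodClosed.Build R[i] (R -> R[i]^o) smooth_fun smooth_submod_closed.

(* The space E(R) of complex-valued smooth functions. *)
Record testfun := TestFun { tf :> R -> R[i]^o; _ : tf \in smooth_fun }.

HB.instance Definition _ := [isSub for tf].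
HB.instance Definition _ := [Choice of testfun by <:].
HB.instance Definition _ := [SubChoice_isSubLmodule of testfun by <:].

Lemma tf_smooth (phi : testfun) : smooth phi.
Proof. by case: phi => f fS; apply/smooth_funP. Qed.

Lemma deriv_subproof (phi : testfun) : cderiven 1 phi \in smooth_fun.
Proof.
by apply/smooth_funP; have [? ?] := tf_smooth phi; split;
  [exact: (@rsmooth_derive1 R (fun x => complex.Re (phi x)))
  |exact: (@rsmooth_derive1 R (fun x => complex.Im (phi x)))].
Qed.

Definition test_deriv (phi : testfun) : testfun := TestFun (deriv_subproof phi).

Lemma affine_subproof (c d : R) (phi : testfun) :
  (fun x => phi (c * x + d)) \in smooth_fun.
Proof.
apply/smooth_funP; have [sr si] := tf_smooth phi.
by split; [exact: (@rsmooth_affine R c d _ sr)|exact: (@rsmooth_affine R c d _ si)].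
Qed.

Definition test_affine (c d : R) (phi : testfun) : testfun :=
  TestFun (affine_subproof c d phi).

Definition test_supp (phi : testfun) : set R := closure [set x | phi x != 0].

End TestFunctions.

Section Distributions.
Variable R : realType.

(* An element of E'(R) is determined by its values on test functions, and the
   operations on E'(R) are defined below on arbitrary functionals. *)
Definition functional := testfun R -> R[i]^o.
HB.instance Definition _ := GRing.Lmodule.on functional.

(* Continuity for the Frechet topology of E(R): uniform convergence on compact
   sets of the derivatives of every order. *)
Definition test_continuous (T : functional) : Prop :=
  forall (phi0 : testfun R) (eps : R), 0 < eps ->
  exists (m : nat) (r delta : R), 0 < delta /\
    forall phi : testfun R,
      (forall (j : nat) (x : R), (j <= m)%N -> `|x| <= r ->
         `|cderiven j phi x - cderiven j phi0 x| < delta%:C) ->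
      `|T phi - T phi0| < eps%:C.

(* E'(R), the topological dual of E(R) *)
Record cs_distribution := CsDistribution {
  dist_val :> {linear testfun R -> R[i]^o};
  dist_cont : test_continuous dist_val }.

Definition to_functional (T : cs_distribution) : functional := T.
Coercion to_functional : cs_distribution >-> functional.

Definition translate (tau : R) (T : functional) : functional :=
  fun phi => T (test_affine 1 tau phi).

(* The dilated distribution T(./delta), for delta > 0; the factor delta is the
   Jacobian of x = delta * y. *)
Definition dilate (delta : R) (T : functional) : functional :=
  fun phi => delta%:C * T (test_affine delta 0 phi).

Definition dist_deriv (T : functional) : functional :=
  fun phi => - T (test_deriv phi).

Definition vanishes_on (T : functional) (U : set R) : Prop :=
  forall phi : testfun R,
    compact (test_supp phi) -> test_supp phi `<=` U -> T phi = 0.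

Definition dist_supp (T : functional) : set R :=
  [set x | ~ exists U : set R, [/\ open U, U x & vanishes_on T U]].

(* For T = F(0, ..., k), [is_left_end T i] says that i is k_l and
   [is_right_end T i] that i is k_r. *)
Definition is_left_end (T : functional) (i : int) : Prop :=
  vanishes_on T [set x | x < i%:~R] /\
  forall j : int, vanishes_on T [set x | x < j%:~R] -> j <= i.

Definition is_right_end (T : functional) (i : int) : Prop :=
  vanishes_on T [set x | i%:~R < x] /\
  forall j : int, vanishes_on T [set x | j%:~R < x] -> i <= j.

(* The B-spline function N(a_0, ..., a_rho; .), of order rho >= 1; the value at
   rho = 0 is junk, see [bspline_dist]. *)
Fixpoint bspline (rho : nat) (a : nat -> R) (t : R) : R :=
  match rho with
  | 0 => 0
  | 1 => \1_(`]a 0%N, a 1%N]) t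
  | (m.+1 as q).+1 =>
      (t - a 0%N) / (a q - a 0%N) * bspline q a t
      + (a rho - t) / (a rho - a 1%N) * bspline q (fun i => a i.+1) t
  end.

(* The B-spline as a distribution: the Dirac distribution at a_0 for order 0. *)
Definition bspline_dist (rho : nat) (a : nat -> R) : functional := fun phi =>
  if rho == 0%N then phi (a 0%N)
  else (\int[lebesgue_measure]_t (bspline rho a t * complex.Re (phi t)))%R
       +i* (\int[lebesgue_measure]_t (bspline rho a t * complex.Im (phi t)))%R.

End Distributions.

Section Knots.

(* The set P_k; the knot a_j is [nth 0 a j]. *)
Record knots (k : nat) := Knots {
  knots_val :> k.+1.-tuple rat;
  knots_sorted : sorted <%R (knots_val : seq rat) }.

Variable k : nat.

Definition int_knots_tuple : k.+1.-tuple rat := [tuple (i%:R : rat) | i < k.+1].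

Lemma int_knots_subproof : sorted <%R (int_knots_tuple : seq rat).
Proof.
rewrite /= (map_comp (fun n : nat => n%:R : rat) val) val_enum_ord.
rewrite sorted_map; apply: sub_sorted (iota_ltn_sorted 0 k.+1).
by move=> i j /=; rewrite ltr_nat.
Qed.

(* (0, 1, ..., k) *)
Definition int_knots : knots k := Knots int_knots_subproof.

Lemma shift_subproof (tau : rat) (a : knots k) :
  sorted <%R (map_tuple (fun x => x + tau) a : seq rat).
Proof.
rewrite /= sorted_map; apply: sub_sorted (knots_sorted a).
by move=> x y /=; rewrite ltrD2r.
Qed.

Definition shift_knots (tau : rat) (a : knots k) : knots k :=
  Knots (shift_subproof tau a).

Lemma scale_subproof (delta : rat) (delta0 : 0 < delta) (a : knots k) :
  sorted <%R (map_tuple (fun x => delta * x) a : seq rat).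
Proof.
rewrite /= sorted_map; apply: sub_sorted (knots_sorted a).
by move=> x y /=; rewrite ltr_pM2l.
Qed.

Definition scale_knots (delta : rat) (delta0 : 0 < delta) (a : knots k) :
  knots k := Knots (scale_subproof delta0 a).

Lemma init_size (b : knots k.+1) : size (take k.+1 b) == k.+1.
Proof. by rewrite size_takel// size_tuple. Qed.

Lemma init_subproof (b : knots k.+1) : sorted <%R (Tuple (init_size b) : seq rat).
Proof. exact: take_sorted (knots_sorted b). Qed.

(* (b_0, ..., b_k) for b = (b_0, ..., b_{k+1}) *)
Definition init_knots (b : knots k.+1) : knots k := Knots (init_subproof b).

Lemma tail_subproof (b : knots k.+1) : sorted <%R (behead_tuple b : seq rat).
Proof. by rewrite /= -drop1; exact: drop_sorted (knots_sorted b). Qed.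

(* (b_1, ..., b_{k+1}) for b = (b_0, ..., b_{k+1}) *)
Definition tail_knots (b : knots k.+1) : knots k := Knots (tail_subproof b).

End Knots.

Section Conditions.
Variables (R : realType) (k : nat) (F : knots k -> cs_distribution R).

Definition real_knot (a : knots k) (j : nat) : R := ratr (nth 0 a j).

Definition support_condition : Prop := forall a : knots k,
  dist_supp (F a) `<=` `[real_knot a 0, real_knot a k].

(* [b] is the increasing rearrangement of {a_0, ..., a_k, x}: it is increasing
   by the type [knots], and it is a permutation of these points. *)
Definition span_condition : Prop :=
  forall (a : knots k) (x : rat) (b : knots k.+1),
  (exists2 j : nat, (j < k)%N & nth 0 a j < x < nth 0 a j.+1) ->
  perm_eq b (x :: a) ->
  exists c d : R[i],
    (F a : functional R) =
      c *: (F (init_knots b) : functional R) + d *: (F (tail_knots b) : functional R).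

Definition translation_invariant : Prop := forall (a : knots k) (tau : rat),
  exists c : R[i],
    (F (shift_knots tau a) : functional R) = c *: translate (ratr tau) (F a).

Definition dilation_invariant : Prop :=
  forall (a : knots k) (delta : rat) (delta0 : 0 < delta),
  exists c : R[i],
    (F (scale_knots delta0 a) : functional R) = c *: dilate (ratr delta) (F a).

End Conditions.

(* Main.v *)
Require Import Defs.
From HB Require Import structures.
From mathcomp Require Import all_boot all_order all_algebra.
From mathcomp Require Import all_classical all_reals all_analysis.
From mathcomp Require Import measurable_realfun ring lra zify.

(** Polynomials are dense in the space of smooth functions, so a distribution
    with compact support is determined by its values on them, and all of the
    algebra takes place on polynomials. Let T = F(0, ..., k) and let S be the
    shift P |-> P(X + 1). Inserting the missing integers into (0, m, ..., mk)
    with the span condition gives T(P(mX)) = T(p_m(S) P) with deg p_m <= (m-1)k,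
    for every m >= 2. Comparing p_m and p_n shows that p_m = c_m B(X^m) / B for
    one polynomial B of degree at most k, and then T(P^(u)) = g (B(S) P^(n))(0)
    for some n and some g <> 0, where u is the multiplicity of 1 as a root of B.

    By the span condition and the affine covariance, every F(a) then satisfies
    F(a)(P^(u)) = sum_x beta_a(x) P^(n)(x) for a finitely supported measure
    beta_a on Q, and beta inherits these two properties. A maximal rank argument
    on the integers with a hole shows that beta_a lives on the points of a. When
    at most two coefficients of B vanish at each end, this vanishing propagates
    to beta_a for all a, and B has no root except 0 and 1. So u is
    r = k_r - k_l and beta_a annihilates the polynomials of degree less than r:
    it is a divided difference over r + 1 consecutive knots, and its value on
    P^(n) is, up to a factor, the integral of a B-spline against P^(n + r). *)

Set Implicit Arguments.
Unset Strict Implicit.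
Unset Printing Implicit Defensive.
Import Order.TTheory GRing.Theory Num.Theory.
Local Open Scope ring_scope.

(** * Shift operators on polynomials *)

(** The two exponents have a meaning. Up to sign, T(P^(u)) = beta(P^(n)) says that D^u T = D^n beta:
    T is the n-th derivative of a u-fold antiderivative of the measure beta, and this antiderivative
    has compact support exactly when beta kills the polynomials of degree less than u. For a divided
    difference of order u it is a B-spline. On polynomials, B(S) is surjective with an explicit
    kernel, so B can be divided out.

    The obstacle is that the symbol describes F on equally spaced knots only. Any other F(a) is a
    combination, with unknown coefficients, of uniform ones on a fine grid, and nothing says
    directly that the masses at the grid points outside of a cancel. Hence the dimension count that
    confines beta_a to the knots, and the insertion of points that carries zero coefficients of B to
    arbitrary knots. The bound 2 enters there: the insertion argument treats the first and the
    second knot, and by reflection the last two. *)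

Section ShiftOperators.
Variable K : numFieldType.
Implicit Types (P Q G : {poly K}) (c : K) (m n : nat).

Definition shiftp c P : {poly K} := P \Po ('X + c%:P).
Definition scalep c P : {poly K} := P \Po (c *: 'X).
(** This is Q(S) applied to P, for the shift S : P |-> P(X + 1). Products of polynomials become
    compositions of operators, so all these operators commute. *)
Definition opE Q P : {poly K} := \sum_(i < size Q) Q`_i *: shiftp i%:R P.

Lemma poly_eq_horner P Q : (forall x, P.[x] = Q.[x]) -> P = Q.
Proof.
move=> h; apply/eqP; rewrite -subr_eq0;
apply/eqP/(@roots_geq_poly_eq0 _ _ (map (fun i : nat => i%:R) (iota 0 (size (P - Q))))).
- by apply/allP => x _; rewrite /root hornerD hornerN h subrr.
- rewrite map_inj_in_uniq ?iota_uniq// => i j _ _ /eqP; rewrite eqr_nat => /eqP//.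
- by rewrite size_map size_iota.
Qed.

Lemma opEw Q P N : (size Q <= N)%N -> opE Q P = \sum_(i < N) Q`_i *: shiftp i%:R P.
Proof.
move=> h; rewrite /opE (big_ord_widen N (fun i : nat => Q`_i *: shiftp i%:R P) h).
rewrite big_mkcond; apply: eq_bigr => i _; case: ltnP => // hi.
by rewrite nth_default// scale0r.
Qed.

Lemma horner_shiftp c P x : (shiftp c P).[x] = P.[x + c].
Proof. by rewrite /shiftp horner_comp !hornerE. Qed.

Lemma horner_scalep c P x : (scalep c P).[x] = P.[c * x].
Proof. by rewrite /scalep horner_comp !hornerE. Qed.

Lemma horner_opE Q P N x : (size Q <= N)%N ->
  (opE Q P).[x] = \sum_(i < N) Q`_i * P.[x + i%:R].
Proof.
move=> h; rewrite (opEw _ h) horner_sum; apply: eq_bigr => i _.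
by rewrite hornerZ horner_shiftp.
Qed.

Lemma opE_is_linear Q : linear (opE Q).
Proof.
move=> a P G; apply: poly_eq_horner => x.
rewrite hornerD hornerZ !(horner_opE _ _ (leqnn _)) mulr_sumr -big_split/=.
by apply: eq_bigr => i _; rewrite hornerD hornerZ; ring.
Qed.

HB.instance Definition _ Q :=
  GRing.isLinear.Build K {poly K} {poly K} *:%R (opE Q) (opE_is_linear Q).

Lemma opEDl Q Q' P : opE (Q + Q') P = opE Q P + opE Q' P.
Proof.
have h1 : (size (Q + Q')%R <= maxn (size Q) (size Q'))%N by exact: size_polyD.
rewrite (opEw _ h1) (opEw _ (leq_maxl (size Q) (size Q'))) (opEw _ (leq_maxr (size Q) (size Q'))) -big_split/=.
by apply: eq_bigr => i _; rewrite coefD scalerDl.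
Qed.

Lemma opEZl c Q P : opE (c *: Q) P = c *: opE Q P.
Proof.
rewrite (opEw _ (size_scale_leq c Q)) scaler_sumr.
by apply: eq_bigr => i _; rewrite coefZ scalerA.
Qed.

Lemma opEBl Q Q' P : opE (Q - Q') P = opE Q P - opE Q' P.
Proof. by rewrite opEDl -[- Q']scaleN1r opEZl scaleN1r. Qed.

Lemma opE0l P : opE 0 P = 0.
Proof. by rewrite /opE size_poly0 big_ord0. Qed.

Lemma opEsum (I : Type) (r : seq I) (F : I -> {poly K}) P :
  opE (\sum_(i <- r) F i) P = \sum_(i <- r) opE (F i) P.
Proof.
elim: r => [|i r IH]; first by rewrite !big_nil opE0l.
by rewrite !big_cons opEDl IH.
Qed.

Lemma opEXn n P : opE 'X^n P = shiftp n%:R P.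
Proof.
rewrite /opE size_polyXn (bigD1 ord_max)//= coefXn eqxx scale1r big1 ?addr0// => i hi.
by rewrite coefXn -[X in (_ == X)]/(val (@ord_max n)) val_eqE (negbTE hi) scale0r.
Qed.

Lemma opEC c P : opE c%:P P = c *: P.
Proof.
have -> : c%:P = c *: 'X^0 by rewrite expr0 alg_polyC.
rewrite opEZl opEXn; congr (_ *: _).
by apply: poly_eq_horner => x; rewrite horner_shiftp addr0.
Qed.

Lemma opEM Q Q' P : opE (Q * Q') P = opE Q (opE Q' P).
Proof.
rewrite -{1}[Q]coefK -{1}[Q']coefK !poly_def mulr_suml opEsum.
rewrite [RHS]/opE; apply: eq_bigr => i _.
rewrite -scalerAl opEZl; congr (_ *: _).
rewrite mulr_sumr opEsum.
apply: poly_eq_horner => x; rewrite horner_shiftp (horner_opE _ _ (leqnn _)) horner_sum.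
apply: eq_bigr => j _; rewrite -scalerAr opEZl hornerZ -exprD opEXn horner_shiftp.
by rewrite natrD addrA.
Qed.

(** A unit step of the variable is a step of length m after dilation by m, so S becomes S^m. *)
Lemma opE_scalep Q P m : (0 < m)%N ->
  opE Q (scalep m%:R P) = scalep m%:R (opE (Q \Po 'X^m) P).
Proof.
move=> m0; have -> : Q \Po 'X^m = \sum_(i < size Q) Q`_i *: 'X^(i * m).
  rewrite comp_polyE; apply: eq_bigr => i _; by rewrite -exprM mulnC.
rewrite opEsum; apply: poly_eq_horner => x.
rewrite (horner_opE _ _ (leqnn _)) horner_scalep horner_sum; apply: eq_bigr => i _.
rewrite opEZl hornerZ opEXn horner_shiftp horner_scalep natrM; congr (_ * P.[_]); ring.
Qed.

Lemma scalepM a b P : scalep a (scalep b P) = scalep (b * a) P.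
Proof. by apply: poly_eq_horner => x; rewrite !horner_scalep mulrA. Qed.

Lemma deriv_opE Q P : (opE Q P)^`() = opE Q P^`().
Proof.
rewrite /opE raddf_sum/=; apply: eq_bigr => i _; rewrite derivZ; congr (_ *: _).
by rewrite /shiftp deriv_comp derivD derivX derivC addr0 mulr1.
Qed.

Lemma derivn_opE n Q P : (opE Q P)^`(n) = opE Q P^`(n).
Proof. by elim: n P => // n IH P; rewrite !derivSn deriv_opE IH. Qed.

Lemma deriv_scalep c P : (scalep c P)^`() = c *: scalep c P^`().
Proof. by rewrite /scalep deriv_comp derivZ derivX alg_polyC mulrC mul_polyC. Qed.

Lemma derivn_scalep n c P : (scalep c P)^`(n) = c ^+ n *: scalep c P^`(n).
Proof.
elim: n P => [|n IH] P; first by rewrite scale1r.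
by rewrite derivSn deriv_scalep derivnZ IH scalerA -derivSn exprS.
Qed.

Lemma scalep_is_linear c : linear (scalep c).
Proof. by move=> a P G; rewrite /scalep comp_polyD comp_polyZ. Qed.

HB.instance Definition _ c :=
  GRing.isLinear.Build K {poly K} {poly K} *:%R (scalep c) (scalep_is_linear c).

Lemma size_shiftp c P : size (shiftp c P) = size P.
Proof. by rewrite /shiftp size_comp_poly2// size_XaddC. Qed.

Lemma lead_coef_shiftp c P : lead_coef (shiftp c P) = lead_coef P.
Proof. by rewrite /shiftp lead_coef_comp ?size_XaddC// lead_coefXaddC expr1n mulr1. Qed.

Lemma coef_shiftp_top c P n : (size P <= n.+1)%N -> (shiftp c P)`_n = P`_n.
Proof.
rewrite leq_eqVlt => /predU1P[h|h].
  have := lead_coef_shiftp c P; rewrite !lead_coefE size_shiftp h /=; by [].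
by rewrite !nth_default// size_shiftp.
Qed.

Lemma size_opE Q P : (size (opE Q P) <= size P)%N.
Proof.
apply/leq_sizeP => j hj; rewrite /opE coef_sum big1// => i _.
by rewrite coefZ [(shiftp _ _)`_j]nth_default ?mulr0// size_shiftp.
Qed.

(** Shifts keep the leading coefficient, so Q(S) multiplies it by the sum of the coefficients of Q.
    If Q(1) is nonzero, Q(S) is triangular and hence bijective: only the root 1 of Q creates a
    kernel. *)
Lemma coef_opE_top Q P n : (size P <= n.+1)%N -> (opE Q P)`_n = Q.[1] * P`_n.
Proof.
move=> h; rewrite /opE coef_sum horner_coef mulr_suml; apply: eq_bigr => i _.
by rewrite coefZ coef_shiftp_top// expr1n mulr1.
Qed.

Lemma opE_inj1 Q P : Q.[1] != 0 -> opE Q P = 0 -> P = 0.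
Proof.
move=> Q1 h; apply/eqP; rewrite -lead_coef_eq0; apply/eqP.
have := coef_opE_top Q (leqSpred (size P)); rewrite h coef0 lead_coefE => /esym/eqP.
by rewrite mulf_eq0 (negbTE Q1) => /eqP.
Qed.

Lemma opE_surj1 Q G : Q.[1] != 0 -> exists P, opE Q P = G.
Proof.
move=> Q1; have [n] := ubnP (size G); elim: n G => // n IH G; rewrite ltnS => hG.
case: n IH hG => [|n] IH hG.
  exists 0; rewrite linear0; apply/esym/eqP; by rewrite -size_poly_leq0.
pose P0 := (G`_n / Q.[1]) *: 'X^n : {poly K}.
have hP0 : (size P0 <= n.+1)%N by rewrite (leq_trans (size_scale_leq _ _))// size_polyXn.
have [] := IH (G - opE Q P0).
  rewrite ltnS; apply/leq_sizeP => j; rewrite leq_eqVlt => /predU1P[<-|hj].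
    rewrite coefB coef_opE_top// coefZ coefXn eqxx mulr1.
    by rewrite mulrCA mulfV// mulr1 subrr.
  rewrite coefB !nth_default ?subr0//; last exact: leq_trans hG hj.
  by rewrite (leq_trans (size_opE _ _))// (leq_trans hP0 hj).
by move=> P hP; exists (P + P0); rewrite linearD/= hP subrK.
Qed.

Lemma opE_delta P : opE ('X - 1) P = shiftp 1 P - P.
Proof. by rewrite opEBl -['X]expr1 opEXn -polyC1 opEC scale1r. Qed.

Lemma delta_surj G : exists P, opE ('X - 1) P = G.
Proof.
have [n] := ubnP (size G); elim: n G => // n IH G; rewrite ltnS => hG.
case: n IH hG => [|n] IH hG.
  exists 0; rewrite linear0; apply/esym/eqP; by rewrite -size_poly_leq0.
(* The difference of X^(n+1) has leading term (n + 1) X^n, so that of [P0] has the top coefficient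
   of [G]. *)
pose P0 := (G`_n / n.+1%:R) *: 'X^(n.+1) : {poly K}.
have hd : (size (opE ('X - 1) P0) <= n.+1)%N /\ (opE ('X - 1) P0)`_n = G`_n.
  rewrite opE_delta; have hsz : (size P0 <= n.+2)%N.
    by rewrite (leq_trans (size_scale_leq _ _))// size_polyXn.
  split.
    apply/leq_sizeP => j; rewrite leq_eqVlt => /predU1P[<-|hj].
      by rewrite coefB coef_shiftp_top// subrr.
    by rewrite coefB !nth_default ?subr0 ?size_shiftp//; exact: leq_trans hsz hj.
  rewrite coefB /P0 /shiftp linearZ/= comp_Xn_poly polyC1 !coefZ exprD1n coefXn.
  rewrite coef_sum (bigD1 (inord n))//= inordK; last by lia.
  rewrite coefMn coefXn eqxx big1 ?addr0.
    by rewrite (ltn_eqF (ltnSn n)) mulr0 subr0 binSn -mulrA mulVf ?mulr1// pnatr_eq0.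
  move=> i hi; rewrite coefMn coefXn; case: eqP => [e|_]; last by rewrite mul0rn.
  by case/eqP: hi; apply: val_inj; rewrite /= inordK -?e//; lia.
have [] := IH (G - opE ('X - 1) P0).
  rewrite ltnS; apply/leq_sizeP => j; rewrite leq_eqVlt => /predU1P[<-|hj].
    by rewrite coefB hd.2 subrr.
  rewrite coefB !nth_default ?subr0//; last exact: leq_trans hG hj.
  exact: leq_trans hd.1 hj.
by move=> P hP; exists (P + P0); rewrite linearD/= hP subrK.
Qed.

Lemma opE_surj Q G : Q != 0 -> exists P, opE Q P = G.
Proof.
move=> Q0; have [p [Q1 hQ1 ->]] := multiplicity_XsubC Q 1; rewrite Q0/= in hQ1.
elim: p => [|p IH]; first by rewrite expr0 mulr1; apply: opE_surj1.
have [P hP] := IH; have [P' hP'] := delta_surj P.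
by exists P'; rewrite exprSr mulrA opEM polyC1 hP' -polyC1.
Qed.

(** The value at every natural number equals the value at 0, and a non-constant polynomial takes a
    value only finitely often. *)
Lemma delta_eq0 P : opE ('X - 1) P = 0 -> P^`() = 0.
Proof.
rewrite opE_delta => /eqP; rewrite subr_eq0 => /eqP h.
have hn (n : nat) : P.[n%:R] = P.[0].
  elim: n => // n IH; rewrite -natr1 -[RHS]IH -[in RHS]h horner_shiftp; by [].
have -> : P = (P.[0])%:P; last by rewrite derivC.
apply/eqP; rewrite -subr_eq0; apply/eqP.
apply/(@roots_geq_poly_eq0 _ _ (map (fun i : nat => i%:R) (iota 0 (size (P - (P.[0])%:P))))).
- by apply/allP => x /mapP[i _ ->]; rewrite /root !hornerE hn subrr.
- rewrite map_inj_in_uniq ?iota_uniq// => i j _ _ /eqP; rewrite eqr_nat => /eqP//.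
- by rewrite size_map size_iota.
Qed.

Lemma delta_exp_eq0 p P : opE (('X - 1) ^+ p) P = 0 -> P^`(p) = 0.
Proof.
elim: p P => [|p IH] P; first by rewrite expr0 -polyC1 opEC scale1r.
rewrite exprSr mulrC opEM => /delta_eq0; rewrite deriv_opE => /IH.
by rewrite derivSn.
Qed.

(** The factor Q1(S) is injective and each factor S - 1 costs one derivative. Hence P^(p) depends on
    B(S) P only, for B = Q1 (X - 1)^p, and a functional of P^(p) factors through B(S). *)
Lemma opE_ker p Q1 P : Q1.[1] != 0 -> opE (Q1 * ('X - 1) ^+ p) P = 0 -> P^`(p) = 0.
Proof. by move=> h; rewrite opEM => /(opE_inj1 h); exact: delta_exp_eq0. Qed.

Lemma derivn_opE_low p Q1 P : (size P <= p)%N -> opE (Q1 * ('X - 1) ^+ p) P = 0.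
Proof.
move=> h; rewrite opEM.
suff -> : opE (('X - 1) ^+ p) P = 0 by rewrite linear0.
elim: p P h => [|p IH] P h.
  by move: h; rewrite size_poly_leq0 => /eqP->; rewrite linear0.
rewrite exprSr opEM; apply: IH; apply/leq_sizeP => j; rewrite opE_delta.
rewrite leq_eqVlt => /predU1P[<-|hj]; first by rewrite coefB coef_shiftp_top// subrr.
by rewrite coefB !nth_default ?subr0 ?size_shiftp//; exact: leq_trans h hj.
Qed.

Lemma derivn_surj n G : exists P, P^`(n) = G.
Proof.
elim: n G => [|n IH] G; first by exists G.
suff [G' hG] : exists G', G'^`() = G.
  by have [P hP] := IH G'; exists P; rewrite derivnS hP.
exists (\poly_(i < (size G).+1) (G`_i.-1 / i%:R)).
apply/polyP => i; rewrite coef_deriv coef_poly ltnS.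
case: ltnP => [hi|hi]; last by rewrite mul0rn nth_default.
by rewrite /= -[_ *+ _]mulr_natr -mulrA mulVf ?mulr1// pnatr_eq0.
Qed.

End ShiftOperators.

(** * Refinable functionals on polynomials *)

Section TruncatedCongruence.
Variable K : fieldType.
Implicit Types (A B C : {poly K}) (N n m : nat).

Definition eqmodX N A B := forall i, (i < N)%N -> A`_i = B`_i.

Lemma eqmodX_sym N A B : eqmodX N A B -> eqmodX N B A.
Proof. by move=> h i hi; rewrite h. Qed.

Lemma eqmodX_trans N B A C : eqmodX N A B -> eqmodX N B C -> eqmodX N A C.
Proof. by move=> h1 h2 i hi; rewrite h1// h2. Qed.

Lemma eqmodX_mull N C A B : eqmodX N A B -> eqmodX N (C * A) (C * B).
Proof.
move=> h i hi; rewrite !coefM; apply: eq_bigr => j _; congr (_ * _); apply: h.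
by rewrite (leq_ltn_trans (leq_subr _ _)).
Qed.

Lemma eqmodX_leq N M A B : (M <= N)%N -> eqmodX N A B -> eqmodX M A B.
Proof. by move=> h hAB i hi; apply: hAB; exact: leq_trans hi h. Qed.

Lemma eqmodX_comp N m A B : (0 < m)%N ->
  eqmodX N A B -> eqmodX (m * N) (A \Po 'X^m) (B \Po 'X^m).
Proof.
move=> m0 h i hi; rewrite !coef_comp_poly_Xn//; case: ifP => // _; apply: h.
by rewrite ltn_divLR// mulnC.
Qed.

Lemma eqmodX_unit N A : A`_0 = 1 -> eqmodX N (A \Po 'X^N) 1.
Proof.
case: N => // N A0 i hi; rewrite coef_comp_poly_Xn// coef1.
case: i hi => [|i] hi; first by rewrite dvdn0 div0n A0.
by rewrite gtnNdvd.
Qed.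

Lemma eqmodX_eq A B : (forall N, eqmodX N A B) -> A = B.
Proof. by move=> h; apply/polyP => i; exact: (h i.+1). Qed.

Lemma trunc_inverse A r : A`_0 = 1 ->
  exists b : {poly K}, [/\ (size b <= r.+1)%N, b`_0 = 1 & eqmodX r.+1 (b * A) 1].
Proof.
move=> A0; elim: r => [|r [b [bs b0 hb]]].
  exists 1; split; rewrite ?size_poly1 ?coef1// => -[|i]// _.
  by rewrite mul1r A0 coef1.
pose d := (b * A)`_r.+1; exists (b - d *: 'X^(r.+1)).
have hA i : (i <= r.+1)%N -> ('X^(r.+1) * A)`_i = (i == r.+1)%:R.
  move=> hi; rewrite coefXnM; case: ltnP => h; first by rewrite ltn_eqF.
  have -> : i = r.+1 by apply/eqP; rewrite eqn_leq hi.
  by rewrite subnn A0 eqxx.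
split.
- rewrite (leq_trans (size_polyD _ _))// geq_max (leq_trans bs)//= size_polyN.
  by rewrite (leq_trans (size_scale_leq _ _))// size_polyXn.
- by rewrite coefB coefZ coefXn mulr0 subr0.
- move=> i; rewrite ltnS => hi; rewrite mulrBl coefB -scalerAl coefZ hA//.
  move: hi; rewrite leq_eqVlt => /predU1P[->|hi].
    by rewrite eqxx mulr1 subrr coef1.
  by rewrite ltn_eqF// mulr0 subr0 hb.
Qed.

End TruncatedCongruence.

(* If [q_m] is the "coboundary" [B(X^m)/B] of a formal series [B], then the
   coefficients of [1/B] restricted to an arithmetic progression of step [m]
   satisfy a recurrence that does not depend on [m]; comparing the recurrences
   for [m] and [m - 1] shows that [1/B] is rational. *)
Section Coboundary.
Variable K : fieldType.
Variables (q : nat -> {poly K}) (r : nat).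
Hypothesis q0 : forall m, (1 < m)%N -> (q m)`_0 = 1.
Hypothesis qsz : forall m, (1 < m)%N -> (size (q m) <= m.-1 * r + 1)%N.
Hypothesis qcomm : forall m, (1 < m)%N ->
  (q m \Po 'X^2) * q 2 = (q 2 \Po 'X^m) * q m.

(** Partial products of the series A = prod_j q_2(X^(2^j)), the solution of q_2(X) A(X^2) = A(X)
    with A(0) = 1. This is 1/B, normalised. Modulo X^(2^J) the partial product is exact, so
    statements about A become congruences between polynomials. *)
Local Definition eJ J := \prod_(j < J) (q 2 \Po 'X^(2 ^ j)).

Lemma comp_XnXn (A : {poly K}) a b : (A \Po 'X^a) \Po 'X^b = A \Po 'X^(a * b).
Proof. by rewrite -comp_polyA comp_Xn_poly -exprM mulnC. Qed.

(** By commutation, moving q_m across the factor of index j turns q_m(X^(2^j)) into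
    q_m(X^(2^(j+1))). The last of these is 1 modulo X^(2^J), whence q_m A(X^m) = A. *)
Lemma eJ_comm J m : (1 < m)%N ->
  q m * (eJ J \Po 'X^m) = eJ J * (q m \Po 'X^(2 ^ J)).
Proof.
move=> m1; elim: J => [|J IH].
  by rewrite /eJ !big_ord0 expr1 comp_polyXr -polyC1 comp_polyC mulrC.
rewrite /eJ !big_ord_recr/= -/(eJ J) comp_polyM mulrA IH comp_XnXn -!mulrA.
congr (_ * _); rewrite mulnC -comp_XnXn -comp_polyM mulrC -qcomm//.
by rewrite comp_polyM comp_XnXn -expnS mulrC.
Qed.

Lemma eJ_coef0 J : (eJ J)`_0 = 1.
Proof.
elim: J => [|J IH]; first by rewrite /eJ big_ord0 coef1.
by rewrite /eJ big_ord_recr/= -/(eJ J) coef0M IH mul1r coef_comp_poly_Xn ?expn_gt0// dvdn0 div0n q0.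
Qed.

Lemma eJ_stab J J' : (J <= J')%N -> eqmodX (2 ^ J) (eJ J') (eJ J).
Proof.
elim: J' => [|J' IH]; first by rewrite leqn0 => /eqP->.
rewrite leq_eqVlt => /predU1P[->//|]; rewrite ltnS => h.
apply: eqmodX_trans (IH h); rewrite /eJ big_ord_recr/= -/(eJ J').
rewrite -[X in eqmodX _ _ X]mulr1; apply: eqmodX_mull.
by apply: (@eqmodX_leq _ (2 ^ J')); [rewrite leq_exp2l|exact/eqmodX_unit/q0].
Qed.

Lemma eJ_refine J m : (1 < m)%N -> eqmodX (2 ^ J) (q m * (eJ J \Po 'X^m)) (eJ J).
Proof.
move=> m1; rewrite eJ_comm// -[X in eqmodX _ _ X]mulr1.
exact/eqmodX_mull/eqmodX_unit/q0.
Qed.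

Lemma coef_comp_mul (b A : {poly K}) m n : (0 < m)%N -> ((size b).-1 * m <= n)%N ->
  ((b \Po 'X^m) * A)`_n = \sum_(v < size b) b`_v * A`_(n - v * m).
Proof.
move=> m0 hn; rewrite comp_polyE mulr_suml coef_sum; apply: eq_bigr => v _.
have hv : (v * m <= n)%N.
  by apply: leq_trans hn; rewrite leq_mul2r -ltnS (ltn_predK (ltn_ord v)) ltn_ord orbT.
by rewrite -scalerAl coefZ -exprM coefXnM [(m * v)%N]mulnC ltnNge hv.
Qed.

(** Let b be the inverse of A modulo X^(r+1). Then b(X^m) A = q_m (bA)(X^m), which is q_m modulo
    X^((r+1)m), and q_m has degree at most (m - 1) r. So the coefficients of b(X^m) A from rm to
    (r+1)m - 1, apart from the constant one, vanish, and b does not depend on m. *)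
Lemma section_recurrence : exists b : nat -> K, b 0%N = 1 /\
  forall J n m, (r < 2 ^ J)%N -> (1 < m)%N -> (0 < n)%N -> (r * m <= n)%N ->
    (n < r.+1 * m)%N -> (n < 2 ^ J)%N ->
    \sum_(v < r.+1) b v * (eJ J)`_(n - v * m) = 0.
Proof.
have [b [bs b0 hb]] := trunc_inverse r (eJ_coef0 r).
exists (fun v => b`_v); split=> // J n m hJ m1 n0 rmn nrm nJ.
have bE : \sum_(v < r.+1) b`_v * (eJ J)`_(n - v * m) = ((b \Po 'X^m) * eJ J)`_n.
  rewrite coef_comp_mul ?(ltnW m1)//; last first.
    by apply: leq_trans rmn; rewrite leq_mul2r; apply/orP; right; case: (size b) bs.
  rewrite [RHS](big_ord_widen r.+1 (fun v : nat => b`_v * (eJ J)`_(n - v * m)) bs).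
  rewrite [RHS]big_mkcond/=; apply: eq_bigr => v _; case: ltnP => // h.
  by rewrite nth_default// mul0r.
rewrite bE -(eqmodX_mull _ (@eJ_refine J m m1) nJ).
rewrite mulrCA -comp_polyM.
have hbJ : eqmodX r.+1 (b * eJ J) 1.
  move=> i hi; rewrite -(hb i hi).
  have [h|h] := leqP r J.
    have := eqmodX_mull b (eJ_stab h); apply; apply: leq_trans hi _.
    by rewrite ltn_expl.
  have := eqmodX_mull b (eJ_stab (ltnW h)) => /(_ i) <-//.
  exact: leq_trans hi _.
have := eqmodX_mull (q m) (eqmodX_comp (ltnW m1) hbJ).
rewrite -polyC1 comp_polyC mulr1 => -> //; last by rewrite mulnC.
rewrite nth_default// (leq_trans (qsz m1))//.
rewrite addn1; case: (posnP r) => [->|r0]; first by rewrite muln0.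
have : (m.-1 * r < m * r)%N by rewrite ltn_pmul2r//; case: m m1 {rmn nrm bE} => //.
by move=> h; apply: leq_trans h _; rewrite mulnC.
Qed.

(** The relations for (n, m) and for (n - j - 1, m - 1) share their last term, since n - (j+1)m = (n
    - j - 1) - (j+1)(m - 1). Their difference has one term less and multiplies [g v] by 1 -
    X^(j+1-v). The margin [t] keeps both pairs in the range of validity; each subtraction costs r +
    1. *)
Lemma eliminate j (g : nat -> {poly K}) (M : nat) t :
  (1 < t)%N -> (j <= r)%N ->
  (forall n m, (0 < n)%N -> (r * m <= n)%N -> (n + t <= r.+1 * m)%N -> (n < M)%N ->
    \sum_(v < j.+1) (g v)`_(n - v * m) = 0) ->
  forall n m, (0 < n)%N -> (r * m <= n)%N -> (n + (t + j * r.+1) <= r.+1 * m)%N ->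
    (n < M)%N -> ((\prod_(i < j) (1 - 'X^(i.+1))) * g 0%N)`_n = 0.
Proof.
elim: j g t => [|j IH] g t t1 jr h n m n0 rmn nm nM.
  have := h n m n0 rmn; rewrite mul0n addn0 in nm.
  by rewrite big_ord1 mul0n subn0 big_ord0 mul1r; apply.
pose g' v := (1 - 'X^(j.+1 - v)) * g v.
rewrite big_ord_recr/= -mulrA -[(1 - _) * g 0%N]/(g' 0%N).
apply: (IH g' (t + r.+1)%N (ltn_addr _ t1) (ltnW jr) _ n m n0 rmn _ nM); last first.
  by move: nm; rewrite mulSn; lia.
move=> {nm nM rmn n0 m n} n m n0 rmn nm nM.
have mt : (t + r.+1 <= m)%N by nia.
have h1 := h n m n0 rmn (leq_trans _ nm) nM.
have h2 := h (n - j.+1)%N m.-1.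
rewrite big_ord_recr/= in h1; rewrite big_ord_recr/= in h2.
have mE : (m = m.-1.+1)%N by lia.
have E : (n - j.+1 - j.+1 * m.-1 = n - j.+1 * m)%N by rewrite -subnDA {2}mE mulnS.
rewrite E in h2.
have {}h1 := h1 _; have {}h2 := h2 _ _ _ _.
have -> : \sum_(v < j.+1) ((1 - 'X^(j.+1 - v)) * g v)`_(n - v * m) =
  (\sum_(v < j.+1) (g v)`_(n - v * m) + (g j.+1)`_(n - j.+1 * m)) -
  (\sum_(v < j.+1) (g v)`_(n - j.+1 - v * m.-1) + (g j.+1)`_(n - j.+1 * m)).
  rewrite opprD addrACA subrr addr0 -sumrB; apply: eq_bigr => v _.
  have vj := ltn_ord v.
  rewrite mulrBl mul1r coefB coefXnM.
  have hv : (v * m <= j * m)%N by rewrite leq_mul2r -ltnS vj orbT.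
  have hj : (j.+1 * m <= r * m)%N by rewrite leq_mul2r jr orbT.
  have h3 : (j.+1 - v <= n - v * m)%N.
    have : ((j.+1 - v) * m <= n - v * m)%N by rewrite mulnBl; lia.
    by apply: leq_trans; rewrite leq_pmulr//; lia.
  rewrite ltnNge h3 /=; congr (_ - (g v)`_ _).
  by rewrite {1 3}mE mulnS in hv h3 *; lia.
have : (r * 3 <= r * m)%N by rewrite leq_mul2l; lia.
by rewrite h1 ?h2 ?subr0//; nia.
Qed.

Lemma inverse_rational : exists (P Q : {poly K}) (N : nat), [/\ P`_0 = 1, Q`_0 = 1 &
  forall J, (N <= J)%N -> eqmodX (2 ^ J) (Q * eJ J) P].
Proof.
have [b [b0 hb]] := section_recurrence.
pose Q : {poly K} := \prod_(i < r) (1 - 'X^(i.+1)).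
(* [t] is the margin left after r eliminations. Beyond r (t + r), every n satisfies rm <= n and n +
   t <= (r+1)m with m the quotient of n by r. *)
pose t := (2 + r * r.+1)%N; pose N1 := (r * (t + r)).+1.
have Q0 : Q`_0 = 1.
  rewrite /Q; elim: r => [|i IH]; first by rewrite big_ord0 coef1.
  by rewrite big_ord_recr/= coef0M IH mul1r coefB coef1 coefXn subr0.
have vanish J n : (r < 2 ^ J)%N -> (N1 <= n)%N -> (n < 2 ^ J)%N -> (Q * eJ J)`_n = 0.
  move=> rJ Nn nJ.
  have n0 : (0 < n)%N by exact: leq_trans Nn.
  have [m [rmn nm]] : exists m, (r * m <= n)%N /\ (n + t <= r.+1 * m)%N.
    case: (posnP r) => [r0|r0].
      by exists (n + t)%N; rewrite r0 mul0n mul1n.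
    exists (n %/ r)%N; rewrite mulnC leq_trunc_div; split=> //.
    rewrite mulSn {1}(divn_eq n r).
    have : (n %% r < r)%N by rewrite ltn_mod.
    have : (t + r <= n %/ r)%N by rewrite leq_divRL// mulnC; exact: ltnW.
    by lia.
  have := @eliminate r (fun v => b v *: eJ J) (2 ^ J) 2 isT (leqnn _) _ n m n0 rmn nm nJ.
  rewrite b0 scale1r; apply => {m rmn nm n0 Nn nJ n} n m n0 rmn nm nJ.
  rewrite -[RHS](hb J n m rJ _ n0 rmn _ nJ); last 2 first.
  - by nia.
  - by lia.
  by apply: eq_bigr => v _; rewrite coefZ.
pose J1 := (N1 + r)%N.
pose P : {poly K} := \poly_(i < N1) (Q * eJ J1)`_i.
exists P, Q, J1; split=> //.
  by rewrite coef_poly /= coef0M Q0 eJ_coef0 mulr1.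
have J2 : (J1 < 2 ^ J1)%N by rewrite ltn_expl.
move=> J hJ i hi; rewrite coef_poly; case: ltnP => h.
  by apply: (eqmodX_mull Q (eJ_stab hJ)); rewrite /J1 in J2 *; lia.
apply: vanish => //; have : (2 ^ J1 <= 2 ^ J)%N by rewrite leq_exp2l.
by rewrite /J1 in J2 *; lia.
Qed.

Lemma coboundary : exists B : {poly K}, B`_0 != 0 /\
  forall m, (1 < m)%N -> q m * B = B \Po 'X^m.
Proof.
have [P [Q [N [P0 Q0 h]]]] := inverse_rational.
have Pn0 : P != 0 by apply/eqP => e; move: P0; rewrite e coef0 => /eqP; rewrite eq_sym oner_eq0.
have main m : (1 < m)%N -> q m * Q * (P \Po 'X^m) = (Q \Po 'X^m) * P.
  move=> m1; apply: eqmodX_eq => M.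
  pose J := (M + N)%N; have hJ := h J (leq_addl _ _).
  have MJ : (M <= 2 ^ J)%N by rewrite (leq_trans (leq_addr N M))// ltnW// ltn_expl.
  apply: (eqmodX_leq MJ).
  apply: (@eqmodX_trans _ _ (q m * Q * ((Q * eJ J) \Po 'X^m))).
    apply/eqmodX_mull/eqmodX_sym; apply: (@eqmodX_leq _ (m * 2 ^ J)).
      by rewrite leq_pmull// ltnW.
    by apply: eqmodX_comp => //; exact: ltnW.
  apply: (@eqmodX_trans _ _ ((Q \Po 'X^m) * (Q * eJ J))); last exact: eqmodX_mull.
  rewrite comp_polyM; have := eqmodX_mull (Q * (Q \Po 'X^m)) (@eJ_refine J m m1).
  have -> : Q * (Q \Po 'X^m) * (q m * (eJ J \Po 'X^m)) =
    q m * Q * ((Q \Po 'X^m) * (eJ J \Po 'X^m)) by ring.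
  by have -> : Q * (Q \Po 'X^m) * eJ J = (Q \Po 'X^m) * (Q * eJ J) by ring.
pose g := gcdp P Q; pose P' := P %/ g; pose Q' := Q %/ g.
have PE : P = P' * g by rewrite divpK// dvdp_gcdl.
have QE : Q = Q' * g by rewrite divpK// dvdp_gcdr.
have g0 : g != 0 by rewrite gcdp_eq0 (negbTE Pn0).
have cop : coprimep P' Q' by rewrite /P' /Q'; apply: coprimep_div_gcd; rewrite Pn0.
have compn0 (A : {poly K}) m : (0 < m)%N -> A != 0 -> A \Po 'X^m != 0.
  by move=> m0; rewrite comp_poly_eq0// size_polyXn.
have main' m : (1 < m)%N -> q m * Q' * (P' \Po 'X^m) = (Q' \Po 'X^m) * P'.
  move=> m1; have gm := compn0 g m (ltnW m1) g0.
  apply: (mulIf (mulf_neq0 g0 gm)); have := main m m1; rewrite {1 2}PE {1 2}QE !comp_polyM.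
  move=> E; transitivity (q m * (Q' * g) * ((P' \Po 'X^m) * (g \Po 'X^m))); first by ring.
  by rewrite E; ring.
have P'n0 : P' != 0 by apply: contraNneq Pn0 => e; rewrite PE e mul0r.
(* P'(X^2) divides Q'(X^2) P' and is coprime to Q'(X^2), so it divides P', although its degree is
   twice as large. Hence P' is constant and the polynomial Q' is a multiple of 1/A. *)
have szP' : size P' = 1%N.
  have dv : (P' \Po 'X^2) %| P'.
    rewrite -(@Gauss_dvdpr _ _ (Q' \Po 'X^2)); last exact: coprimep_comp_poly.
    by rewrite -main'// dvdp_mull.
  have := dvdp_leq P'n0 dv; have := @size_comp_poly _ P' 'X^2.
  have := compn0 P' 2%N isT P'n0; rewrite size_polyXn/= -size_poly_eq0.
  move: (P'n0); rewrite -size_poly_eq0.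
  by case: (size (P' \Po 'X^2)) => [|?]; case: (size P') => [|?] //=; lia.
have [c c0 P'E] : exists2 c, c != 0 & P' = c%:P.
  by have /eqP/size_poly1P := szP'.
exists Q'; split.
  by apply/eqP => e; move: Q0; rewrite QE coef0M e mul0r => /eqP; rewrite eq_sym oner_eq0.
move=> m m1; have := main' m m1; rewrite P'E comp_polyC; apply: mulIf.
by rewrite polyC_eq0.
Qed.

End Coboundary.

Section Valuation.
Variable K : fieldType.
Implicit Types A B : {poly K}.

Lemma valuation_exists A : A != 0 -> exists v B, B`_0 != 0 /\ A = B * 'X^v.
Proof.
move=> A0; have [v [B hB ->]] := multiplicity_XsubC A 0.
by exists v, B; rewrite subr0 -horner_coef0; split=> //; move: hB; rewrite A0.
Qed.

Lemma valuation_uniq A B v w : A`_0 != 0 -> B`_0 != 0 ->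
  A * 'X^v = B * 'X^w -> v = w /\ A = B.
Proof.
wlog vw : A B v w / (v <= w)%N.
  move=> W A0 B0 E; case: (leqP v w) => h; first exact: W.
  by have [] := W B A w v (ltnW h) B0 A0 (esym E) => -> ->.
move=> A0 B0 E; have {}E : A = B * 'X^(w - v).
  apply: (@mulIf _ ('X^v)); first by rewrite monic_neq0// monicXn.
  by rewrite E -mulrA -exprD subnK.
move: E A0; case: (posnP (w - v)%N) => [e|h] ->.
  by rewrite e expr0 mulr1 => _; split=> //; lia.
by rewrite coefMXn h eqxx.
Qed.

End Valuation.

(** * The symbol of a refinable functional *)

Section Refinable.
Variable K : numFieldType.
Variables (T : {poly K} -> K) (k : nat) (p : nat -> {poly K}).
Hypothesis Tlin : forall c P G, T (c *: P + G) = c * T P + T G.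
Hypothesis Tn0 : exists P, T P != 0.
Hypothesis Tp : forall m, (1 < m)%N -> forall P, T (scalep m%:R P) = T (opE (p m) P).
Hypothesis psz : forall m, (1 < m)%N -> (size (p m) <= m.-1 * k + 1)%N.

Lemma T0 : T 0 = 0.
Proof. by have := Tlin 1 0 0; rewrite scaler0 addr0 mul1r -{1}[T 0]addr0 => /addrI. Qed.
Lemma TZ c P : T (c *: P) = c * T P.
Proof. by have := Tlin c P 0; rewrite T0 !addr0. Qed.
Lemma TB P G : T (P - G) = T P - T G.
Proof. by rewrite addrC -scaleN1r Tlin mulN1r addrC. Qed.

(** A nonzero Q - Q' would give a surjective operator (Q - Q')(S), and T would vanish on its
    image. *)
Lemma symbol_uniq Q Q' : (forall P, T (opE Q P) = T (opE Q' P)) -> Q = Q'.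
Proof.
move=> h; apply/eqP; rewrite -subr_eq0; apply/negPn/negP => n0.
have [P] := Tn0; have [G <-] := opE_surj P n0.
by rewrite opEBl TB h subrr eqxx.
Qed.

(** Dilation by mn can be carried out in two orders, and the symbol of the result is unique. *)
Lemma symbol_comm m n : (1 < m)%N -> (1 < n)%N ->
  (p m \Po 'X^n) * p n = (p n \Po 'X^m) * p m.
Proof.
have H a b P : (1 < a)%N -> (1 < b)%N ->
    T (scalep a%:R (scalep b%:R P)) = T (opE ((p a \Po 'X^b) * p b) P).
  by move=> a1 b1; rewrite Tp// opE_scalep ?(ltnW b1)// Tp// mulrC -opEM.
move=> m1 n1; apply: symbol_uniq => P.
by rewrite -!H// !scalepM mulrC.
Qed.

Lemma symbol_neq0 m : (1 < m)%N -> p m != 0.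
Proof.
move=> m1; have [P P0] := Tn0; apply/eqP => e.
have := Tp m1 (scalep m%:R^-1 P); rewrite scalepM mulVf ?pnatr_eq0; last by lia.
rewrite e opE0l T0; have -> : scalep 1 P = P by rewrite /scalep scale1r comp_polyXr.
by move=> h; rewrite h eqxx in P0.
Qed.

(** [coboundary] wants constant coefficients equal to 1, so the powers of X are split off first:
    commutation with p_2 forces the valuation of p_m to be m - 1 times that of p_2, and likewise for
    the degrees. The bound on B comes from p_2 B = c B(X^2), which gives deg B = deg p_2. *)
Lemma symbol_coboundary : exists B : {poly K}, [/\ B != 0, (size B <= k.+1)%N &
  forall m, (1 < m)%N -> exists2 c, c != 0 & p m * B = c *: (B \Po 'X^m)].
Proof.
have [v2 [q2 [q20 p2E]]] := valuation_exists (symbol_neq0 (isT : 1 < 2)%N).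
pose r := (size q2).-1.
have q2n0 : q2 != 0 by apply: contraNneq q20 => ->; rewrite coef0.
have mE m : (1 < m)%N -> exists q : {poly K}, [/\ q`_0 != 0, p m = q * 'X^(m.-1 * v2),
     (q \Po 'X^2) * q2 = (q2 \Po 'X^m) * q & size q = (m.-1 * r).+1].
  move=> m1; have [v [q [q0 pE]]] := valuation_exists (symbol_neq0 m1).
  have qn0 : q != 0 by apply: contraNneq q0 => ->; rewrite coef0.
  have := symbol_comm m1 (isT : 1 < 2)%N; rewrite pE p2E !comp_polyM !comp_Xn_poly -!exprM.
  move=> E; have : ((q \Po 'X^2) * q2) * 'X^(2 * v + v2) = ((q2 \Po 'X^m) * q) * 'X^(m * v2 + v).
    by rewrite (exprD _ (2 * v)) (exprD _ (m * v2)) mulrACA E mulrACA.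
  have c0 (A : {poly K}) j : (0 < j)%N -> (A \Po 'X^j)`_0 = A`_0.
    by move=> j0; rewrite coef_comp_poly_Xn// dvdn0 div0n.
  have m0 := ltnW m1.
  case/valuation_uniq; rewrite ?coef0M ?c0 ?mulf_neq0// => hv hq.
  have vE : v = (m.-1 * v2)%N by case: m m1 m0 hv {pE E hq} => //= m; lia.
  exists q; rewrite -vE; split=> //.
  have := congr1 (fun A : {poly K} => size A) hq.
  rewrite !size_mul ?comp_poly_eq0 ?size_polyXn//.
  have := size_comp_poly q 'X^2; have := size_comp_poly q2 'X^m; rewrite !size_polyXn/=.
  rewrite /r; move: (qn0) (q2n0); rewrite -!size_poly_eq0.
  have : q \Po 'X^2 != 0 by rewrite comp_poly_eq0 ?size_polyXn.
  have : q2 \Po 'X^m != 0 by rewrite comp_poly_eq0 ?size_polyXn.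
  rewrite -!size_poly_eq0.
  case: (size q) => [|a]//; case: (size q2) => [|b]//; case: (size _) => [|c]//.
  case: (size _) => [|d]//= _ _ _ _; case: m m1 m0 {hv hq E pE vE} => //= m m1 _.
  by rewrite mulnS; lia.
pose cond m (q : {poly K}) := [/\ q`_0 != 0, p m = q * 'X^(m.-1 * v2),
     (q \Po 'X^2) * q2 = (q2 \Po 'X^m) * q & size q = (m.-1 * r).+1].
have q2E : cond 2 q2.
  split=> //; rewrite /r; first by rewrite mul1n.
  by rewrite mul1n prednK// size_poly_gt0.
pose q m := (p m %/ 'X^(m.-1 * v2)).
have qE m : (1 < m)%N -> cond m (q m).
  move=> m1; have [q' [h1 h2 h3 h4]] := mE m m1.
  suff -> : q m = q' by [].
  by rewrite /q h2 mulpK// monic_neq0// monicXn.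
have q2_ : q 2 = q2 by rewrite /q p2E mul1n mulpK// monic_neq0// monicXn.
pose c m := (q m)`_0.
have c0 m : (1 < m)%N -> c m != 0 by case/qE.
have := @coboundary K (fun m => (c m)^-1 *: q m) r.
case.
- by move=> m m1; rewrite coefZ mulVf// c0.
- move=> m m1; case: (qE m m1) => _ _ _ h; rewrite (leq_trans (size_scale_leq _ _))// h; lia.
- move=> m m1; case: (qE m m1) => _ _ h _; rewrite !comp_polyZ -!scalerAl -!scalerAr q2_ h.
  by rewrite !scalerA mulrC.
move=> B' [B0 hB].
have B'n0 : B' != 0 by apply: contraNneq B0 => ->; rewrite coef0.
have main m : (1 < m)%N -> p m * (B' * 'X^v2) = c m *: ((B' * 'X^v2) \Po 'X^m).
  move=> m1; case: (qE m m1) => _ -> _ _; have := hB m m1.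
  rewrite -scalerAl => /(congr1 (fun A => c m *: A)); rewrite scalerA mulfV ?c0// scale1r => E.
  rewrite mulrACA E -exprD comp_polyM comp_Xn_poly -exprM -scalerAl; congr (_ *: (_ * 'X^_)).
  by case: m m1 {E} => //= m _; rewrite mulSn; lia.
have Bn0 : B' * 'X^v2 != 0 by rewrite mulf_neq0// monic_neq0// monicXn.
exists (B' * 'X^v2); split=> //; last by move=> m m1; exists (c m); [exact: c0|exact: main].
have := congr1 (fun A : {poly K} => size A) (main 2%N isT).
rewrite size_mul ?symbol_neq0// size_scale ?c0//.
have := size_comp_poly (B' * 'X^v2) 'X^2; rewrite size_polyXn/=.
have := psz (isT : 1 < 2)%N; rewrite mul1n.
have := symbol_neq0 (isT : 1 < 2)%N; move: (Bn0).
have : (B' * 'X^v2) \Po 'X^2 != 0 by rewrite comp_poly_eq0 ?size_polyXn.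
rewrite -!size_poly_eq0.
set X := B' * 'X^v2; case: (size (p 2)) => [|a]; case: (size X) => [|b];
  by case: (size (X \Po 'X^2)) => [|d] //=; lia.
Qed.

(** T(P^(u)) depends on B(S) P only, so it is H(B(S) P) for a linear H, and p_2 B = c B(X^2) makes H
    homogeneous under dilation by 2. Since X^i has weight 2^i, H is nonzero on a single power
    X^n. *)
Theorem refinable_functional : exists (B Q1 : {poly K}) (u n : nat) (g : K),
  [/\ B = Q1 * ('X - 1) ^+ u, Q1.[1] != 0, (size B <= k.+1)%N,
   (forall m, (1 < m)%N -> B %| (B \Po 'X^m)) &
   g != 0 /\ forall P, T P^`(u) = g * (opE B P)`_n].
Proof.
have [B [B0 Bs hB]] := symbol_coboundary.
have [u [Q1 hQ1 BE]] := multiplicity_XsubC B 1.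
rewrite B0/= in hQ1; rewrite polyC1 in BE.
have [S hS] : exists S : {poly K} -> {poly K}, forall Q, opE B (S Q) = Q.
  have h Q : {P | opE B P == Q}.
    by apply: sigW; have [P <-] := opE_surj Q B0; exists P.
  by exists (fun Q => sval (h Q)) => Q; exact/eqP/(svalP (h Q)).
pose H Q := T (S Q)^`(u).
have HE P : H (opE B P) = T P^`(u).
  rewrite /H; apply/eqP; rewrite -subr_eq0 -TB -derivnB BE.
  by rewrite (opE_ker hQ1) ?T0// -BE linearB/= hS subrr.
have Hlin c P G : H (c *: P + G) = c * H P + H G.
  by rewrite -{1}[P]hS -{1}[G]hS -linearP HE derivnD derivnZ Tlin.
have [c [c0 Hc]] : exists c, c != 0 /\ forall Q, H (scalep 2%:R Q) = c * H Q.
  have [c c0 pB] := hB 2%N isT.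
  exists (2%:R ^+ u * c); split; first by rewrite mulf_neq0// expf_neq0// pnatr_eq0.
  move=> Q; have B2 : B \Po 'X^2 != 0 by rewrite comp_poly_eq0 ?size_polyXn.
  have [Y <-] := opE_surj Q B2.
  rewrite -opE_scalep// HE derivn_scalep TZ Tp// -derivn_opE -HE -opEM.
  have H0 : H 0 = 0.
    by have := Hlin 1 0 0; rewrite scaler0 addr0 mul1r -{1}[H 0]addr0 => /addrI.
  rewrite [B * _]mulrC pB opEZl -[c *: _]addr0 Hlin H0 addr0 mulrA; congr (_ * H _).
have H0 : H 0 = 0.
  by have := Hlin 1 0 0; rewrite scaler0 addr0 mul1r -{1}[H 0]addr0 => /addrI.
have HsumE Q : H Q = \sum_(i < size Q) Q`_i * H 'X^i.
  rewrite -{1}[Q]coefK poly_def.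
  elim/big_rec2: _ => [|i y1 y2 _ IH]; first exact: H0.
  by rewrite Hlin IH.
have Hs i : 2%:R ^+ i * H 'X^i = c * H 'X^i.
  rewrite -Hc -[scalep _ _]addr0.
  have -> : scalep 2%:R 'X^i = 2%:R ^+ i *: ('X^i : {poly K}).
    by rewrite /scalep comp_Xn_poly exprZn.
  by rewrite Hlin H0 addr0.
have [n Hn] : exists n, H 'X^n != 0.
  have [P P0] := Tn0; have [G hG] := derivn_surj u P.
  rewrite -hG -HE HsumE in P0.
  have [i hi|h] := pickP (fun i : 'I_(size (opE B G)) => H 'X^i != 0); first by exists i.
  by move: P0; rewrite big1 ?eqxx// => i _; rewrite (eqP (negbFE (h i))) mulr0.
exists B, Q1, u, n, (H 'X^n); split=> //.
  move=> m m1; have [d d0 hd] := hB m m1.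
  by rewrite -(dvdpZr _ _ d0) -hd dvdp_mull.
split=> // P; rewrite -HE HsumE.
have Hi i : i != n -> H 'X^i = 0.
  move=> hi; apply/eqP/negPn/negP => Hi0.
  have /(mulIf Hi0) e1 := Hs i; have /(mulIf Hn) e2 := Hs n.
  move: hi; rewrite -e2 in e1; move/eqP: e1; rewrite -!natrX eqr_nat eqn_exp2l//.
  by move=> /eqP->; rewrite eqxx.
have [h|h] := ltnP n (size (opE B P)).
  rewrite (bigD1 (Ordinal h))//= big1 ?addr0 1?mulrC// => i hi.
  by rewrite Hi ?mulr0//.
rewrite [in RHS]nth_default// mulr0 big1// => i _; rewrite Hi ?mulr0//.
by rewrite ltn_eqF// (leq_trans (ltn_ord i)).
Qed.

End Refinable.

(** * Families of finitely supported measures indexed by knots *)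

Section KnotLists.
Implicit Types (a X : seq rat) (x : rat).

Lemma sorted_subset_subseq a X : sorted <%R a -> sorted <%R X ->
  {subset a <= X} -> subseq a X.
Proof.
move=> sa sX aX; have -> : a = [seq x <- X | x \in a]; last exact: filter_subseq.
apply: (irr_sorted_eq lt_trans ltxx) => //.
  by apply: sorted_filter => //; exact: lt_trans.
by move=> x; rewrite mem_filter andb_idr// => /aX.
Qed.

Definition win k j X := take k.+1 (drop j X).
Definition isknots k a := (size a == k.+1) && sorted <%R a.

Lemma size_win k j X : (j + k < size X)%N -> size (win k j X) = k.+1.
Proof. by move=> h; rewrite size_takel// size_drop; lia. Qed.

Lemma win_sorted k j X : sorted <%R X -> sorted <%R (win k j X).
Proof. by move=> h; apply/take_sorted/drop_sorted. Qed.

Lemma win_isknots k j X : sorted <%R X -> (j + k < size X)%N -> isknots k (win k j X).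
Proof. by move=> sX h; rewrite /isknots size_win// eqxx win_sorted. Qed.

Lemma nth_win k j X i : (i <= k)%N -> (win k j X)`_i = X`_(j + i).
Proof. by move=> h; rewrite nth_take// nth_drop. Qed.

Lemma win_map (g : nat -> rat) k j n : (j + k < n)%N ->
  win k j (map g (iota 0 n)) = map g (iota j k.+1).
Proof.
move=> h; rewrite /win -map_drop -map_take drop_iota take_iota add0n; congr map.
by congr iota; lia.
Qed.

Lemma win_full k a : size a = k.+1 -> win k 0 a = a.
Proof. by move=> h; rewrite /win drop0 take_oversize// h. Qed.

Lemma sorted_map_iota (g : nat -> rat) j n : (forall i, g i < g i.+1) ->
  sorted <%R (map g (iota j n)).
Proof.
move=> hg; rewrite sorted_map; apply: (@sub_sorted _ ltn); last exact: iota_ltn_sorted.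
by move=> x y xy /=; exact: (homo_ltn lt_trans hg xy).
Qed.

Lemma sorted_nth_lt a i j : sorted <%R a -> (i < j < size a)%N -> a`_i < a`_j.
Proof.
move=> sa /andP[ij ja]; have := @sorted_ltn_nth rat <%R lt_trans 0 a sa i j.
by rewrite !inE; apply => //; exact: ltn_trans ja.
Qed.

Lemma sorted_nth_le a i j : sorted <%R a -> (i <= j)%N -> (j < size a)%N -> a`_i <= a`_j.
Proof.
move=> sa; rewrite leq_eqVlt => /predU1P[->//|ij] ja.
by apply/ltW/sorted_nth_lt; rewrite ?ij.
Qed.

Lemma sorted_nth_inj a i j : sorted <%R a -> (i < size a)%N -> (j < size a)%N ->
  a`_i = a`_j -> i = j.
Proof.
move=> sa ia ja e; case: (ltngtP i j) => // h.
  by have := @sorted_nth_lt a i j sa; rewrite h ja e ltxx => /(_ isT).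
by have := @sorted_nth_lt a j i sa; rewrite h ia e ltxx => /(_ isT).
Qed.

Definition rem_at i X := take i X ++ drop i.+1 X.

Lemma size_rem_at i X : (i < size X)%N -> size (rem_at i X) = (size X).-1.
Proof. by move=> iX; rewrite size_cat size_takel ?size_drop ?(ltnW iX)//; lia. Qed.

Lemma rem_at_isknots k i X : sorted <%R X -> size X = k.+2 -> (i < size X)%N ->
  isknots k (rem_at i X).
Proof.
move=> oX sX iX; rewrite /isknots size_rem_at// sX eqxx; apply: (subseq_sorted lt_trans _ oX).
rewrite -{2}(cat_take_drop i X) cat_subseq// (drop_nth 0 iX); exact: subseq_cons.
Qed.

Lemma nth_rem_at i X m : (i < size X)%N ->
  (rem_at i X)`_m = if (m < i)%N then X`_m else X`_m.+1.
Proof.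
move=> iX; rewrite nth_cat size_takel ?(ltnW iX)//; case: ltnP => h; first by rewrite nth_take.
by rewrite nth_drop; congr nth; lia.
Qed.

Lemma win_rem_ge i j k X : (i <= j)%N -> (j.+1 + k < size X)%N ->
  win k j (rem_at i X) = win k j.+1 X.
Proof.
move=> ij jX; have iX : (i < size X)%N by lia.
have sw : size (win k j (rem_at i X)) = k.+1 by apply: size_win; rewrite size_rem_at; lia.
apply: (@eq_from_nth _ 0) => [|m]; rewrite sw ?size_win// => hm.
by rewrite !nth_win// nth_rem_at// ltnNge (leq_trans ij (leq_addr _ _)).
Qed.

Lemma win_rem_lt i j k X : (j + k < i)%N -> (i < size X)%N ->
  win k j (rem_at i X) = win k j X.
Proof.
move=> ji iX.
have sw : size (win k j (rem_at i X)) = k.+1 by apply: size_win; rewrite size_rem_at; lia.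
apply: (@eq_from_nth _ 0) => [|m]; rewrite sw ?size_win//; [lia|] => hm.
by rewrite !nth_win// nth_rem_at//; case: ltnP => //; lia.
Qed.

Lemma win_rem_mid i j k X : (j <= i <= j + k)%N -> (j + k.+1 < size X)%N ->
  win k j (rem_at i X) = rem_at (i - j) (win k.+1 j X).
Proof.
move=> /andP[ji ijk] jX; have iX : (i < size X)%N by lia.
have s1 : size (win k.+1 j X) = k.+2 by rewrite size_win.
have h1 : (i - j < k.+2)%N by lia.
have sw : size (win k j (rem_at i X)) = k.+1 by apply: size_win; rewrite size_rem_at; lia.
apply: (@eq_from_nth _ 0) => [|m]; rewrite sw ?size_rem_at ?s1// => hm.
rewrite nth_win// !nth_rem_at ?s1//.
have -> : (j + m < i)%N = (m < i - j)%N by lia.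
by case: ltnP => _; rewrite nth_win ?addnS//; lia.
Qed.

Lemma take_win j k X : (j + k.+1 < size X)%N -> take k.+1 (win k.+1 j X) = win k j X.
Proof. by move=> h; rewrite /win take_takel. Qed.

Lemma behead_win j k X : behead (win k.+1 j X) = win k j.+1 X.
Proof. by rewrite /win -drop1 -[k.+2]addn1 -take_drop drop_drop. Qed.

End KnotLists.

Section Refinement.
Variables (K : fieldType) (V : lmodType K) (k : nat) (G : seq rat -> V).

Definition span_law := forall (al : seq rat) (j : nat), sorted <%R al -> size al = k.+2 ->
  (0 < j <= k)%N -> exists c d : K,
    G (rem_at j al) = c *: G (take k.+1 al) + d *: G (behead al).

(** Induction on the number of points. After deletion of a point of X outside of [a], each window of
    the shorter list is a window of X or k + 2 consecutive points of X without an interior one; the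
    span law rewrites the latter. The values lie in any module, as the lemma serves for measures and
    for functionals. *)
Lemma span_law_refine : span_law -> forall X a : seq rat, sorted <%R X -> subseq a X -> size a = k.+1 ->
  exists c : nat -> K, G a = \sum_(j < size X - k) c j *: G (win k j X).
Proof.
move=> HG X; have [n] := ubnP (size X); elim: n X => // n IH X; rewrite ltnS => hn a sX aX sa.
pose insp v := exists c : nat -> K, v = \sum_(j < size X - k) c j *: G (win k j X).
have inspD u v : insp u -> insp v -> insp (u + v).
  move=> [c ->] [d ->]; exists (fun i => c i + d i); rewrite -big_split/=.
  by apply: eq_bigr => i _; rewrite scalerDl.
have inspZ c v : insp v -> insp (c *: v).
  move=> [d ->]; exists (fun i => c * d i); rewrite scaler_sumr.
  by apply: eq_bigr => i _; rewrite scalerA.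
have insp0 : insp 0 by exists (fun=> 0); rewrite big1// => i _; rewrite scale0r.
have inspW j : (j < size X - k)%N -> insp (G (win k j X)).
  move=> hj; exists (fun i => (i == j)%:R); rewrite (bigD1 (Ordinal hj))//= eqxx scale1r.
  by rewrite big1 ?addr0// => i; rewrite -val_eqE/= => /negbTE->; rewrite scale0r.
have := size_subseq_leqif aX; rewrite sa => -[h1 h2].
move: h1; rewrite leq_eqVlt h2 => /predU1P[e|h1].
  have hX : size X = k.+1 by rewrite -e.
  have -> : a = win k 0 X by rewrite win_full.
  by apply: inspW; rewrite hX subSnn.
have [x xX xa] : exists2 x, x \in X & x \notin a.
  have [/hasP[x xX xa]|/hasPn h] := boolP (has (fun x => x \notin a) X); first by exists x.
  have: (size X <= size a)%N.
    apply: uniq_leq_size; first exact: (sorted_uniq lt_trans ltxx).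
    by move=> x /h; rewrite negbK.
  by rewrite sa leqNgt h1.
pose i := index x X; have iX : (i < size X)%N by rewrite index_mem.
pose X' := rem_at i X.
have sX' : size X' = (size X).-1 by rewrite size_rem_at.
have X'X : subseq X' X.
  rewrite -{1}(cat_take_drop i X) cat_subseq// (drop_nth x iX); exact: subseq_cons.
have soX' : sorted <%R X' by exact: (subseq_sorted lt_trans X'X).
have aX' : subseq a X'.
  apply: sorted_subset_subseq => //; first exact: (subseq_sorted lt_trans aX).
  move=> y ya; have := mem_subseq aX ya; rewrite -{1}(cat_take_drop i X) (drop_nth x iX).
  rewrite /X' !mem_cat inE nth_index// => /or3P[->//|/eqP e|->]; last by rewrite orbT.
  by move: xa; rewrite -e ya.
have [|c ->] := IH X' _ a soX' aX' sa; first by rewrite sX'; lia.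
apply: (big_ind insp) => // -[j hj] _; apply: (inspZ); rewrite /= sX' in hj *.
have hj' : (j + k < (size X).-1)%N by lia.
have [ij|ji] := leqP i j; first by rewrite win_rem_ge//; [apply: inspW|]; lia.
have [ijk|ijk] := ltnP (j + k) i; first by rewrite win_rem_lt//; apply: inspW; lia.
have hjX : (j + k.+1 < size X)%N by lia.
rewrite win_rem_mid ?(ltnW ji)//.
have [|c1 [d1 ->]] := HG _ (i - j)%N (win_sorted k.+1 j sX) (size_win hjX); first by lia.
by rewrite take_win// behead_win; apply: (inspD); apply: (inspZ); apply: (inspW); lia.
Qed.

End Refinement.

Definition aff (d t : rat) (a : seq rat) := [seq d * x + t | x <- a].
Definition ints k : seq rat := [seq i%:R | i <- iota 0 k.+1].

Lemma size_ints k : size (ints k) = k.+1.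
Proof. by rewrite size_map size_iota. Qed.

Lemma nth_ints k i : (i <= k)%N -> (ints k)`_i = i%:R.
Proof. by move=> h; rewrite (nth_map 0%N) ?size_iota// nth_iota. Qed.

Lemma ints_isknots k : isknots k (ints k).
Proof. by rewrite /isknots size_ints eqxx sorted_map_iota// => i; rewrite ltr_nat. Qed.

Lemma aff_isknots k d t a : 0 < d -> isknots k a -> isknots k (aff d t a).
Proof.
move=> d0 /andP[sa oa]; rewrite /isknots size_map sa sorted_map /=.
by apply: sub_sorted oa => x y xy /=; rewrite ltrD2r ltr_pM2l.
Qed.

Lemma affK d t a : d != 0 -> aff d^-1 (- (t / d)) (aff d t a) = a.
Proof.
move=> d0; rewrite /aff -map_comp -[RHS]map_id; apply: eq_map => x /=; field.
by [].
Qed.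

(** * The measures charge only their knots *)

Section KnotFamily.
Variables (K : numFieldType) (k : nat).

(* [beta a x] is the mass at [x] of a finitely supported measure attached to the
   knots [a]. *)
Record knotfam (beta : seq rat -> rat -> K) : Prop := Knotfam {
  kf_span : forall (al : seq rat) (j : nat), sorted <%R al -> size al = k.+2 ->
    (0 < j <= k)%N -> exists c d : K, forall x,
    beta (rem_at j al) x = c * beta (take k.+1 al) x + d * beta (behead al) x;
  kf_aff : forall (a : seq rat) (d t : rat), isknots k a -> 0 < d ->
    exists2 c, c != 0 & forall x, beta (aff d t a) (d * x + t) = c * beta a x;
  kf_ints : forall x, beta (ints k) x != 0 -> exists2 i, (i <= k)%N & x = i%:R }.

Variable beta : seq rat -> rat -> K.
Hypothesis Hb : knotfam beta.

Lemma kf_refine (X a : seq rat) : sorted <%R X -> subseq a X -> size a = k.+1 ->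
  exists c : nat -> K, forall x, beta a x = \sum_(j < size X - k) c j * beta (win k j X) x.
Proof.
move=> sX aX sa; have [|c E] := @span_law_refine K (rat -> K^o) k beta _ X a sX aX sa.
  move=> al j sal szal hj; have [c [d E]] := kf_span Hb sal szal hj.
  by exists c, d; apply/funext => x; rewrite E !fctE.
exists c => x; rewrite E; elim/big_rec2: _ => // i y f _ <-.
by rewrite !fctE.
Qed.

Lemma kf_aff_eq0 a d t x : isknots k a -> 0 < d ->
  (beta (aff d t a) (d * x + t) == 0) = (beta a x == 0).
Proof.
by move=> ha d0; have [c c0 ->] := kf_aff Hb t ha d0; rewrite mulf_eq0 (negbTE c0).
Qed.

Lemma kf_unif d t x : 0 < d -> beta (aff d t (ints k)) x != 0 ->
  exists2 i, (i <= k)%N & x = d * i%:R + t.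
Proof.
move=> d0; have -> : x = d * (d^-1 * (x - t)) + t by rewrite mulVKf ?lt0r_neq0// subrK.
rewrite kf_aff_eq0 ?ints_isknots// => /(kf_ints Hb)[i ik ->].
by exists i.
Qed.

(* The increasing enumeration, from [- L] on, of the integers outside of the hole
   [1, M - 1]. *)
Definition holegrid (M L i : nat) : rat :=
  if (i <= L)%N then i%:R - L%:R else (M + (i - L.+1))%:R.

Definition holewin M j := [seq holegrid M k i | i <- iota j k.+1].

Lemma holegrid_lt M L i : (0 < M)%N -> holegrid M L i < holegrid M L i.+1.
Proof.
move=> M0; rewrite /holegrid; case: ltngtP => h.
- by rewrite ltrD2r ltr_nat.
- by rewrite ltr_nat; lia.
- by rewrite h subnn addn0 subrr ltr0n.
Qed.

Lemma holegrid_sorted M L j n : (0 < M)%N -> sorted <%R [seq holegrid M L i | i <- iota j n].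
Proof. by move=> M0; apply: sorted_map_iota => i; exact: holegrid_lt. Qed.

Lemma holewin_isknots M j : (0 < M)%N -> isknots k (holewin M j).
Proof. by move=> M0; rewrite /isknots size_map size_iota eqxx holegrid_sorted. Qed.

(** A window on one side of the hole is a translate of [ints k], whose measure stays on its knots.
    Only the windows that straddle the hole charge it, and their number is bounded independently of
    M. *)
Lemma hole_windows M L i : (0 < M)%N -> (k <= L)%N -> (i + k < L.*2.+2)%N ->
  let w := win k i [seq holegrid M L j | j <- iota 0 L.*2.+2] in
  (forall x, 0 < x < M%:R -> beta w x = 0) \/ exists j : 'I_k.+2, w = holewin M j.
Proof.
have iotaE n : iota n k.+1 = map (addn n) (iota 0 k.+1) by rewrite -iotaDl addn0.
move=> M0 kL hi w; rewrite {}/w win_map//.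
have [h|h] := leqP i (L - k).
  left=> x /andP[x0 xM]; apply/eqP/negPn/negP.
  have -> : [seq holegrid M L j | j <- iota i k.+1] = aff 1 (i%:R - L%:R) (ints k).
    rewrite /aff /ints [iota i _]iotaE -!map_comp; apply/eq_in_map => m.
    rewrite mem_iota => /andP[_ hm] /=; rewrite /holegrid ifT; last by lia.
    by rewrite natrD; ring.
  move=> /kf_unif[//|m mk]; rewrite mul1r => xE.
  move: x0; rewrite xE addrA -natrD subr_gt0 ltr_nat; lia.
have [h'|h'] := leqP i L.
  right; have hj : (i - (L - k) < k.+2)%N by lia.
  exists (Ordinal hj); rewrite /holewin [nat_of_ord _]/=.
  rewrite [iota i _]iotaE [iota (i - _) _]iotaE -!map_comp.
  apply/eq_in_map => m; rewrite mem_iota => /andP[_ hm] /=.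
  rewrite /holegrid; have -> : (i + m <= L)%N = (i - (L - k) + m <= k)%N by lia.
  case: ifP => h3; last by congr (_%:R); lia.
  have -> : (i + m = (i - (L - k) + m) + (L - k))%N by lia.
  by rewrite natrD (natrB _ kL); ring.
left=> x /andP[x0 xM]; apply/eqP/negPn/negP.
have -> : [seq holegrid M L j | j <- iota i k.+1] = aff 1 (M + (i - L.+1))%:R (ints k).
  rewrite /aff /ints [iota i _]iotaE -!map_comp; apply/eq_in_map => m.
  rewrite mem_iota => /andP[_ hm] /=; rewrite /holegrid ifF; last by lia.
  by rewrite mul1r -natrD; congr (_%:R); lia.
move=> /kf_unif[//|m mk]; rewrite mul1r => xE.
by move: xM; rewrite xE -natrD ltr_nat; lia.
Qed.

Lemma int_bound (a : seq rat) : (forall y, y \in a -> y \is a Num.int) ->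
  exists L : nat, forall y, y \in a -> `|y| <= L%:R.
Proof.
elim: a => [|y a IH] h; first by exists 0%N.
have [|L hL] := IH; first by move=> z za; apply: h; rewrite inE za orbT.
have /intrP[z yz] := h y (mem_head _ _).
exists (maxn L `|z|%N) => u; rewrite inE => /orP[/eqP->|/hL].
  by rewrite yz -intr_norm -abszE -[X in X <= _]/(`|z|%N%:R) ler_nat leq_maxr.
by move=> h1; apply: le_trans h1 _; rewrite ler_nat leq_maxl.
Qed.

(** What matters is that k + 2 does not depend on M: inside a hole of any length the measures span a
    space of bounded dimension, which is why a maximal rank exists. *)
Lemma hole_span M a : (0 < M)%N -> isknots k a -> (forall y, y \in a -> y \is a Num.int) ->
  (forall y, y \in a -> y <= 0 \/ M%:R <= y) ->
  exists d : 'I_k.+2 -> K, forall x, 0 < x < M%:R ->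
    beta a x = \sum_j d j * beta (holewin M j) x.
Proof.
move=> M0 /andP[/eqP sa oa] ia ha; have [L0 hL0] := int_bound ia.
pose L := (L0 + k)%N.
pose X := [seq holegrid M L j | j <- iota 0 L.*2.+2].
have sX : sorted <%R X by exact: holegrid_sorted.
have aX : subseq a X.
  apply: sorted_subset_subseq => // y ya; have := hL0 y ya; have /intrP[z yz] := ia y ya.
  rewrite yz -intr_norm -[L0%:R]/((Posz L0)%:~R) ler_int => hz.
  apply/mapP; have [h|h] := ha y ya.
    rewrite yz lerz0 in h; exists (absz (Posz L + z)%R).
      by rewrite mem_iota /=; lia.
    rewrite /holegrid ifT; last by lia.
    by rewrite natr_absz ger0_norm ?intrD; [ring|lia].
  rewrite yz -[M%:R]/((Posz M)%:~R) ler_int in h.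
  exists (L.+1 + absz (z - Posz M)%R)%N; first by rewrite mem_iota /L; lia.
  rewrite /holegrid ifF; last by lia.
  by rewrite addKn natrD natr_absz ger0_norm ?intrB; [ring|lia].
have [c hc] := kf_refine sX aX sa.
have szX : size X = L.*2.+2 by rewrite size_map size_iota.
rewrite szX in hc.
have /choice[d hd] : forall i : 'I_(L.*2.+2 - k), exists d : 'I_k.+2 -> K,
    forall x, 0 < x < M%:R -> c i * beta (win k i X) x = \sum_j d j * beta (holewin M j) x.
  case=> i hi /=; have [||h|[j ->]] := @hole_windows M L i M0; try by rewrite /L; lia.
    by exists (fun=> 0) => x hx; rewrite h// mulr0 big1// => j _; rewrite mul0r.
  exists (fun j' => (j' == j)%:R * c i) => x hx; rewrite (bigD1 j)//= eqxx mul1r.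
  by rewrite big1 ?addr0// => j' /negbTE->; rewrite !mul0r.
exists (fun j => \sum_i d i j) => x hx; rewrite hc.
under [RHS]eq_bigr do rewrite mulr_suml.
by rewrite exchange_big/=; apply: eq_bigr => i _; exact: hd.
Qed.

Lemma int_span a : isknots k a -> (forall y, y \in a -> y \is a Num.int) ->
  exists (L N : nat) (c : nat -> K), forall x,
    beta a x = \sum_(j < N) c j * beta (aff 1 (j%:R - L%:R) (ints k)) x.
Proof.
move=> /andP[/eqP sa oa] ia; have [L hL] := int_bound ia.
pose X := [seq i%:R - L%:R : rat | i <- iota 0 (L.*2 + k).+1].
have sX : sorted <%R X by apply: sorted_map_iota => i; rewrite ltrD2r ltr_nat.
have aX : subseq a X.
  apply: sorted_subset_subseq => // y ya; have := hL y ya; have /intrP[z yz] := ia y ya.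
  rewrite yz -intr_norm -[L%:R]/((Posz L)%:~R) ler_int => hz.
  apply/mapP; exists (absz (Posz L + z)%R); first by rewrite mem_iota /=; lia.
  by rewrite natr_absz ger0_norm ?intrD; [ring|lia].
have [c hc] := kf_refine sX aX sa; rewrite size_map size_iota in hc.
exists L, ((L.*2 + k).+1 - k)%N, c => x; rewrite hc; apply: eq_bigr => -[j hj] _ /=.
congr (_ * beta _ _); rewrite win_map; last by lia.
have -> : iota j k.+1 = map (addn j) (iota 0 k.+1) by rewrite -iotaDl addn0.
by rewrite /aff /ints -!map_comp; apply/eq_in_map => i _ /=; rewrite natrD; ring.
Qed.

Lemma int_supp a x : isknots k a -> (forall y, y \in a -> y \is a Num.int) ->
  beta a x != 0 -> x \is a Num.int.
Proof.
move=> ka ia; have [L [N [c ->]]] := int_span ka ia; apply: contraR => hx.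
rewrite big1// => j _; apply/eqP; rewrite mulf_eq0; apply/orP; right.
apply/negPn/negP => /kf_unif[//|i ik xE]; move/negP: hx; apply; rewrite xE.
by rewrite mul1r rpredD// ?rpredB// ?natr_int.
Qed.

Lemma holewin_int M j y : y \in holewin M j -> y \is a Num.int.
Proof.
by case/mapP => i _ ->; rewrite /holegrid; case: ifP => _; rewrite ?rpredB ?natr_int.
Qed.

Lemma holewin_out M j y : y \in holewin M j -> y <= 0 \/ M%:R <= y.
Proof.
case/mapP => i _ ->; rewrite /holegrid; case: ifP => h; [left|right].
  by rewrite subr_le0 ler_nat.
by rewrite ler_nat leq_addr.
Qed.

(* The measure of some window of the integers outside of the hole charges the
   point [i] of the hole. *)
Definition singular M i := (0 < i < M)%N /\ exists j : 'I_k.+2, beta (holewin M j) i%:R != 0.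

Lemma singular_span M a (x : nat) : isknots k a -> (forall y, y \in a -> y \is a Num.int) ->
  (forall y, y \in a -> y <= 0 \/ M%:R <= y) ->
  (0 < x < M)%N -> beta a x%:R != 0 -> singular M x.
Proof.
move=> ka ia ha /andP[x0 xM]; have M0 : (0 < M)%N by exact: leq_trans xM.
have [d ->] := hole_span M0 ka ia ha; last by rewrite ltr0n ltr_nat x0 xM.
move=> h; split; first by rewrite x0.
have [j hj|hj] := pickP (fun j : 'I_k.+2 => beta (holewin M j) x%:R != 0); first by exists j.
by case/eqP: h; rewrite big1// => j _; rewrite (eqP (negbFE (hj j))) mulr0.
Qed.

Lemma aff_int (d t : rat) a y : d \is a Num.int -> t \is a Num.int ->
  (forall y, y \in a -> y \is a Num.int) -> y \in aff d t a -> y \is a Num.int.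
Proof. by move=> hd ht ha /mapP[z /ha hz ->]; rewrite rpredD// rpredM. Qed.

(** Translation by -1 carries the hole between 0 and N to the one between -1 and N - 1, which
    contains the hole between 0 and N - 1. *)
Lemma singular_pred N x : (1 < x)%N -> singular N x -> singular N.-1 x.-1.
Proof.
move=> x1 [/andP[x0 xN] [j hj]]; have N0 : (0 < N)%N by exact: leq_trans xN.
apply: (@singular_span _ (aff 1 (-1) (holewin N j))).
- exact/aff_isknots/holewin_isknots.
- by move=> y; apply: aff_int; rewrite ?rpredN1//; exact: holewin_int.
- move=> _ /mapP[y /holewin_out hy ->]; rewrite mul1r; case: hy => hy; [left; lra|right].
  by rewrite -subn1 natrB//; lra.
- by lia.
- have -> : x.-1%:R = 1 * x%:R + (-1) :> rat by rewrite -subn1 natrB 1?ltnW// mul1r.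
  by rewrite kf_aff_eq0//; exact: holewin_isknots.
Qed.

(** Column 0 stands for the left edge of the hole and is set to 0. It is kept so that multiplication
    by m maps the column indices of [M] into those of [m * M]. *)
Definition holemx M : 'M[K]_(k.+2, M) :=
  \matrix_(j, i) if (i : nat) == 0%N then 0 else beta (holewin M j) i%:R.
Definition dilmx m M : 'M[K]_(M, m * M) := \matrix_(i, i') ((i' : nat) == (m * i)%N)%:R.

(** Dilation by m keeps the knots outside of the dilated hole, so the dilated measures lie in the
    row space for mM. They charge only multiples of m, since measures with integral knots charge
    only integers. *)
Lemma holemx_dil m M : (0 < m)%N -> (0 < M)%N ->
  exists C : 'M[K]_k.+2, holemx M *m dilmx m M = C *m holemx (m * M).
Proof.
move=> m0 M0; have mM0 : (0 < m * M)%N by rewrite muln_gt0 m0.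
have m0' : 0 < m%:R :> rat by rewrite ltr0n.
have /choice[d hd] : forall j : 'I_k.+2, exists d : 'I_k.+2 -> K, forall x : nat, (0 < x < m * M)%N ->
    beta (holewin M j) (x%:R / m%:R) = \sum_j' d j' * beta (holewin (m * M) j') x%:R.
  move=> j; have kj := @holewin_isknots M j M0.
  have [c c0 hc] := kf_aff Hb 0 kj m0'.
  have [||d hd] := hole_span mM0 (aff_isknots 0 m0' kj).
  - by move=> y; apply: aff_int => //; exact: holewin_int.
  - move=> _ /mapP[y /holewin_out hy ->]; rewrite addr0; case: hy => hy; [left|right].
      by rewrite pmulr_rle0.
    by rewrite natrM ler_pM2l.
  exists (fun j' => c^-1 * d j') => x /andP[x0 xM].
  have xE : x%:R = m%:R * (x%:R / m%:R) + 0 :> rat.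
    by rewrite addr0 mulrC divfK// lt0r_neq0.
  under eq_bigr do rewrite -mulrA.
  by rewrite -mulr_sumr -hd ?ltr0n ?ltr_nat ?x0// {2}xE hc mulKf.
exists (\matrix_(j, j') d j j'); apply/matrixP => j i'; rewrite !mxE.
have [i0|i0] := posnP i'.
  rewrite big1 => [|i _]; last first.
    rewrite !mxE i0; case: (posnP i) => hi; first by rewrite mul0r.
    by rewrite ltn_eqF ?mulr0// muln_gt0 m0.
  by rewrite big1// => j' _; rewrite !mxE i0 eqxx mulr0.
have hi' : (0 < i' < m * M)%N by rewrite i0 ltn_ord.
transitivity (beta (holewin M j) (i'%:R / m%:R)); last first.
  rewrite hd//; apply: eq_bigr => j' _; rewrite !mxE gtn_eqF//.
have [/dvdnP[q qE]|ndv] := boolP (m %| i')%N.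
  have hq : (q < M)%N by move: (ltn_ord i'); rewrite qE mulnC ltn_pmul2l.
  rewrite (bigD1 (Ordinal hq))//= !mxE /= qE mulnC eqxx mulr1 natrM mulrC mulKf ?lt0r_neq0//.
  rewrite gtn_eqF; last by move: i0; rewrite qE muln_gt0 => /andP[].
  rewrite big1 ?addr0// => i; rewrite -val_eqE/= => hi; rewrite !mxE qE mulnC eqn_pmul2l//.
  by rewrite [(q == _)]eq_sym (negbTE hi) mulr0.
rewrite big1; last first.
  move=> i _; rewrite !mxE; case: ifP => _; first by rewrite mul0r.
  by case: eqP => e; [rewrite e dvdn_mulr in ndv|rewrite mulr0].
apply/esym/eqP/negPn/negP => /(int_supp (holewin_isknots _ M0)).
move=> /(_ (@holewin_int M j))/intrP[z hz].
move/negP: ndv; apply; have : (i'%:R : rat) = (m%:Z * z)%:~R.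
  by rewrite intrM -hz mulrC divfK// lt0r_neq0.
rewrite -[i'%:R]/((Posz i')%:~R) => /eqP; rewrite eqr_int => /eqP h.
by have := dvdz_mulr z (dvdzz m%:Z); rewrite -h.
Qed.

Lemma rank_dil m M : (0 < m)%N -> \rank (holemx M *m dilmx m M) = \rank (holemx M).
Proof.
move=> m0; rewrite mxrankMfree//; apply/row_freeP; exists (dilmx m M)^T.
apply/matrixP => i j; rewrite !mxE.
have hi : (m * i < m * M)%N by rewrite ltn_pmul2l.
rewrite (bigD1 (Ordinal hi))//= big1 ?addr0.
  by rewrite !mxE /= eqxx mul1r eqn_pmul2l// val_eqE.
by move=> l; rewrite -val_eqE/= => /negbTE hl; rewrite !mxE hl mul0r.
Qed.

Lemma singular_mx M (i : 'I_M) : singular M i <-> exists j, holemx M j i != 0.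
Proof.
split=> [[/andP[i0 _] [j hj]]|[j]].
  by exists j; rewrite mxE gtn_eqF.
rewrite mxE; case: posnP => [_|i0 hj]; first by rewrite eqxx.
by split; [rewrite i0 ltn_ord|exists j].
Qed.

Lemma singular_dil m M i : (0 < m)%N -> singular M i -> singular (m * M) (m * i).
Proof.
move=> m0 h; have [/andP[i0 iM] _] := h; have M0 : (0 < M)%N by exact: leq_trans iM.
have [C hC] := holemx_dil m0 M0.
have hi : (m * i < m * M)%N by rewrite ltn_pmul2l.
have [j hj] := (singular_mx (Ordinal iM)).1 h.
have [j' hj'|hj'] := pickP (fun j' => holemx (m * M) j' (Ordinal hi) != 0).
  by apply: (singular_mx (Ordinal hi)).2; exists j'.
have : (C *m holemx (m * M)) j (Ordinal hi) = 0.
  by rewrite mxE big1// => j' _; rewrite (eqP (negbFE (hj' j'))) mulr0.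
rewrite -hC mxE (bigD1 (Ordinal iM))//= big1 ?addr0.
  by rewrite [dilmx _ _ _ _]mxE /= eqxx mulr1 => /eqP; rewrite (negbTE hj).
move=> l; rewrite -val_eqE/= => /negbTE hl.
by rewrite [dilmx _ _ _ _]mxE /= eqn_pmul2l// eq_sym hl mulr0.
Qed.

(* Dilation by [m] embeds the row space of [holemx M] into that of
   [holemx (m * M)]; if [M] has maximal rank they coincide. *)
Lemma max_rank_hole : exists2 M, (0 < M)%N &
  forall m i, (0 < m)%N -> singular (m * M) i -> exists2 i', i = (m * i')%N & singular M i'.
Proof.
pose P r := `[< exists2 M, (0 < M)%N & \rank (holemx M) = r >].
have exP : exists r, P r by exists (\rank (holemx 1)); apply/asboolP; exists 1%N.
have ubP r : P r -> (r <= k.+2)%N by move=> /asboolP[M _ <-]; exact: rank_leq_row.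
case: (ex_maxnP exP ubP) => r /asboolP[M M0 Mr] rmax; exists M => // m i m0 hs.
have [/andP[i0 iM] _] := hs; have [C hC] := holemx_dil m0 M0.
have : (holemx (m * M) <= C *m holemx (m * M))%MS.
  rewrite -mxrank_leqif_sup ?submxMl// eqn_leq mxrankS ?submxMl//= -hC rank_dil// Mr rmax//.
  by apply/asboolP; exists (m * M)%N; rewrite // muln_gt0 m0.
rewrite -hC => /submxP[D hD].
have [j hj] := (singular_mx (Ordinal iM)).1 hs.
have [i' hi'|hi'] := pickP (fun i' : 'I_M => (i == m * i')%N && [exists j, holemx M j i' != 0]).
  exists i'; first by case/andP: hi' => /eqP.
  by case/andP: hi' => _ /existsP hj'; apply: (singular_mx i').2.
case/eqP: hj; rewrite hD mulmxA mxE big1// => l _; rewrite [dilmx _ _ _ _]mxE /=.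
have := hi' l; case: eqP => [_ /=|_ _]; last by rewrite mulr0.
move=> /existsPn hl; rewrite mulr1 mxE big1// => j' _.
by have := hl j'; rewrite negbK => /eqP->; rewrite mulr0.
Qed.

(* For [M] as above, the smallest singular point [l] gives the singular point
   [2 * l - 1] of the hole of length [2 * M - 1]; scaled by [2 * M], the latter
   would be a multiple of [2 * (2 * M - 1)] by a singular point below [l]. *)
Lemma no_singular M i : ~ singular M i.
Proof.
have [M0 M00 h] := max_rank_hole.
have main l : ~ singular M0 l.
  have [n] := ubnP l; elim: n l => // n IH l; rewrite ltnS => ln hl.
  have [/andP[l0 lM] _] := hl.
  have h2 := singular_dil (isT : 0 < 2)%N hl.
  have l2 : (1 < 2 * l)%N by lia.
  have M2 : (0 < 2 * M0)%N by lia.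
  have := singular_dil M2 (singular_pred l2 h2).
  have -> : (2 * M0 * (2 * M0).-1 = (2 * (2 * M0).-1) * M0)%N by lia.
  case/h => [|l' E hl']; first by lia.
  have ll' : (l <= l')%N.
    by rewrite leqNgt; apply/negP => hlt; apply: (IH l') => //; lia.
  have : ((2 * M0).-1 * l <= (2 * M0).-1 * l')%N by rewrite leq_mul2l ll' orbT.
  move: E; case: M0 M00 lM {h IH hl h2 hl' M2} => // M1 _ lM; rewrite mulnS.
  case: l l0 {ln l2} lM ll' => // l _ lM ll'; rewrite mulnS /=; nia.
move=> hs; have [/andP[i0 iM] _] := hs.
have := singular_dil M00 hs; rewrite mulnC => /h[|i' _ /main//].
exact: leq_trans iM.
Qed.

(** If x is not a knot, an affine map clearing all denominators sends x to 1 and the knots to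
    integers other than 1. These avoid the hole of length 2, so 1 would be singular. *)
Theorem kf_supp a x : isknots k a -> beta a x != 0 -> x \in a.
Proof.
move=> ka hx; apply/negPn/negP => xa.
have [D [D0 hD]] : exists D : nat, (0 < D)%N /\ forall y, y \in x :: a -> D%:R * y \is a Num.int.
  elim: (x :: a) => [|y s [D [D0 IH]]]; first by exists 1%N.
  exists (D * `|denq y|)%N; split.
    by rewrite muln_gt0 D0 absz_gt0 denq_eq0.
  have hy : `|denq y|%:R * y \is a Num.int.
    by rewrite natr_absz normr_denq mulrC -numqE intr_int.
  move=> z; rewrite inE natrM => /orP[/eqP->|/IH hz].
    by rewrite -mulrA rpredM// natr_int.
  by rewrite mulrAC rpredM// natr_int.
have D0' : 0 < D%:R :> rat by rewrite ltr0n.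
pose b := aff D%:R (1 - D%:R * x) a.
have hxi := hD x (mem_head _ _).
have : singular 2 1.
  apply: (@singular_span _ b) => //; first exact: aff_isknots.
  - move=> _ /mapP[y ya ->]; rewrite rpredD ?rpredB ?int_num1//.
    by apply: hD; rewrite inE ya orbT.
  - move=> _ /mapP[y ya ->]; have : y != x by apply: contraNneq xa => <-.
    have hyi := hD y _; rewrite inE ya orbT in hyi; have {hyi} := hyi isT.
    case/intrP: hxi => u hu /intrP[v hv]; rewrite hu hv => hyx.
    have : v != u.
      by apply: contraNneq hyx => e; rewrite -(inj_eq (mulfI (lt0r_neq0 D0'))) hu hv e.
    rewrite -[2%:R]/(2%:~R : rat) -[1]/(1%:~R : rat) -!(intrB, intrD) ler_int lerz0.
    by rewrite neq_lt => /orP[] h; [left|right]; lia.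
  have -> : 1%:R = D%:R * x + (1 - D%:R * x) :> rat by rewrite addrC subrK.
  by rewrite kf_aff_eq0.
exact: no_singular.
Qed.

End KnotFamily.

(** * Zero masses at the ends of the knots *)

Lemma sorted_cat_lt (s1 s2 : seq rat) : sorted <%R s1 -> sorted <%R s2 ->
  (forall x y, x \in s1 -> y \in s2 -> x < y) -> sorted <%R (s1 ++ s2).
Proof.
rewrite !(sorted_pairwise lt_trans) pairwise_cat => -> -> h; rewrite /= !andbT.
by apply/allrelP => x y; exact: h.
Qed.

Lemma mem_affP d t (a : seq rat) x : x \in aff d t a -> exists2 y, y \in a & x = d * y + t.
Proof. by move/mapP. Qed.

Lemma mem_intsP k x : x \in ints k -> exists2 i, (i <= k)%N & x = i%:R.
Proof. by case/mapP => i; rewrite mem_iota add0n => /andP[_ ik] ->; exists i. Qed.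

Section KnotFamilyEnds.
Variables (K : numFieldType) (k : nat) (beta : seq rat -> rat -> K).
Hypothesis Hb : knotfam k beta.
Hypothesis k0 : (0 < k)%N.

Lemma kf_win_supp (X : seq rat) j i : sorted <%R X -> (j + k < size X)%N -> (i < size X)%N ->
  beta (win k j X) X`_i != 0 -> (j <= i <= j + k)%N.
Proof.
move=> sX jX iX /(kf_supp Hb (win_isknots sX jX)) /(nthP 0)[m].
rewrite size_win// ltnS => mk; rewrite nth_win// => /(sorted_nth_inj sX _ iX) <-; lia.
Qed.

(** The principle of the insertion arguments: the windows that start after the index i do not
    contain X_i, so if those starting at 1, ..., i do not charge it, its mass comes from the first
    window. *)
Lemma kf_win0 (X : seq rat) i : sorted <%R X -> forall a, subseq a X -> size a = k.+1 ->
  (i < size X)%N -> beta a X`_i != 0 ->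
  (forall j, (0 < j <= i)%N -> (j + k < size X)%N -> beta (win k j X) X`_i = 0) ->
  beta (win k 0 X) X`_i != 0.
Proof.
move=> sX a aX sa iX; have [c ->] := kf_refine Hb sX aX sa; move=> h1 h2.
apply: contraNneq h1 => h0; rewrite big1// => -[j hj] _ /=.
have jX : (j + k < size X)%N by lia.
apply/eqP; rewrite mulf_eq0; apply/orP; right.
case: (posnP j) => [->|j0]; first exact/eqP.
have [ji|ij] := leqP j i; first by rewrite h2// j0.
apply/negPn/negP => /(kf_win_supp sX jX iX); lia.
Qed.

(** Insert k equally spaced points between a_0 and a_1. Only the first window of the refined list
    contains a_0, and it is an affine image of [ints k]. *)
Lemma kf_first : beta (ints k) 0 = 0 -> forall a, isknots k a -> beta a a`_0 = 0.
Proof.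
move=> h0 a /andP[/eqP sa oa]; apply/eqP/negPn/negP => ha.
have a01 : a`_0 < a`_1 by apply: sorted_nth_lt => //; rewrite sa.
pose h := (a`_1 - a`_0) / k.+1%:R.
have h_gt0 : 0 < h by rewrite divr_gt0 ?subr_gt0 ?ltr0n.
have h1 : h * k%:R + a`_0 < a`_1.
  by rewrite -ltrBrDr /h mulrAC ltr_pdivrMr ?ltr0n// ltr_pM2l ?subr_gt0// ltr_nat.
pose X := aff h a`_0 (ints k) ++ behead a.
have sX : sorted <%R X.
  apply: sorted_cat_lt; first by case/andP: (aff_isknots a`_0 h_gt0 (ints_isknots k)).
    by rewrite -drop1; exact: drop_sorted.
  move=> _ y /mem_affP[_ /mem_intsP[i ik ->] ->] /(nthP 0)[j].
  rewrite size_behead sa => jk <-; rewrite nth_behead.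
  apply: le_lt_trans (_ : h * k%:R + a`_0 < _); first by rewrite lerD2r ler_pM2l// ler_nat.
  by apply: lt_le_trans h1 _; apply: sorted_nth_le; rewrite ?sa.
have szX : size X = (k.+1 + k)%N by rewrite size_cat size_map size_ints size_behead sa.
have X0 : X`_0 = a`_0 by rewrite /X /ints /= mulr0 add0r.
have aX : subseq a X.
  apply: sorted_subset_subseq => // y; case E : a => [|z t]; first by rewrite in_nil.
  rewrite inE /X mem_cat => /orP[/eqP->|yt]; last by rewrite E /= yt orbT.
  by rewrite E /= mulr0 add0r mem_head.
have : beta (win k 0 X) X`_0 != 0.
  by apply: (kf_win0 sX aX sa); rewrite ?X0 ?szX// => j; lia.
have -> : win k 0 X = aff h a`_0 (ints k).
  by rewrite /win drop0 take_size_cat// size_map size_ints.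
have -> : X`_0 = h * 0 + a`_0 by rewrite mulr0 add0r.
by rewrite (kf_aff_eq0 Hb) ?ints_isknots// h0 eqxx.
Qed.

Lemma cons_ints_isknots y : 0 < y -> isknots k (- y :: ints k.-1).
Proof.
move=> y0; rewrite /isknots; apply/andP; split.
  by apply/eqP; rewrite /= size_map size_iota; lia.
rewrite -[_ :: _]/([:: -y] ++ ints k.-1).
apply: sorted_cat_lt => //; first by case/andP: (ints_isknots k.-1).
move=> u v; rewrite inE => /eqP-> /mem_intsP[i _ ->].
by rewrite (@lt_le_trans _ _ 0)// oppr_lt0.
Qed.

(* Suppose not. Then the measure of [(-y, 0, ..., k - 1)] charges [0] for all large
   [y]. It does not charge [-1], so when [-1] is inserted, the measure of
   [(-y, -1, ..., k - 2)], which enters with a nonzero coefficient, does not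
   charge [-1], a contradiction after translation. *)
Lemma kf_second : beta (ints k) 0 = 0 -> beta (ints k) 1 = 0 ->
  forall a, isknots k a -> beta a a`_1 = 0.
Proof.
move=> h0 h1; have first0 := kf_first h0.
have [k2|k1] := ltnP 1 k; last first.
  (* There is no a_2 in this case, but two knots are always an affine image of [ints 1]. *)
  have {}k1 : k = 1%N by lia.
  move=> a ka; have /andP[/eqP sa oa] := ka; rewrite k1 in sa.
  have a01 : a`_0 < a`_1 by apply: sorted_nth_lt => //; rewrite sa.
  have aE : a = aff (a`_1 - a`_0) a`_0 (ints k).
    rewrite k1 /ints /= mulr0 mulr1 add0r subrK.
    by case: a sa {ka oa a01} => // x [|y []].
  have {1}-> : a`_1 = (a`_1 - a`_0) * 1 + a`_0 by rewrite mulr1 subrK.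
  by rewrite {1}aE; apply/eqP; rewrite (kf_aff_eq0 Hb) ?subr_gt0 ?ints_isknots ?h1.
move=> a ka; have /andP[/eqP sa oa] := ka; apply/eqP/negPn/negP => ha.
have a01 : a`_0 < a`_1 by apply: sorted_nth_lt => //; rewrite sa.
have a12 : a`_1 < a`_2 by apply: sorted_nth_lt => //; rewrite sa.
(* Points with spacing h are inserted after a_1. Only the windows 0 and 1 contain a_1; it is the
   first knot of the window 1, which does not charge it, so the window 0 must. *)
have far h : 0 < h -> h * k%:R + a`_1 < a`_2 ->
    beta (a`_0 :: aff h a`_1 (ints k.-1)) a`_1 != 0.
  move=> h_gt0 hk.
  pose Y := aff h a`_1 (ints k.-1) ++ drop 2 a; pose X := a`_0 :: Y.
  have oY : sorted <%R Y.
    apply: sorted_cat_lt; first by case/andP: (aff_isknots a`_1 h_gt0 (ints_isknots k.-1)).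
      exact: drop_sorted.
    move=> _ y /mem_affP[_ /mem_intsP[i ik ->] ->] /(nthP 0)[j].
    rewrite size_drop sa => jk <-; rewrite nth_drop.
    apply: le_lt_trans (_ : h * k%:R + a`_1 < _).
      by rewrite lerD2r ler_pM2l// ler_nat; lia.
    by apply: lt_le_trans hk _; apply: sorted_nth_le; rewrite ?sa//; lia.
  have hge y : y \in Y -> a`_1 <= y.
    rewrite mem_cat => /orP[/mem_affP[_ /mem_intsP[i ik ->] ->]|/(nthP 0)[j]].
      by rewrite lerDr mulr_ge0// ltW.
    by rewrite size_drop sa => jk <-; rewrite nth_drop; apply: sorted_nth_le; rewrite ?sa//; lia.
  have sX : sorted <%R X.
    rewrite -[X]/([:: a`_0] ++ Y); apply: sorted_cat_lt => // x y.
    by rewrite inE => /eqP-> /hge; exact: lt_le_trans.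
  have szX : size X = (k.+1 + k.-1)%N.
    by rewrite -[size X]/((size Y).+1) size_cat size_map size_ints size_drop sa; lia.
  have X1 : X`_1 = a`_1 by rewrite /X /Y /ints /= mulr0 add0r.
  have aX : subseq a X.
    apply: sorted_subset_subseq => // y /(nthP 0)[[|[|j]]]; rewrite sa => hj <-.
    - exact: mem_head.
    - by rewrite -X1 mem_nth// szX.
    - rewrite inE mem_cat; apply/orP; right; apply/orP; right.
      by rewrite -[j.+2]/(2 + j)%N -nth_drop mem_nth// size_drop sa; lia.
  have <- : win k 0 X = a`_0 :: aff h a`_1 (ints k.-1).
    by rewrite /win drop0 /= take_size_cat// size_map size_ints prednK.
  rewrite -X1; apply: (kf_win0 sX aX sa); rewrite ?X1//.
  move=> j /andP[j0 j1] jX; have -> : j = 1%N by lia.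
  have <- : (win k 1 X)`_0 = a`_1 by rewrite nth_win// X1.
  by apply: first0; apply: win_isknots => //; rewrite szX; lia.
have kpos : 0 < k%:R :> rat by rewrite ltr0n.
(* With h = (a_1 - a_0) / y, the condition of [far] reads y > Y. Later y = Y + 2 is taken, so that
   both y and y - 1 qualify. *)
pose Y := k%:R * (a`_1 - a`_0) / (a`_2 - a`_1).
have Y0 : 0 < Y by rewrite divr_gt0 ?mulr_gt0 ?subr_gt0.
have far2 y : Y < y -> beta (- y :: ints k.-1) 0 != 0.
  move=> Yy; have y0 : 0 < y := lt_trans Y0 Yy.
  pose h := (a`_1 - a`_0) / y.
  have h_gt0 : 0 < h by rewrite divr_gt0 ?subr_gt0.
  have := far h h_gt0; have -> : a`_0 :: aff h a`_1 (ints k.-1) = aff h a`_1 (- y :: ints k.-1).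
    by rewrite /= mulrN divfK ?lt0r_neq0//; congr (_ :: _); ring.
  have ky := cons_ints_isknots y0.
  have {3}-> : a`_1 = h * 0 + a`_1 by rewrite mulr0 add0r.
  rewrite (kf_aff_eq0 Hb)//; apply.
  rewrite -ltrBrDr /h mulrAC ltr_pdivrMr// mulrC.
  by move: Yy; rewrite /Y ltr_pdivrMr ?subr_gt0// [X in _ < X]mulrC.
pose y := Y + 2.
have y1 : 1 < y by rewrite /y; lra.
pose al := - y :: -1 :: ints k.-1.
have oal : sorted <%R al.
  rewrite -[al]/([:: -y; -1] ++ ints k.-1); apply: sorted_cat_lt.
  - by rewrite /= ltrN2 y1.
  - by case/andP: (ints_isknots k.-1).
  - move=> u v; rewrite !inE => /orP[]/eqP-> /mem_intsP[i _ ->];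
    by apply: (@lt_le_trans _ _ 0) => //; lra.
have szal : size al = k.+2 by rewrite /= size_map size_iota; lia.
have hk1 : (0 < 1 <= k)%N by rewrite k0.
have [c [d hcd]] := kf_span Hb oal szal hk1.
have e1 : rem_at 1 al = - y :: ints k.-1 by rewrite /rem_at /= ?drop0.
have e2 : behead al = aff 1 (-1) (ints k).
  apply: (@eq_from_nth _ 0); first by rewrite size_behead szal size_map size_ints.
  move=> i; rewrite size_behead szal -[k.+2.-1]/(k.+1) => ik; rewrite (nth_map 0) ?size_ints// nth_ints//.
  case: i ik => [|i] ik; first by rewrite mulr0 add0r.
  by rewrite /= nth_ints; [rewrite -natr1; ring|lia].
have e3 : take k.+1 al = aff 1 (-1) (- (y - 1) :: ints k.-1).
  apply: (@eq_from_nth _ 0); first by rewrite size_takel ?szal// /= !size_map size_iota; lia.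
  move=> i; rewrite size_takel ?szal// => ik; rewrite nth_take// (nth_map 0); last first.
    by rewrite /= size_map size_iota; lia.
  case: i ik => [|[|i]] ik; [by rewrite /=; ring|by rewrite /ints /=; ring|].
  change ((ints k.-1)`_i = 1 * (ints k.-1)`_i.+1 + -1).
  by rewrite !nth_ints; [rewrite -natr1; ring|lia|lia].
rewrite e1 e2 e3 in hcd.
have c0 : c != 0.
  have Yy : Y < y by rewrite /y; lra.
  apply: contraNneq (far2 y Yy) => c0.
  rewrite hcd c0 mul0r add0r mulf_eq0; apply/orP; right.
  have -> : 0 = 1 * 1 + -1 :> rat by rewrite mulr1 subrr.
  by rewrite (kf_aff_eq0 Hb) ?ints_isknots ?h1.
have : beta (- y :: ints k.-1) (-1) = 0.
  apply/eqP/negPn/negP => /(kf_supp Hb).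
  have hk := cons_ints_isknots (lt_trans ltr01 y1).
  move=> /(_ hk); rewrite inE => /orP[|/mem_intsP[i _]].
    by rewrite eqr_opp => /eqP h; move: y1; rewrite -h ltxx.
  by move=> h; have : (0 : rat) <= -1 by rewrite h.
have e4 : beta (aff 1 (-1) (ints k)) (-1) = 0.
  have {2}-> : -1 = 1 * 0 + -1 :> rat by rewrite mulr0 add0r.
  by apply/eqP; rewrite (kf_aff_eq0 Hb) ?ints_isknots ?h0.
rewrite hcd e4 mulr0 addr0 => /eqP; rewrite mulf_eq0 (negbTE c0) orFb.
have e5 : -1 = 1 * 0 + -1 :> rat by rewrite mulr0 add0r.
rewrite [X in beta _ X == _]e5.
rewrite (kf_aff_eq0 Hb)//; first by apply/negP/far2; rewrite /y; lra.
by apply: cons_ints_isknots; rewrite subr_gt0.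
Qed.

End KnotFamilyEnds.

Lemma nth_aff d t (a : seq rat) i : (i < size a)%N -> (aff d t a)`_i = d * a`_i + t.
Proof. exact: nth_map. Qed.

Section Reflection.
Variables (K : numFieldType) (k : nat) (beta : seq rat -> rat -> K).
Hypothesis Hb : knotfam k beta.

Definition opprev (a : seq rat) := rev (map -%R a).

Lemma size_opprev a : size (opprev a) = size a.
Proof. by rewrite size_rev size_map. Qed.

Lemma nth_opprev a i : (i < size a)%N -> (opprev a)`_i = - a`_(size a - i.+1).
Proof.
move=> h; have h' : (size a - i.+1 < size a)%N by lia.
by rewrite nth_rev size_map// (nth_map 0).
Qed.

Lemma opprev_sorted a : sorted <%R a -> sorted <%R (opprev a).
Proof.
rewrite /opprev rev_sorted sorted_map => h.
by apply: sub_sorted h => x y /=; rewrite ltrN2.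
Qed.

Lemma opprev_isknots a : isknots k a -> isknots k (opprev a).
Proof. by rewrite /isknots size_opprev => /andP[-> /opprev_sorted]. Qed.

Lemma opprev_aff d t a : opprev (aff d t a) = aff d (- t) (opprev a).
Proof.
rewrite /opprev /aff map_rev -!map_comp; congr rev; apply: eq_map => x /=; ring.
Qed.

Lemma opprev_ints : opprev (ints k) = aff 1 (- k%:R) (ints k).
Proof.
apply: (@eq_from_nth _ 0); first by rewrite size_opprev !size_map.
move=> i; rewrite size_opprev size_ints => ik.
rewrite nth_opprev ?size_ints// nth_aff ?size_ints// subSS !nth_ints ?leq_subr//.
by rewrite natrB//; ring.
Qed.

(** The affine law covers only positive factors, so reflection has to be checked separately. It
    exchanges the two ends and reduces the last two knots to the first two. *)
Lemma knotfam_opp : knotfam k (fun a x => beta (opprev a) (- x)).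
Proof.
split.
- move=> al j oal sal /andP[j0 jk].
  have hj : (0 < k.+1 - j <= k)%N by lia.
  have [|c [d h]] := kf_span Hb (opprev_sorted oal) _ hj; first by rewrite size_opprev.
  have e1 : rem_at (k.+1 - j) (opprev al) = opprev (rem_at j al).
    apply: (@eq_from_nth _ 0); first by rewrite size_opprev !size_rem_at ?size_opprev// sal; lia.
    move=> i; rewrite size_rem_at size_opprev ?sal; last by lia.
    move=> hi; rewrite nth_rem_at ?size_opprev ?sal; last by lia.
    rewrite [RHS]nth_opprev ?size_rem_at ?sal; try lia.
    rewrite nth_rem_at ?sal; last by lia.
    by do 2?[case: ltnP => ?]; try lia; rewrite nth_opprev ?sal; try lia; congr (- nth _ _ _); lia.
  have e2 : take k.+1 (opprev al) = opprev (behead al).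
    apply: (@eq_from_nth _ 0).
      by rewrite size_opprev size_takel ?size_opprev ?sal// size_behead sal.
    move=> i; rewrite size_takel ?size_opprev ?sal// => hi.
    rewrite nth_take// !nth_opprev ?size_behead ?sal//; last by lia.
    by rewrite nth_behead; congr (- nth _ _ _); rewrite /=; lia.
  have e3 : behead (opprev al) = opprev (take k.+1 al).
    apply: (@eq_from_nth _ 0).
      by rewrite size_opprev size_takel ?sal// size_behead size_opprev sal.
    move=> i; rewrite size_behead size_opprev sal => hi.
    rewrite nth_behead !nth_opprev ?size_takel ?sal// nth_take; last by rewrite /=; lia.
    by congr (- nth _ _ _); rewrite /=; lia.
  by exists d, c => x; rewrite -e1 h e2 e3 addrC.
- move=> a d t ka d0; have [c c0 h] := kf_aff Hb (- t) (opprev_isknots ka) d0.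
  by exists c => // x; rewrite opprev_aff opprD -mulrN h.
- move=> x; rewrite opprev_ints => /(kf_unif Hb ltr01)[i ik xE].
  exists (k - i)%N; first by lia.
  by rewrite natrB//; rewrite -[x]opprK xE; ring.
Qed.

Lemma opp_ints_eq0 i : (i <= k)%N ->
  (beta (opprev (ints k)) (- i%:R) == 0) = (beta (ints k) (k - i)%:R == 0).
Proof.
move=> ik; rewrite opprev_ints.
have -> : - i%:R = 1 * (k - i)%:R + - k%:R :> rat by rewrite natrB//; ring.
by rewrite (kf_aff_eq0 Hb)// ints_isknots.
Qed.

End Reflection.

Section Ends.
Variables (K : numFieldType) (k s r : nat) (beta : seq rat -> rat -> K).
Hypothesis Hb : knotfam k beta.
Hypothesis k0 : (0 < k)%N.
Hypothesis hsr : (s + r <= k)%N.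
Hypothesis hs : (s <= 2)%N.
Hypothesis hr : (k - (s + r) <= 2)%N.
Hypothesis hb0 : forall i, (i <= k)%N -> (i < s)%N || (s + r < i)%N -> beta (ints k) i%:R = 0.

(** At most two knots have to be excluded at each end: [kf_first] and [kf_second] do so on the left,
    their reflections on the right. *)
Lemma kf_ends a x : isknots k a -> beta a x != 0 ->
  exists2 i, (i <= r)%N & x = a`_(s + i).
Proof.
move=> ka hx; have := kf_supp Hb ka hx => /(nthP 0)[j].
have /andP[/eqP sa oa] := ka; rewrite sa ltnS => jk xE.
have hj : (s <= j)%N.
  rewrite leqNgt; apply/negP => js; case/eqP: hx; rewrite -xE.
  case: j jk js {xE} => [|[|j]] jk js; last by lia.
    by apply: (kf_first Hb) => //; apply: (@hb0 0%N) => //; rewrite js.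
  apply: (kf_second Hb) => //; first by apply: (@hb0 0%N) => //; rewrite (ltn_trans _ js).
  by apply: (@hb0 1%N) => //; rewrite js.
have hj2 : (j <= s + r)%N.
  rewrite leqNgt; apply/negP => js; case/eqP: hx; rewrite -xE.
  have Ho := knotfam_opp Hb; have ko := opprev_isknots ka.
  have E i : (i <= k)%N -> (opprev a)`_i = - a`_(k - i).
    by move=> ik; rewrite nth_opprev sa// subSS.
  have K2 : opprev (opprev a) = a.
    by rewrite /opprev map_rev revK -map_comp -[RHS]map_id; apply: eq_map => y /=; rewrite opprK.
  have z i : (i <= k)%N -> (s + r < k - i)%N -> beta (opprev (ints k)) (- i%:R) = 0.
    move=> ik h; apply/eqP; rewrite (opp_ints_eq0 Hb)//; apply/eqP/hb0; first by lia.
    by rewrite h orbT.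
  have [jE|jE] : j = k \/ j = k.-1 by lia.
    have := kf_first Ho k0 _ ko; rewrite K2 E// subn0 opprK jE; apply.
    by rewrite -[X in - X]/(0%:R); apply: z => //; rewrite subn0 -jE.
  have := kf_second Ho k0 _ _ ko; rewrite K2 E; last by lia.
  rewrite subn1 opprK jE; apply.
    by rewrite -[X in - X]/(0%:R); apply: z => //; rewrite subn0; lia.
  by rewrite -[X in - X]/(1%:R); apply: z; lia.
exists (j - s)%N; first by lia.
by rewrite subnKC.
Qed.

Hypothesis hbs : beta (ints k) s%:R != 0.

(** Prolonged by an arithmetic progression of step M, the list contains the uniform knots of step M
    whose point of index s is a_s, and their measure charges a_s. A window that starts at j > 0
    charges no index below j + s, so the mass at a_s comes from the first window, which is [a]. *)
Lemma kf_left_end a M : isknots k a -> 0 < M ->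
  (forall i, (i <= s)%N -> a`_i = a`_s - M * (s - i)%:R) -> a`_k < a`_s + M ->
  beta a a`_s != 0.
Proof.
move=> ka M0 hleft hright; have /andP[/eqP sa oa] := ka.
pose T := aff M (a`_s + M) (ints k); pose X := a ++ T.
have sX : sorted <%R X.
  apply: sorted_cat_lt => //; first by case/andP: (aff_isknots (a`_s + M) M0 (ints_isknots k)).
  move=> _ _ /(nthP 0)[i ia <-] /mem_affP[_ /mem_intsP[j _ ->] ->].
  apply: (@le_lt_trans _ _ a`_k); first by apply: sorted_nth_le; rewrite ?sa// -ltnS -sa.
  by apply: lt_le_trans hright _; rewrite lerDr mulr_ge0// ltW.
have szX : size X = (k.+1 + k.+1)%N by rewrite size_cat sa size_map size_ints.
pose u := aff M (a`_s - M * s%:R) (ints k).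
have ku : isknots k u by apply: aff_isknots => //; exact: ints_isknots.
have /andP[/eqP su ou] := ku.
have uX : subseq u X.
  apply: sorted_subset_subseq => // _ /mem_affP[_ /mem_intsP[i ik ->] ->].
  rewrite /X mem_cat; have [iss|si] := leqP i s.
    apply/orP; left; have -> : M * i%:R + (a`_s - M * s%:R) = a`_i.
      by rewrite (hleft i iss) natrB//; ring.
    by rewrite mem_nth// sa.
  apply/orP; right; apply/mapP; exists ((i - s.+1)%:R).
    by apply/mapP; exists (i - s.+1)%N => //; rewrite mem_iota; lia.
  by rewrite natrB// -[s.+1%:R]natr1; ring.
have sk : (s <= k)%N by lia.
have Xs : X`_s = a`_s by rewrite nth_cat sa ltnS sk.
suff : beta (win k 0 X) X`_s != 0 by rewrite Xs /win drop0 -sa take_size_cat.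
apply: (kf_win0 Hb k0 sX uX su).
- by rewrite szX; lia.
- have -> : X`_s = M * s%:R + (a`_s - M * s%:R) by rewrite Xs; ring.
  by rewrite (kf_aff_eq0 Hb)// ints_isknots.
- move=> j /andP[j0 js] jX; apply/eqP/negPn/negP.
  have kw := win_isknots sX jX; move=> /(kf_ends kw)[i ir].
  rewrite nth_win; last by lia.
  move=> /(sorted_nth_inj sX _ _); rewrite szX; lia.
Qed.

End Ends.

(** * Divided differences and the shape of the measures *)

Section DividedDifferenceUnique.
Variables (K : fieldType) (r : nat) (y : 'I_r.+1 -> K) (gam : 'I_r.+1 -> K).
Hypothesis yinj : injective y.
Hypothesis kill : forall P : {poly K}, (size P <= r)%N -> \sum_i gam i * P.[y i] = 0.

Definition node_prod (i : 'I_r.+1) := \prod_(j | j != i) (y i - y j).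

Lemma node_prod_neq0 i : node_prod i != 0.
Proof.
apply/prodf_neq0 => j ji; rewrite subr_eq0; apply: contraNneq ji => /yinj->//.
Qed.

(** Test the weights on the product of the X - y_j over the r - 1 nodes other than y_i and y_i'. *)
Lemma divided_difference_uniq i i' : gam i * node_prod i = gam i' * node_prod i'.
Proof.
have [->//|ii'] := eqVneq i i'.
pose P := \prod_(j | (j != i) && (j != i')) ('X - (y j)%:P).
have hP l : P.[y l] = \prod_(j | (j != i) && (j != i')) (y l - y j).
  by rewrite horner_prod; apply: eq_bigr => j _; rewrite hornerXsubC.
have sP : (size P <= r)%N.
  rewrite /P -big_filter size_prod_XsubC -sum1_size big_filter.
  have : (\sum_(j < r.+1) 1 = r.+1)%N by rewrite sum1_card card_ord.
  by rewrite (bigD1 i)//= (bigD1 i') 1?eq_sym//=; lia.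
have := kill sP; rewrite (bigD1 i)//= (bigD1 i') 1?eq_sym//= big1 ?addr0; last first.
  move=> j /andP[ji ji']; rewrite hP (bigD1 j) ?ji//=; first by rewrite subrr mul0r mulr0.
rewrite !hP => E.
rewrite /node_prod (bigD1 i') 1?eq_sym//= [in RHS](bigD1 i)//=.
have -> : \prod_(j < r.+1 | (j != i') && (j != i)) (y i' - y j) =
   \prod_(j < r.+1 | (j != i) && (j != i')) (y i' - y j) by apply: eq_bigl => j; rewrite andbC.
move: E; set A := \prod_(_ | _) _; set B := \prod_(_ | _) _ => /eqP.
rewrite addr_eq0 => /eqP E; rewrite mulrCA E; ring.
Qed.

End DividedDifferenceUnique.

Section KnotFamilyShape.
Variables (K : numFieldType) (k s r : nat) (beta : seq rat -> rat -> K).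
Hypothesis Hb : knotfam k beta.
Hypothesis k0 : (0 < k)%N.
Hypothesis hsr : (s + r <= k)%N.
Hypothesis Hends : forall a x, isknots k a -> beta a x != 0 ->
  exists2 i, (i <= r)%N & x = a`_(s + i).
Hypothesis Hleft : forall a (M : rat), isknots k a -> 0 < M ->
  (forall i, (i <= s)%N -> a`_i = a`_s - M * (s - i)%:R) -> a`_k < a`_s + M ->
  beta a a`_s != 0.

(** The hypothesis makes w a root of the polynomial whose coefficients are the masses of [ints k],
    so every integral translate of that measure annihilates the geometric sequence of ratio w. *)
Lemma unif_sum (w : K) (j L N : nat) : (j < N)%N ->
  \sum_(i < k.+1) beta (ints k) i%:R * w ^+ i = 0 ->
  \sum_(n < N + k) w ^+ n * beta (aff 1 (j%:R - L%:R) (ints k)) (n%:R - L%:R) = 0.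
Proof.
move=> jN hw; have [c c0 hc] := kf_aff Hb (j%:R - L%:R) (ints_isknots k) ltr01.
pose F n := c * (w ^+ n * beta (ints k) (n%:R - j%:R)).
have -> : \sum_(n < N + k) w ^+ n * beta (aff 1 (j%:R - L%:R) (ints k)) (n%:R - L%:R)
   = \sum_(0 <= n < N + k) F n.
  rewrite big_mkord; apply: eq_bigr => n _.
  have -> : n%:R - L%:R = 1 * (n%:R - j%:R) + (j%:R - L%:R) :> rat by ring.
  by rewrite hc /F; ring.
have F0 n : ~~ (j <= n <= j + k)%N -> F n = 0.
  move=> h; rewrite /F; case: (eqVneq (beta (ints k) (n%:R - j%:R)) 0) => [->|/(kf_ints Hb)[i ik]].
    by rewrite !mulr0.
  move=> /eqP; rewrite subr_eq -natrD eqr_nat => /eqP nE; case/negP: h; lia.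
rewrite (big_cat_nat _ (n := j))//=; last by lia.
rewrite [X in X + _]big_nat_cond big1 ?add0r; last by move=> n /andP[/andP[h1 h2] _]; apply: F0; clear -h1 h2; lia.
rewrite (big_cat_nat _ (n := (j + k.+1)%N))//=; [|lia|lia].
have -> : \sum_(j + k.+1 <= i < N + k) F i = 0.
  by rewrite big_nat_cond big1// => n /andP[/andP[h1 h2] _]; apply: F0; clear -h1 h2; lia.
rewrite addr0.
rewrite -{1}[j]add0n big_addn addKn big_mkord.
transitivity (c * w ^+ j * \sum_(i < k.+1) beta (ints k) i%:R * w ^+ i); last by rewrite hw mulr0.
rewrite mulr_sumr; apply: eq_bigr => i _; rewrite /F natrD addrK exprD; ring.
Qed.

(* On the integers, the functions [1] and [n |-> w ^+ n] are annihilated by every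
   measure with integral knots. Take the knots [..., 1, d, 2d, ...] with [1] at
   the index [s]: the two functions agree at all the charged points but [1]. *)
Lemma kf_root_one (w : K) d : (0 < r)%N -> (1 < d)%N -> w != 0 -> w ^+ d = 1 ->
  \sum_(i < k.+1) beta (ints k) i%:R * w ^+ i = 0 ->
  \sum_(i < k.+1) beta (ints k) i%:R = 0 -> w = 1.
Proof.
move=> r0 d1 w0 wd hw h1; have sk : (s < k)%N by lia.
(* Large enough for the knots d, 2d, ... to stay below a_s + M, as [Hleft] requires. *)
pose M : rat := (d * k + 1)%:R.
have M0 : 0 < M by rewrite ltr0n addn1.
pose g i : rat := if (i <= s)%N then 1 - M * (s - i)%:R else (d * (i - s))%:R.
have gmono i : g i < g i.+1.
  rewrite /g; case: (ltngtP i s) => h.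
  - by rewrite ltrD2l ltrN2 ltr_pM2l// ltr_nat; lia.
  - by rewrite ltr_nat ltn_pmul2l; lia.
  - by rewrite h subnn mulr0 subr0 subSnn muln1 ltr1n.
pose a := [seq g i | i <- iota 0 k.+1].
have ka : isknots k a by rewrite /isknots size_map size_iota eqxx sorted_map_iota.
have aE i : (i <= k)%N -> a`_i = g i.
  by move=> ik; rewrite (nth_map 0%N) ?size_iota// nth_iota.
have as1 : a`_s = 1 by rewrite aE ?(ltnW sk)// /g leqnn subnn mulr0 subr0.
have ba : beta a 1 != 0.
  rewrite -as1; apply: (Hleft ka M0).
    by move=> i iS; rewrite as1 aE ?(leq_trans iS (ltnW sk))// /g iS.
  rewrite as1 aE// /g leqNgt sk /= /M -(natrD _ 1) ltr_nat.
  have : (d * (k - s) <= d * k)%N by rewrite leq_mul2l leq_subr orbT.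
  by lia.
have ia y : y \in a -> y \is a Num.int.
  case/mapP => i _ ->; rewrite /g; case: ifP => _; last exact: natr_int.
  by rewrite rpredB ?int_num1// rpredM ?natr_int.
have [L [N [c hc]]] := int_span Hb ka ia.
have S z : \sum_(i < k.+1) beta (ints k) i%:R * z ^+ i = 0 ->
    \sum_(n < N + k) z ^+ n * beta a (n%:R - L%:R) = 0.
  move=> hz; under eq_bigr do rewrite hc mulr_sumr.
  rewrite exchange_big/= big1// => j _; under eq_bigr do rewrite mulrCA.
  by rewrite -mulr_sumr unif_sum ?mulr0.
have hL : (L.+1 < N + k)%N.
  rewrite ltnNge; apply/negP => hN; case/eqP: ba; rewrite hc big1// => j _.
  apply/eqP; rewrite mulf_eq0; apply/orP; right; apply/negPn/negP => /(kf_unif Hb ltr01)[i ik].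
  have := ltn_ord j => hj.
  move=> /eqP; rewrite mul1r addrA eq_sym subr_eq -natrD -(natrD _ 1) eqr_nat => /eqP; lia.
have S1 : \sum_(n < N + k) beta a (n%:R - L%:R) = 0.
  rewrite -[RHS](S 1).
    by apply: eq_bigr => n _; rewrite expr1n mul1r.
  by rewrite -[RHS]h1; apply: eq_bigr => i _; rewrite expr1n mulr1.
have : \sum_(n < N + k) (w ^+ n - w ^+ L) * beta a (n%:R - L%:R) = 0.
  under eq_bigr do rewrite mulrBl.
  by rewrite sumrB S// -mulr_sumr S1 mulr0 subrr.
rewrite (bigD1 (Ordinal hL))//= big1 ?addr0; last first.
  move=> n; rewrite -val_eqE /= => nL.
  have [->|] := eqVneq (beta a (n%:R - L%:R)) 0; first by rewrite mulr0.
  move=> /(Hends ka)[i ir]; rewrite aE; last by lia.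
  rewrite /g; case: ifP => hi.
    have -> : i = 0%N by lia.
    rewrite addn0 subnn mulr0 subr0 => /eqP; rewrite subr_eq -(natrD _ 1) eqr_nat add1n.
    by rewrite (negbTE nL).
  rewrite addKn => /eqP; rewrite subr_eq -natrD eqr_nat => /eqP->.
  by rewrite exprD exprM wd expr1n mul1r subrr mul0r.
rewrite -natr1 addrAC subrr add0r => /eqP; rewrite mulf_eq0 (negbTE ba) orbF exprS.
by rewrite -{2}[w ^+ L]mul1r -mulrBl mulf_eq0 expf_eq0 (negbTE w0) andbF orbF subr_eq0 => /eqP.
Qed.

Hypothesis Hkill : forall a (P : {poly K}) (l : seq rat), isknots k a -> (size P <= r)%N ->
  uniq l -> (forall x, beta a x != 0 -> x \in l) -> \sum_(x <- l) beta a x * P.[ratr x] = 0.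

Definition knot_node (a : seq rat) (i : 'I_r.+1) : K := ratr a`_(s + i).

Lemma knot_node_inj a : isknots k a -> injective (knot_node a).
Proof.
move=> /andP[/eqP sa oa] i j; rewrite /knot_node => /fmorph_inj /(sorted_nth_inj oa).
rewrite sa => h; apply/val_inj/eqP; rewrite -(eqn_add2l s); apply/eqP; apply: h.
  by have := ltn_ord i; lia.
by have := ltn_ord j; lia.
Qed.

Lemma kf_divided_difference a : isknots k a -> exists kap : K,
  forall i : 'I_r.+1, beta a a`_(s + i) = kap / node_prod (knot_node a) i.
Proof.
move=> ka; have /andP[/eqP sa oa] := ka.
have kinj := knot_node_inj ka.
have kill (P : {poly K}) : (size P <= r)%N ->
    \sum_(i < r.+1) beta a a`_(s + i) * P.[knot_node a i] = 0.
  move=> sP; have := @Hkill a P [seq a`_(s + i) | i <- iota 0 r.+1] ka sP.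
  rewrite big_map -(big_mkord predT (fun i => beta a a`_(s + i) * P.[ratr a`_(s + i)])).
  rewrite /index_iota subn0; apply.
    rewrite map_inj_in_uniq ?iota_uniq// => i j; rewrite !mem_iota => hi hj.
    by move=> /(sorted_nth_inj oa); rewrite sa; lia.
  move=> x /(Hends ka)[i ir ->]; apply/mapP; exists i => //.
  by rewrite mem_iota; lia.
exists (beta a a`_(s + 0) * node_prod (knot_node a) ord0) => i.
rewrite -[0%N]/(nat_of_ord (@ord0 r)).
rewrite (@divided_difference_uniq _ _ (knot_node a) (fun i => beta a a`_(s + i)) kill ord0 i).
by rewrite mulfK// node_prod_neq0.
Qed.

(** Replacing the first s knots of [a] by a progression gives knots [b] that charge a_s by [Hleft].
    The expansion of [b] in the windows of U ++ a is triangular: a_j is the first point that the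
    window j can charge, and [b] does not charge it for j < s. A divided difference with zero mass
    at its first node vanishes, so every term before the last one is 0, and the last window is
    [a]. *)
Lemma kf_nonzero a : isknots k a -> beta a a`_s != 0.
Proof.
move=> ka; have /andP[/eqP sa oa] := ka.
have sk : (s <= k)%N by lia.
have a0k : a`_0 <= a`_k by apply: sorted_nth_le; rewrite ?sa.
have ask : a`_s <= a`_k by apply: sorted_nth_le; rewrite ?sa.
have a0s : a`_0 <= a`_s by apply: sorted_nth_le; rewrite ?sa.
(* This step places [U] below a_0 and leaves a_k below a_s + M. *)
pose M : rat := a`_k - a`_0 + 1.
have M0 : 0 < M by rewrite /M; lra.
pose U : seq rat := [seq a`_s - M * (s - i)%:R | i <- iota 0 s].
have szU : size U = s by rewrite size_map size_iota.
have nU i : (i < s)%N -> U`_i = a`_s - M * (s - i)%:R.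
  by move=> h; rewrite (nth_map 0%N) ?size_iota// nth_iota.
have oU : sorted <%R U.
  have : sorted <%R [seq a`_s - M * s%:R + M * i%:R | i <- iota 0 s].
    by apply: sorted_map_iota => i; rewrite ltrD2l ltr_pM2l// ltr_nat.
  congr (sorted _ _); apply/eq_in_map => i; rewrite mem_iota => /andP[_ hi].
  by rewrite natrB ?(ltnW hi)//; ring.
have Ulow x : x \in U -> x < a`_0.
  case/mapP => i; rewrite mem_iota => /andP[_ hi] ->.
  have : M * 1 <= M * (s - i)%:R by rewrite ler_pM2l// ler1n subn_gt0.
  by rewrite mulr1 /M; lra.
have age x : x \in a -> a`_0 <= x.
  by move=> /(nthP 0)[i hi <-]; apply: sorted_nth_le.
pose b := U ++ drop s a; pose X := U ++ a.
have ob : sorted <%R b.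
  apply: sorted_cat_lt => //; first exact: drop_sorted.
  by move=> x y /Ulow h /mem_drop /age; exact: lt_le_trans.
have oX : sorted <%R X.
  by apply: sorted_cat_lt => // x y /Ulow h /age; exact: lt_le_trans.
have sb : size b = k.+1 by rewrite size_cat szU size_drop sa subSn// addnS subnKC.
have kb : isknots k b by rewrite /isknots sb eqxx.
have nb i : b`_i = if (i < s)%N then a`_s - M * (s - i)%:R else a`_i.
  rewrite nth_cat szU; case: ltnP => h; first exact: nU.
  by rewrite nth_drop subnKC.
have hb : beta b a`_s != 0.
  have -> : a`_s = b`_s by rewrite nb ltnn.
  apply: (Hleft kb M0).
    move=> i iS; rewrite !nb ltnn; case: ltnP => // si.
    have e : i = s by apply/eqP; rewrite eqn_leq iS.
    by rewrite e subnn mulr0 subr0.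
  by rewrite !nb ltnn ltnNge sk /= /M; lra.
have bX : subseq b X.
  apply: sorted_subset_subseq => // x; rewrite !mem_cat => /orP[->//|/mem_drop->].
  by rewrite orbT.
have szX : size X = (s + k.+1)%N by rewrite size_cat szU sa.
have [c hc] := kf_refine Hb oX bX sb.
have szXk : (size X - k)%N = s.+1 by rewrite szX addnS -addSn addnK.
have nX i : (i <= k)%N -> X`_(s + i) = a`_i.
  by move=> ik; rewrite nth_cat szU ltnNge leq_addr /= addKn.
have wX j : (j <= s)%N -> isknots k (win k j X).
  by move=> js; apply: win_isknots => //; rewrite szX addnS ltnS leq_add2r.
have ws : win k s X = a by rewrite /win drop_size_cat// take_oversize// sa.
have lead j : (j <= s)%N -> beta (win k j X) a`_j = 0 -> forall x, beta (win k j X) x = 0.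
  move=> js h x; apply/eqP/negPn/negP => /[dup] hx /(Hends (wX j js))[i ir xE].
  have [kap hk] := kf_divided_difference (wX j js).
  have aj : a`_j = (win k j X)`_(s + @ord0 r).
    by rewrite addn0 nth_win// addnC nX// (leq_trans js).
  case/eqP: hx; rewrite xE -[ i]/(nat_of_ord (Ordinal (ir : (i < r.+1)%N))) hk.
  move: h; rewrite aj hk => /eqP; rewrite mulf_eq0 invr_eq0 (negbTE (node_prod_neq0 _ _)); last first.
    exact/knot_node_inj/wX.
  by rewrite orbF => /eqP->; rewrite mul0r.
have main j : (j <= s)%N -> (forall i x, (i < j)%N -> c i * beta (win k i X) x = 0) ->
    beta b a`_j = c j * beta (win k j X) a`_j.
  move=> js hi; rewrite hc szXk (bigD1 (Ordinal (js : (j < s.+1)%N)))//= big1 ?addr0//.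
  move=> [i his] /=; rewrite -val_eqE /= => ij.
  have [h|h] := ltnP i j; first exact: hi.
  have [->|] := eqVneq (beta (win k i X) a`_j) 0; first by rewrite mulr0.
  rewrite -nX ?(leq_trans js)//.
  move=> /(Hends (wX i _))[//|m mr]; rewrite nth_win; last by clear -mr hsr; lia.
  by move=> /(sorted_nth_inj oX); rewrite szX; clear -mr hsr js h ij his; lia.
have zero j : (j <= s)%N -> forall i x, (i < j)%N -> c i * beta (win k i X) x = 0.
  elim: j => // j IH js i x; rewrite ltnS leq_eqVlt => /predU1P[->|]; last first.
    by apply: IH; exact: ltnW.
  have : beta b a`_j = 0.
    apply/eqP/negPn/negP => /(Hends kb)[m mr]; rewrite nb ifF; last by clear; lia.
    by move=> /(sorted_nth_inj oa); rewrite sa; clear -mr hsr js; lia.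
  rewrite (main j (ltnW js) (IH (ltnW js))) => /eqP; rewrite mulf_eq0 => /orP[/eqP->|/eqP h].
    by rewrite mul0r.
  by rewrite (lead j (ltnW js) h) mulr0.
move: hb; rewrite (main s (leqnn s) (zero s (leqnn s))) ws mulf_eq0 negb_or.
by case/andP.
Qed.

End KnotFamilyShape.

(** * From functionals on polynomials to measures on the knots *)

Section PointMeasures.
Variable K : numFieldType.
Implicit Types (b : rat -> K) (L : {poly K} -> K) (P G : {poly K}).

Definition affp (d t : rat) G : {poly K} := G \Po ((ratr d)%:P * 'X + (ratr t)%:P).

Lemma horner_affp d t G x : (affp d t G).[x] = G.[ratr d * x + ratr t].
Proof. by rewrite /affp horner_comp !hornerE. Qed.

Lemma affp_comp d t d' t' G : affp d t (affp d' t' G) = affp (d' * d) (d' * t + t') G.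
Proof. by apply: poly_eq_horner => x; rewrite !horner_affp !(rmorphM, rmorphD); congr (G.[_]); ring. Qed.

Lemma affp_scale n G : affp n%:R 0 G = scalep n%:R G.
Proof.
by apply: poly_eq_horner => x; rewrite horner_affp horner_scalep rmorph0 addr0 ratr_nat.
Qed.

Lemma affp_shift n G : affp 1 n%:R G = shiftp n%:R G.
Proof.
by apply: poly_eq_horner => x; rewrite horner_affp horner_shiftp rmorph1 mul1r ratr_nat.
Qed.

Lemma derivn_affp n d t G : (affp d t G)^`(n) = ratr d ^+ n *: affp d t G^`(n).
Proof.
elim: n G => [|n IH] G; first by rewrite scale1r.
have E : ((ratr d)%:P * 'X + (ratr t)%:P : {poly K})^`() = (ratr d)%:P.
  by rewrite derivD derivM !derivC derivX mul0r add0r mulr1 addr0.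
rewrite derivSn /affp deriv_comp E mulrC (mul_polyC _ (G^`() \Po _)).
by rewrite derivnZ IH scalerA -derivSn exprS.
Qed.

Definition measure_of b L := exists l : seq rat, [/\ uniq l,
  forall x, b x != 0 -> x \in l & forall G, L G = \sum_(x <- l) b x * G.[ratr x]].

Lemma measure_of_any b L l : measure_of b L -> uniq l -> (forall x, b x != 0 -> x \in l) ->
  forall G, L G = \sum_(x <- l) b x * G.[ratr x].
Proof.
move=> [l' [ul' hl' hL]] ul hl G; rewrite hL.
rewrite (bigID (fun x => b x != 0))/= [X in _ + X]big1 ?addr0; last first.
  by move=> x; rewrite negbK => /eqP->; rewrite mul0r.
rewrite [RHS](bigID (fun x => b x != 0))/= [X in _ = _ + X]big1 ?addr0; last first.
  by move=> x; rewrite negbK => /eqP->; rewrite mul0r.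
rewrite -big_filter -[RHS]big_filter; apply: perm_big; apply: uniq_perm.
- exact: filter_uniq.
- exact: filter_uniq.
by move=> x; rewrite !mem_filter; case: eqP => //= /eqP h; rewrite hl ?hl'.
Qed.

Lemma measure_of_lin b b' L L' c d : measure_of b L -> measure_of b' L' ->
  measure_of (fun x => c * b x + d * b' x) (fun G => c * L G + d * L' G).
Proof.
move=> h h'; have [l [ul hl _]] := h; have [l' [ul' hl' _]] := h'.
exists (undup (l ++ l')); split; first exact: undup_uniq.
  move=> x hx; rewrite mem_undup mem_cat; apply/orP.
  have [e|/hl->] := eqVneq (b x) 0; last by left.
  have [e'|/hl'->] := eqVneq (b' x) 0; last by right.
  by move: hx; rewrite e e' !mulr0 addr0 eqxx.
move=> G; rewrite (measure_of_any h (undup_uniq (l ++ l'))); last first.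
  by move=> x /hl xl; rewrite mem_undup mem_cat xl.
rewrite (measure_of_any h' (undup_uniq (l ++ l'))); last first.
  by move=> x /hl' xl; rewrite mem_undup mem_cat xl orbT.
rewrite !mulr_sumr -big_split/=; apply: eq_bigr => x _; ring.
Qed.

Lemma measure_of_eq b b' L L' : b =1 b' -> L =1 L' -> measure_of b L -> measure_of b' L'.
Proof. by move=> /funext <- /funext <-. Qed.

Lemma measure_of_0 : measure_of (fun=> 0) (fun=> 0).
Proof. by exists [::]; split=> // [x|G]; [rewrite eqxx|rewrite big_nil]. Qed.

Lemma measure_of_sum n (b : nat -> rat -> K) (L : nat -> {poly K} -> K) (c : nat -> K) :
  (forall i, (i < n)%N -> measure_of (b i) (L i)) ->
  measure_of (fun x => \sum_(i < n) c i * b i x) (fun G => \sum_(i < n) c i * L i G).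
Proof.
elim: n => [|n IH] h.
  by apply: measure_of_eq measure_of_0 => x; rewrite big_ord0.
have h1 := IH (fun i hi => h i (leqW hi)).
apply: measure_of_eq (measure_of_lin 1 (c n) h1 (h n (ltnSn n))) => x;
  by rewrite big_ord_recr/= mul1r.
Qed.

Lemma measure_of_delta y : measure_of (fun x => (x == y)%:R) (fun G => G.[ratr y]).
Proof.
exists [:: y]; split=> // [x|G]; last by rewrite big_seq1 eqxx mul1r.
by case: (eqVneq x y) => [->|]; rewrite ?mem_head ?eqxx.
Qed.

Lemma measure_of_aff b L c d t : d != 0 -> measure_of b L ->
  measure_of (fun x => c * b (d^-1 * (x - t))) (fun G => c * L (affp d t G)).
Proof.
move=> d0 [l [ul hl hL]].
have E x : d^-1 * (d * x + t - t) = x by rewrite addrK mulKf.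
exists [seq d * x + t | x <- l]; split.
- rewrite map_inj_uniq// => x y /addIr /(mulfI d0)//.
- move=> x; rewrite mulf_eq0 negb_or => /andP[_ /hl h]; apply/mapP.
  by exists (d^-1 * (x - t)) => //; rewrite mulVKf// subrK.
- move=> G; rewrite hL mulr_sumr big_map; apply: eq_bigr => x _.
  by rewrite E horner_affp !(rmorphM, rmorphD) mulrA.
Qed.

(** A polynomial that vanishes at all the points of a finite list except y isolates the mass at
    y. *)
Lemma measure_of_uniq b b' L : measure_of b L -> measure_of b' L -> b =1 b'.
Proof.
move=> h h' y; apply/eqP; rewrite -subr_eq0; apply/eqP.
have [l [ul hl hL]] := measure_of_lin 1 (-1) h h'.
have {}hL G : \sum_(x <- l) (1 * b x + -1 * b' x) * G.[ratr x] = 0.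
  by rewrite -hL mul1r mulN1r subrr.
have [yl|yl] := boolP (y \in l); last first.
  by apply/eqP/negPn/negP => hy; move: yl; rewrite hl// mul1r mulN1r.
pose G : {poly K} := \prod_(x <- l | x != y) ('X - (ratr x)%:P).
have := hL G; rewrite (bigD1_seq y)//= big1 ?addr0; last first.
  move=> x xy; have [xl|xl] := boolP (x \in l).
    by rewrite /G horner_prod -big_filter (bigD1_seq x) ?mem_filter ?xy ?filter_uniq//= hornerXsubC subrr mul0r mulr0.
  suff -> : 1 * b x + -1 * b' x = 0 by rewrite mul0r.
  by apply/eqP/negPn/negP => /hl; apply/negP.
move=> /eqP; rewrite mulf_eq0 mul1r mulN1r => /orP[/eqP//|].
rewrite /G horner_prod prodf_seq_eq0 => /hasP[x xl /andP[xy]].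
rewrite hornerXsubC subr_eq0 => /eqP /fmorph_inj e.
by rewrite e eqxx in xy.
Qed.

End PointMeasures.

(** * The measures attached to the functionals *)

Section Link.
Variables (K : numFieldType) (k : nat) (mu : seq rat -> {poly K} -> K).
Hypothesis mu_lin : forall a c P G, mu a (c *: P + G) = c * mu a P + mu a G.
Hypothesis mu_span : forall (al : seq rat) (j : nat), sorted <%R al -> size al = k.+2 ->
    (0 < j <= k)%N -> exists c d : K, forall P,
    mu (rem_at j al) P = c * mu (take k.+1 al) P + d * mu (behead al) P.
Hypothesis mu_aff : forall (a : seq rat) (d t : rat), isknots k a -> 0 < d ->
    exists2 c, c != 0 & forall P, mu (aff d t a) P = c * mu a (affp d t P).
Hypothesis mu_neq0 : exists P, mu (ints k) P != 0.

Lemma mu0 a : mu a 0 = 0.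
Proof. by have := mu_lin a 1 0 0; rewrite scaler0 addr0 mul1r -{1}[mu a 0]addr0 => /addrI. Qed.

Lemma mu_refine (X a : seq rat) : sorted <%R X -> subseq a X -> size a = k.+1 ->
  exists c : nat -> K, forall P, mu a P = \sum_(j < size X - k) c j * mu (win k j X) P.
Proof.
move=> sX aX sa; have [|c E] := @span_law_refine K ({poly K} -> K^o) k mu _ X a sX aX sa.
  move=> al j sal szal hj; have [c [d E]] := mu_span sal szal hj.
  by exists c, d; apply/funext => x; rewrite E !fctE.
exists c => x; rewrite E; elim/big_rec2: _ => // i y f _ <-.
by rewrite !fctE.
Qed.

Definition gridq (D L n : nat) : seq rat := [seq (i%:R - L%:R) / D%:R | i <- iota 0 n].

Lemma common_grid (a : seq rat) : exists D L N : nat, (0 < D)%N /\ {subset a <= gridq D L N}.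
Proof.
have [D [D0 hD]] : exists D : nat, (0 < D)%N /\ forall y, y \in a -> D%:R * y \is a Num.int.
  elim: a => [|y a [D [D0 IH]]]; first by exists 1%N.
  exists (D * `|denq y|)%N; split.
    by rewrite muln_gt0 D0 absz_gt0 denq_eq0.
  have hy : `|denq y|%:R * y \is a Num.int.
    by rewrite natr_absz normr_denq mulrC -numqE intr_int.
  move=> z; rewrite inE natrM => /orP[/eqP->|/IH hz].
    by rewrite -mulrA rpredM// natr_int.
  by rewrite mulrAC rpredM// natr_int.
have D0' : D%:R != 0 :> rat by rewrite pnatr_eq0 -lt0n.
have [|L hL] := @int_bound [seq D%:R * y | y <- a].
  by move=> _ /mapP[y /hD h ->].
exists D, L, (L + L).+1; split=> // y ya.
have /intrP[z hz] := hD y ya.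
have := hL (D%:R * y); rewrite map_f// => /(_ isT); rewrite hz -intr_norm -[L%:R]/((Posz L)%:~R) ler_int => zL.
apply/mapP; exists (absz (Posz L + z)%R); first by rewrite mem_iota /=; lia.
rewrite natr_absz ger0_norm ?intrD; last by lia.
by rewrite addrAC subrr add0r -hz mulrAC mulfV// mul1r.
Qed.

Lemma gridq_sorted D L n : (0 < D)%N -> sorted <%R (gridq D L n).
Proof.
move=> D0; apply: sorted_map_iota => i.
by rewrite ltr_pM2r ?invr_gt0 ?ltr0n// ltrD2r ltr_nat.
Qed.

Lemma win_gridq D L n j : (0 < D)%N -> (j + k < n)%N ->
  win k j (gridq D L n) = aff D%:R^-1 ((j%:R - L%:R) / D%:R) (ints k).
Proof.
move=> D0 h; rewrite win_map//; have -> : iota j k.+1 = map (addn j) (iota 0 k.+1).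
  by rewrite -iotaDl addn0.
by rewrite /aff /ints -!map_comp; apply/eq_in_map => i _ /=; rewrite natrD; ring.
Qed.

Lemma mu_gridq D L n a : (0 < D)%N -> isknots k a -> {subset a <= gridq D L n} ->
  exists c : nat -> K, forall P, mu a P =
    \sum_(j < n - k) c j * mu (ints k) (affp D%:R^-1 ((j%:R - L%:R) / D%:R) P).
Proof.
move=> D0 /andP[/eqP sa oa] ha.
have sX := @gridq_sorted D L n D0.
have [c hc] := mu_refine sX (sorted_subset_subseq oa sX ha) sa.
rewrite size_map size_iota in hc.
have D0' : 0 < D%:R^-1 :> rat by rewrite invr_gt0 ltr0n.
have /choice[e he] : forall j : nat, exists e : K, forall P,
    mu (aff D%:R^-1 ((j%:R - L%:R) / D%:R) (ints k)) P =
    e * mu (ints k) (affp D%:R^-1 ((j%:R - L%:R) / D%:R) P).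
  by move=> j; have [e _ he] := mu_aff ((j%:R - L%:R) / D%:R) (ints_isknots k) D0'; exists e.
exists (fun j => c j * e j) => P; rewrite hc; apply: eq_bigr => -[j hj] _ /=.
by rewrite win_gridq// ?he ?mulrA//; lia.
Qed.

Lemma ints_gridq m : (0 < m)%N -> {subset ints k <= gridq m 0 (m * k).+1}.
Proof.
move=> m0 _ /mem_intsP[i ik ->]; apply/mapP; exists (m * i)%N.
  by rewrite mem_iota add0n ltnS leq_mul2l ik orbT.
by rewrite subr0 natrM mulrAC mulfV ?mul1r// pnatr_eq0 -lt0n.
Qed.

(** The grid of step 1/m from 0 to k has mk + 1 points, hence (m - 1) k + 1 windows, and each of
    them is [ints k] contracted by m and shifted. Applied to P(mX), the contraction disappears. *)
Lemma mu_refinable m : (1 < m)%N -> exists p : {poly K}, (size p <= m.-1 * k + 1)%N /\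
  forall P, mu (ints k) (scalep m%:R P) = mu (ints k) (opE p P).
Proof.
move=> m1; have m0 := ltnW m1.
have [c hc] := mu_gridq m0 (ints_isknots k) (ints_gridq m0).
pose N := ((m * k).+1 - k)%N.
have NE : N = (m.-1 * k + 1)%N by rewrite /N; case: m m1 {m0 c hc N} => // m _; rewrite mulSn; lia.
exists (\poly_(j < N) c j); split; first by rewrite -NE size_poly.
move=> P; rewrite hc -/N (opEw _ (size_poly _ _)).
have -> : \sum_(i < N) (\poly_(j < N) c j)`_i *: shiftp i%:R P =
    \sum_(i < N) c i *: shiftp i%:R P.
  by apply: eq_bigr => i _; rewrite coef_poly ltn_ord.
rewrite (_ : mu _ (\sum_(i < N) _) = \sum_(i < N) c i * mu (ints k) (shiftp i%:R P)); last first.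
  elim/big_rec2: _ => [|i y1 y2 _ IH]; first exact: mu0.
  by rewrite mu_lin -IH.
apply: eq_bigr => i _; congr (_ * mu _ _).
rewrite -affp_scale affp_comp -affp_shift subr0 addr0 mulfV ?pnatr_eq0 -?lt0n//.
by rewrite mulrC divfK// pnatr_eq0 -lt0n.
Qed.

Section WithSymbol.
Variables (B : {poly K}) (u n : nat) (g : K).
Hypothesis Bsz : (size B <= k.+1)%N.
Hypothesis g0 : g != 0.
Hypothesis Bu : forall P : {poly K}, (size P <= u)%N -> opE B P = 0.
Hypothesis muB_ : forall P, mu (ints k) P^`(u) = g * (opE B P^`(n)).[0].

(** Taken alone, the second condition makes L vanish on degrees less than u - n only. The third one,
    which holds on [ints k] because B(S) kills degrees less than u, is therefore carried along; it
    is what makes the measure a divided difference. *)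
Definition represents (b : rat -> K) (nu : {poly K} -> K) := exists L, [/\ measure_of b L,
  forall P, nu P^`(u) = L P^`(n) & forall P : {poly K}, (size P <= u)%N -> L P = 0].

Lemma represents_uniq b b' nu : represents b nu -> represents b' nu -> b =1 b'.
Proof.
move=> [L [hb hL _]] [L' [hb' hL' _]].
suff e : L = L' by rewrite e in hb; exact: measure_of_uniq hb hb'.
by apply/funext => G; have [P <-] := derivn_surj n G; rewrite -hL -hL'.
Qed.

Lemma represents_sum N (b : nat -> rat -> K) (nu : nat -> {poly K} -> K) (c : nat -> K) :
  (forall i, (i < N)%N -> represents (b i) (nu i)) ->
  represents (fun x => \sum_(i < N) c i * b i x) (fun G => \sum_(i < N) c i * nu i G).
Proof.
move=> h; have /choice[L hL] : forall i, exists L, (i < N)%N ->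
    [/\ measure_of (b i) L, forall P, nu i P^`(u) = L P^`(n) & forall P : {poly K}, (size P <= u)%N -> L P = 0].
  by move=> i; case: ltnP => [/h[L hL]|_]; [exists L|exists (fun=> 0)].
exists (fun G => \sum_(i < N) c i * L i G); split.
- by apply: measure_of_sum => i /hL[].
- by move=> P; apply: eq_bigr => i _; have [_ -> _] := hL i (ltn_ord i).
- by move=> P sP; rewrite big1// => i _; have [_ _ ->] := hL i (ltn_ord i); rewrite ?mulr0.
Qed.

Lemma represents_aff b nu c d t : 0 < d -> represents b nu ->
  represents (fun x => c * ratr d ^+ n / ratr d ^+ u * b (d^-1 * (x - t)))
    (fun P => c * nu (affp d t P)).
Proof.
move=> d0 [L [hb hL hk]].
have d0' : ratr d != 0 :> K by rewrite fmorph_eq0 lt0r_neq0.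
have nuZ e P : exists P', P'^`(u) = e *: P^`(u) /\ P'^`(n) = e *: P^`(n).
  by exists (e *: P); rewrite !derivnZ.
exists (fun G => c * ratr d ^+ n / ratr d ^+ u * L (affp d t G)); split.
- by apply: measure_of_aff; rewrite ?lt0r_neq0.
- move=> P; have LZ e G : L (e *: G) = e * L G.
    case: hb => l [_ _ hl]; rewrite !hl mulr_sumr; apply: eq_bigr => x _.
    by rewrite hornerZ mulrCA.
  have -> : affp d t P^`(u) = ((ratr d ^+ u)^-1 *: affp d t P)^`(u).
    by rewrite derivnZ derivn_affp scalerA mulVf ?expf_neq0// scale1r.
  by rewrite hL derivnZ derivn_affp !LZ; ring.
- move=> P sP; rewrite hk ?mulr0// (leq_trans _ sP)// /affp.
  have -> : size (P \Po ((ratr d)%:P * 'X + (ratr t)%:P)) = size P; last by [].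
  by rewrite size_comp_poly2// mul_polyC size_polyDl size_scale ?size_polyX// size_polyC; case: eqP.
Qed.

Lemma represents_ints : represents (fun x => \sum_(i < k.+1) g * B`_i * (x == i%:R)%:R) (mu (ints k)).
Proof.
exists (fun G => g * (opE B G).[0]); split.
- apply: measure_of_eq (measure_of_sum (fun i => g * B`_i) (fun i _ => measure_of_delta K i%:R)) => //.
  move=> G; rewrite (horner_opE _ _ Bsz) mulr_sumr; apply: eq_bigr => i _.
  by rewrite add0r ratr_nat mulrA.
- by move=> P; rewrite muB_.
- by move=> P /Bu->; rewrite horner0 mulr0.
Qed.

Lemma represents_lin b1 b2 nu1 nu2 c d : represents b1 nu1 -> represents b2 nu2 ->
  represents (fun x => c * b1 x + d * b2 x) (fun P => c * nu1 P + d * nu2 P).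
Proof.
move=> [L1 [h1 e1 z1]] [L2 [h2 e2 z2]].
exists (fun G => c * L1 G + d * L2 G); split.
- exact: measure_of_lin.
- by move=> P; rewrite e1 e2.
- by move=> P sP; rewrite z1 ?z2// !mulr0 addr0.
Qed.

Lemma represents_exists a : isknots k a -> exists b, represents b (mu a).
Proof.
move=> ka; have [D [L [N [D0 hD]]]] := common_grid a.
have [c hc] := mu_gridq D0 ka hD.
have D0' : 0 < D%:R^-1 :> rat by rewrite invr_gt0 ltr0n.
have -> : mu a = fun P => \sum_(j < N - k) c j * (1 * mu (ints k) (affp D%:R^-1 ((j%:R - L%:R) / D%:R) P)).
  by apply/funext => P; rewrite hc; apply: eq_bigr => j _; rewrite mul1r.
pose nu (j : nat) P := 1 * mu (ints k) (affp D%:R^-1 ((j%:R - L%:R) / D%:R) P).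
eexists; apply: (@represents_sum _ _ nu) => j _; exact: (represents_aff _ _ D0' represents_ints).
Qed.

(** Every polynomial is an n-th derivative, so the representing measure is unique. Linear and affine
    relations between the functionals thus pass to the measures. *)
Lemma family_exists : exists beta : seq rat -> rat -> K, [/\ knotfam k beta,
  forall a, isknots k a -> represents (beta a) (mu a) &
  forall i, (i <= k)%N -> beta (ints k) i%:R = g * B`_i].
Proof.
have /choice[beta hb] : forall a, exists b, isknots k a -> represents b (mu a).
  by move=> a; case: (boolP (isknots k a)) => [/represents_exists[b hb]|_]; [exists b|exists (fun=> 0)].
have bi x := represents_uniq (hb _ (ints_isknots k)) represents_ints x.
exists beta; split=> //.
- split.
  + move=> al j oal sal jk; have [c [d hcd]] := mu_span oal sal jk.
    exists c, d; have kw : isknots k (take k.+1 al).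
      by rewrite /isknots size_takel ?sal// eqxx take_sorted.
    have kt : isknots k (behead al).
      by rewrite /isknots size_behead sal eqxx -drop1 drop_sorted.
    have kr : isknots k (rem_at j al).
      by apply: rem_at_isknots => //; rewrite sal; lia.
    have := represents_lin c d (hb _ kw) (hb _ kt).
    have <- : mu (rem_at j al) = (fun P => c * mu (take k.+1 al) P + d * mu (behead al) P).
      by apply/funext => P; rewrite hcd.
    exact: represents_uniq (hb _ kr).
  + move=> a d t ka d0; have [c c0 hc] := mu_aff t ka d0.
    have d0' : ratr d != 0 :> K by rewrite fmorph_eq0 lt0r_neq0.
    exists (c * ratr d ^+ n / ratr d ^+ u).
      by rewrite mulf_neq0 ?invr_eq0 ?mulf_neq0 ?expf_neq0.
    move=> x; have := represents_aff c t d0 (hb _ ka).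
    have <- : mu (aff d t a) = (fun P => c * mu a (affp d t P)) by apply/funext => P; rewrite hc.
    move=> /(represents_uniq (hb _ (aff_isknots t d0 ka)))->.
    by rewrite addrK mulKf// lt0r_neq0.
  + move=> x; rewrite bi => h.
    have [i hi|h'] := pickP (fun i : 'I_k.+1 => x == i%:R).
      by exists i; [rewrite -ltnS ltn_ord|exact/eqP].
    by case/eqP: h; rewrite big1// => i _; rewrite h' mulr0.
- move=> i ik; rewrite bi (bigD1 (Ordinal (ik : (i < k.+1)%N)))//= eqxx mulr1 big1 ?addr0//.
  by move=> j; rewrite -val_eqE/= eqr_nat => h; rewrite eq_sym (negbTE h) mulr0.
Qed.

End WithSymbol.
End Link.

Lemma coef_derivn0 (K : numFieldType) (P : {poly K}) n : P`_n = P^`(n).[0] / n`!%:R.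
Proof.
by rewrite horner_coef0 coef_derivn addn0 ffactnn -[_ *+ _]mulr_natr mulfK ?pnatr_eq0 -?lt0n ?fact_gt0//.
Qed.

(** * The roots of the symbol *)

Section RootsOfUnity.
Variable K : closedFieldType.

(** Divisibility makes every positive power of w a root. Two of the powers coincide, so w is a root
    of unity, and 1 is one of its powers. *)
Lemma self_dilating_root (B : {poly K}) (w : K) : B != 0 ->
  (forall m, (1 < m)%N -> B %| (B \Po 'X^m)) -> root B w -> w != 0 ->
  root B 1 /\ exists2 d, (1 < d)%N & w ^+ d = 1.
Proof.
move=> B0 hB rw w0.
have rwm m : (0 < m)%N -> root B (w ^+ m).
  rewrite leq_eqVlt => /predU1P[<-//|m1].
  have /dvdpP[q qE] := hB m m1; have := congr1 (fun P : {poly K} => P.[w]) qE.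
  rewrite horner_comp hornerXn hornerM (rootP rw) mulr0 => /eqP.
  by [].
have [i [j [ij e]]] : exists i j, (i < j)%N /\ w ^+ i.+1 = w ^+ j.+1.
  apply: contrapT => h.
  have : (size [seq w ^+ i.+1 | i <- iota 0 (size B)] < size B)%N.
    apply: max_poly_roots => //; first by apply/allP => _ /mapP[i _ ->]; exact: rwm.
    rewrite map_inj_in_uniq ?iota_uniq// => i j _ _ e.
    by case: (ltngtP i j) => // ij; case: h; [exists i, j|exists j, i].
  by rewrite size_map size_iota ltnn.
have w1 : w ^+ (j - i) = 1.
  apply: (mulfI (expf_neq0 i.+1 w0)).
  by rewrite mulr1 -exprD addSn subnKC ?(ltnW ij).
(* The exponent is doubled because j - i may be 1. *)
have d1 : (1 < 2 * (j - i))%N by lia.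
have wd : w ^+ (2 * (j - i)) = 1 by rewrite mulnC exprM w1 expr1n.
by split; [rewrite -wd; apply: rwm; lia|exists (2 * (j - i))%N].
Qed.

(** Over a closed field, B is c X^v (X - 1)^u. The lowest nonzero coefficient gives v = s and the
    degree gives u + v = s + r. *)
Lemma self_dilating_shape (B Q1 : {poly K}) (u s r : nat) :
  B = Q1 * ('X - 1) ^+ u -> Q1.[1] != 0 ->
  (forall w, root B w -> w != 0 -> w = 1) ->
  (forall i, (i < s)%N || (s + r < i)%N -> B`_i = 0) -> B`_s != 0 -> B`_(s + r) != 0 ->
  u = r.
Proof.
move=> BE Q11 hw hout hs hsr.
have Q0 : Q1 != 0 by apply: contraNneq Q11 => ->; rewrite horner0.
have [v [Q2 [Q20 Q1E]]] := valuation_exists Q0.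
have Q2n0 : Q2 != 0 by apply: contraNneq Q20 => ->; rewrite coef0.
have szQ2 : size Q2 = 1%N.
  apply/eqP; apply: contraNT Q11 => h.
  have [w rw] := closed_rootP Q2 h.
  have w0 : w != 0 by apply: contraNneq Q20 => w0; move: rw; rewrite w0 rootE horner_coef0.
  have rB : root B w by rewrite BE Q1E !rootM rw.
  by move: rw; rewrite (hw w rB w0) Q1E hornerM => /rootP->; rewrite mul0r.
have [c c0 Q2E] : exists2 c, c != 0 & Q2 = c%:P by have /eqP/size_poly1P := szQ2.
have szB : size B = (u + v).+1.
  have h1 : size (('X - 1 : {poly K}) ^+ u) = u.+1.
    by rewrite -polyC1 size_exp_XsubC.
  have n1 : ('X - 1 : {poly K}) ^+ u != 0 by rewrite -size_poly_eq0 h1.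
  by rewrite BE size_mul// h1 Q1E Q2E mul_polyC size_scale// size_polyXn addSn addnS addnC.
have szB' : size B = (s + r).+1.
  apply/eqP; rewrite eqn_leq; apply/andP; split.
    by apply/leq_sizeP => j hj; apply: hout; rewrite hj orbT.
  by rewrite ltnNge; apply/negP => /leq_sizeP/(_ _ (leqnn _)) e; rewrite e eqxx in hsr.
have vs : v = s.
  have [C [C0 CE]] : exists C : {poly K}, C`_0 != 0 /\ B = C * 'X^v.
    exists (Q2 * ('X - 1) ^+ u); split; last by rewrite BE Q1E mulrAC.
    rewrite coef0M mulf_neq0// -horner_coef0 horner_exp hornerD hornerN hornerX hornerC.
    by rewrite sub0r expf_neq0// oppr_eq0 oner_eq0.
  have hv : B`_v != 0 by rewrite CE coefMXn ltnn subnn.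
  case: (ltngtP v s) => // h.
    by move: hv; rewrite hout ?h// eqxx.
  by move: hs; rewrite CE coefMXn h eqxx.
by move: szB; rewrite szB' vs addnC => -[/addIn].
Qed.

End RootsOfUnity.

(** * The theorem for functionals on polynomials *)

Section AlgebraicTheorem.
Variables (K : numClosedFieldType) (k : nat) (mu : seq rat -> {poly K} -> K).
Hypothesis mu_lin : forall a c P G, mu a (c *: P + G) = c * mu a P + mu a G.
Hypothesis mu_span : forall (al : seq rat) (j : nat), sorted <%R al -> size al = k.+2 ->
    (0 < j <= k)%N -> exists c d : K, forall P,
    mu (rem_at j al) P = c * mu (take k.+1 al) P + d * mu (behead al) P.
Hypothesis mu_aff : forall (a : seq rat) (d t : rat), isknots k a -> 0 < d ->
    exists2 c, c != 0 & forall P, mu (aff d t a) P = c * mu a (affp d t P).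
Hypothesis mu_neq0 : exists P, mu (ints k) P != 0.
Hypothesis k0 : (0 < k)%N.

Theorem mu_symbol : exists (B Q1 : {poly K}) (u n : nat) (g : K),
  [/\ B = Q1 * ('X - 1) ^+ u, Q1.[1] != 0, (size B <= k.+1)%N,
   (forall m, (1 < m)%N -> B %| (B \Po 'X^m)) &
   g != 0 /\ forall P, mu (ints k) P^`(u) = g * (opE B P^`(n)).[0]].
Proof.
have /choice[p hp] : forall m : nat, exists p : {poly K}, (1 < m)%N ->
    (size p <= m.-1 * k + 1)%N /\
    forall P, mu (ints k) (scalep m%:R P) = mu (ints k) (opE p P).
  move=> m; case: (ltnP 1 m) => [/(mu_refinable mu_lin mu_span mu_aff)[p hp]|_]; first by exists p.
  by exists 0.
have [B [Q1 [u [n [g [BE Q11 Bs Bd [g0 gE]]]]]]] :=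
  refinable_functional (mu_lin (ints k)) mu_neq0
    (fun m m1 P => (hp m m1).2 P) (fun m m1 => (hp m m1).1).
exists B, Q1, u, n, (g / n`!%:R); split=> //; split.
  by rewrite mulf_neq0// invr_eq0 pnatr_eq0 -lt0n fact_gt0.
by move=> P; rewrite gE coef_derivn0 derivn_opE mulrA mulrAC.
Qed.

Theorem mu_divided_difference (B Q1 : {poly K}) (u n s r : nat) (g : K) :
  B = Q1 * ('X - 1) ^+ u -> Q1.[1] != 0 -> (size B <= k.+1)%N ->
  (forall m, (1 < m)%N -> B %| (B \Po 'X^m)) -> g != 0 ->
  (forall P, mu (ints k) P^`(u) = g * (opE B P^`(n)).[0]) ->
  (s + r <= k)%N -> (s <= 2)%N -> (k - (s + r) <= 2)%N ->
  (forall i, (i < s)%N || (s + r < i)%N -> B`_i = 0) -> B`_s != 0 -> B`_(s + r) != 0 ->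
  forall a, isknots k a -> exists2 kap, kap != 0 & forall P, mu a P^`(r) =
    \sum_(i < r.+1) kap / node_prod (@knot_node K s r a) i * (P^`(n)).[knot_node K s a i].
Proof.
move=> BE Q11 Bs Bd g0 muE hsr hs2 hr2 hout Bs0 Bsr0.
have Bker (P : {poly K}) : (size P <= u)%N -> opE B P = 0.
  by move=> sP; rewrite BE derivn_opE_low.
have [beta [Hb hrep hint]] := family_exists mu_span mu_aff Bs g0 Bker muE.
have hb0 i : (i <= k)%N -> (i < s)%N || (s + r < i)%N -> beta (ints k) i%:R = 0.
  by move=> ik h; rewrite hint// hout// mulr0.
have hbs : beta (ints k) s%:R != 0 by rewrite hint ?mulf_neq0//; lia.
have Hends := kf_ends Hb k0 hsr hs2 hr2 hb0.
have Hleft := kf_left_end Hb k0 hsr hs2 hr2 hb0 hbs.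
have B0 : B != 0 by apply: contraNneq Bs0 => ->; rewrite coef0.
have sumB w : root B w -> \sum_(i < k.+1) beta (ints k) i%:R * w ^+ i = 0.
  move=> /rootP; rewrite (horner_coef_wide _ Bs) => h.
  rewrite -[RHS](mulr0 g) -[X in _ = g * X]h mulr_sumr; apply: eq_bigr => i _.
  by rewrite hint ?mulrA// -ltnS ltn_ord.
have hw w : root B w -> w != 0 -> w = 1.
  move=> rw w0; have [r1 [d d1 wd]] := self_dilating_root B0 Bd rw w0.
  case: (posnP r) => [rz|r0]; last first.
    apply: (kf_root_one Hb k0 hsr Hends Hleft r0 d1 w0 wd (sumB w rw)).
    rewrite -[RHS](sumB 1 r1); apply: eq_bigr => i _; by rewrite expr1n mulr1.
  (* For r = 0 the polynomial B is a monomial and has no nonzero root. *)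
  move/rootP: rw; rewrite horner_coef => h.
  have sB : (s < size B)%N.
    by rewrite ltnNge; apply/negP => /leq_sizeP/(_ _ (leqnn _)) e; rewrite e eqxx in Bs0.
  move: h; rewrite (bigD1 (Ordinal sB))//= big1 ?addr0.
    by move/eqP; rewrite mulf_eq0 (negbTE Bs0) expf_eq0 (negbTE w0) andbF.
  move=> i; rewrite -val_eqE /= => is_; rewrite hout ?mul0r//.
  by rewrite rz addn0 -neq_ltn.
have ur : u = r by exact: (self_dilating_shape BE Q11 hw hout Bs0 Bsr0).
(* With u = r, the measures kill the degrees less than r and live on r + 1 knots, which leaves one
   free factor. *)
move: muE Bker hrep hint; rewrite ur => muE Bker hrep hint.
have Hkill a (P : {poly K}) (l : seq rat) : isknots k a -> (size P <= r)%N ->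
    uniq l -> (forall x, beta a x != 0 -> x \in l) -> \sum_(x <- l) beta a x * P.[ratr x] = 0.
  move=> ka sP ul hl; have [L [hL _ hz]] := hrep a ka.
  by rewrite -(measure_of_any hL ul hl) hz.
move=> a ka; have /andP[/eqP sa oa] := ka.
have [kap hk] := kf_divided_difference k0 hsr Hends Hkill ka.
have nz := kf_nonzero Hb k0 hsr Hends Hleft Hkill ka.
exists kap.
  apply: contraNneq nz => kz; rewrite -[s]addn0 -[0%N]/(nat_of_ord (@ord0 r)).
  by rewrite hk kz mul0r.
move=> P; have [L [hL hE _]] := hrep a ka.
rewrite hE (measure_of_any hL (l := [seq a`_(s + i) | i <- iota 0 r.+1])).
- rewrite big_map -[iota 0 r.+1]/(index_iota 0 r.+1) big_mkord.
  by apply: eq_bigr => i _; rewrite hk.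
- rewrite map_inj_in_uniq ?iota_uniq// => i j; rewrite !mem_iota => hi hj.
  by move=> /(sorted_nth_inj oa); rewrite sa; clear -hi hj hsr; lia.
- move=> x /(Hends a x ka)[i ir ->]; apply/mapP; exists i => //.
  by rewrite mem_iota add0n ltnS.
Qed.

End AlgebraicTheorem.

Import numFieldNormedType.Exports.
Local Open Scope classical_set_scope.
Local Open Scope ring_scope.

(** * Density of polynomials among smooth functions *)

Section Approximation.
Variable R : realType.
Implicit Types (f : R -> R) (P : {poly R}).

Lemma rsmooth_is_derive f (x : R) : rsmooth f -> is_derive x 1 f (derive1 f x).
Proof. by move=> sf; split; [exact: (sf 0%N)|rewrite derive1E]. Qed.

Lemma is_derive_continuous f df : (forall x : R, is_derive x 1 f (df x)) -> continuous f.
Proof.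
move=> h x; apply/differentiable_continuous; rewrite -derivable1_diffP.
by have [] := h x.
Qed.

Lemma rsmooth_continuous f : rsmooth f -> continuous f.
Proof. by move=> sf; apply: is_derive_continuous => x; exact: rsmooth_is_derive. Qed.

Lemma mvt_lipschitz f df (a b C : R) : (forall x : R, is_derive x 1 f (df x)) ->
  (forall x, a <= x <= b -> `|df x| <= C) ->
  forall x y, a <= x <= b -> a <= y <= b -> `|f x - f y| <= C * `|x - y|.
Proof.
move=> hf hC x y; wlog xy : x y / x <= y.
  move=> W hx hy; case: (leP x y) => h; first exact: W.
  by rewrite distrC [`|x - y|]distrC; apply: W => //; exact: ltW.
move=> /andP[ax xb] /andP[ay yb].
have cf : {within `[x, y], continuous f}.
  by apply: continuous_subspaceT; exact: is_derive_continuous.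
have [c] := MVT_segment xy (fun z _ => hf z) cf.
rewrite in_itv/= => /andP[xc cy] E.
rewrite distrC E normrM [`|x - y|]distrC ler_wpM2r// hC//.
by rewrite (le_trans ax xc) (le_trans cy yb).
Qed.

Lemma continuous_bounded f (a b : R) : continuous f ->
  exists2 C : R, 0 < C & forall x, a <= x <= b -> `|f x| <= C.
Proof.
move=> cf; have [ab|ab] := leP a b; last first.
  by exists 1 => // x /andP[h1 h2]; move: ab; rewrite ltNge (le_trans h1 h2).
have cn : {within `[a, b], continuous (fun x => `|f x|)}.
  apply: continuous_subspaceT => x; apply: (@continuous_comp _ _ _ f Num.norm); first exact: cf.
  exact: norm_continuous.
have [c cab hc] := EVT_max ab cn.
exists (`|f c| + 1); first by rewrite ltr_wpDl.
move=> x hx; rewrite (le_trans (hc x _)) ?in_itv//=.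
by rewrite lerDl.
Qed.

(** The Bernstein polynomial with samples h 0, ..., h n, by de Casteljau recursion. For x in [0, 1],
    its value at x is the mean of h under the binomial law of parameters n and x. *)
Fixpoint bernstein n (h : nat -> R) : {poly R} :=
  if n is n'.+1 then 'X * bernstein n' (fun k => h k.+1) + (1 - 'X) * bernstein n' h
  else (h 0%N)%:P.

Lemma bernsteinS n h x : (bernstein n.+1 h).[x] =
  x * (bernstein n (fun k => h k.+1)).[x] + (1 - x) * (bernstein n h).[x].
Proof. by rewrite /= !hornerE. Qed.

Lemma bernstein_lin n h g (c : R) x :
  (bernstein n (fun k => h k + c * g k)).[x] = (bernstein n h).[x] + c * (bernstein n g).[x].
Proof.
elim: n h g => [|n IH] h g; first by rewrite /= !hornerE.
rewrite !bernsteinS !IH; ring.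
Qed.

Lemma bernstein_const n (c : R) x : (bernstein n (fun=> c)).[x] = c.
Proof. by elim: n => [|n IH]; [rewrite /= hornerE|rewrite bernsteinS IH; ring]. Qed.

Lemma bernstein_le n h g x : 0 <= x <= 1 -> (forall k, (k <= n)%N -> h k <= g k) ->
  (bernstein n h).[x] <= (bernstein n g).[x].
Proof.
move=> /andP[x0 x1]; elim: n h g => [|n IH] h g hg; first by rewrite /= !hornerE hg.
rewrite !bernsteinS lerD// ler_wpM2l ?subr_ge0//; apply: IH => k kn; apply: hg => //.
by rewrite leqW.
Qed.

(** The binomial mean of (k - c)^2: squared bias plus variance. *)
Lemma bernstein_var n (c x : R) : (bernstein n (fun k => (k%:R - c) ^+ 2)).[x] =
  (n%:R * x - c) ^+ 2 + n%:R * x * (1 - x).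
Proof.
elim: n c => [|n IH] c; first by rewrite /= hornerE; ring.
rewrite bernsteinS IH.
have -> : (fun k : nat => (k.+1%:R - c) ^+ 2) = (fun k : nat => (k%:R - (c - 1)) ^+ 2).
  by apply/funext => k; rewrite -natr1; congr (_ ^+ 2); ring.
rewrite IH -natr1; ring.
Qed.

(** By the inequality of arithmetic and geometric means, L |x - k/N| <= e/2 + L^2 (x - k/N)^2 /
    (2e). The mean of the last term is at most e/2, by the variance formula and N > L^2 / e^2. *)
Lemma bernstein_approx f (L e : R) : 0 < e -> 0 <= L ->
  (forall x y, 0 <= x <= 1 -> 0 <= y <= 1 -> `|f x - f y| <= L * `|x - y|) ->
  exists P, forall x, 0 <= x <= 1 -> `|f x - P.[x]| <= e.
Proof.
move=> e0 L0 hL.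
have [n hn] : exists n : nat, (L ^+ 2) / (e ^+ 2) < n.+1%:R.
  have := archi_boundP (ltW (ltr_pwDl (@ltr01 R) (divr_ge0 (sqr_ge0 L) (sqr_ge0 e)))).
  set N := Num.bound _ => hN; exists N; apply: lt_trans (lt_trans hN _); rewrite ?ltr_nat//.
  by rewrite ltrDr.
set N := n.+1 in hn *; have N0 : 0 < N%:R :> R by rewrite ltr0n.
exists (bernstein N (fun k => f (k%:R / N%:R))) => x hx; have /andP[x0 x1] := hx.
pose V (k : nat) : R := (k%:R - N%:R * x) ^+ 2.
pose c : R := L ^+ 2 / (2 * e * N%:R ^+ 2).
have key k : (k <= N)%N -> `|f x - f (k%:R / N%:R)| <= e / 2 + c * V k.
  move=> kN; have hk : 0 <= (k%:R / N%:R : R) <= 1.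
    by rewrite divr_ge0//= ler_pdivrMr// mul1r ler_nat.
  apply: le_trans (hL _ _ hx hk) _.
  set d := `|_|; have dE : d ^+ 2 = V k / N%:R ^+ 2.
    rewrite /d real_normK ?num_real// /V -[x in x - _](mulfK (lt0r_neq0 N0)) -mulrBl.
    by rewrite exprMn exprVn -sqrrN opprB [x * _]mulrC.
  have -> : c * V k = (L * d) ^+ 2 / (2 * e).
    rewrite exprMn dE /c; field; by rewrite !lt0r_neq0.
  have h : 0 <= (L * d - e) ^+ 2 := sqr_ge0 _.
  have e2 : 0 < 2 * e by rewrite mulr_gt0.
  have hE : (L * d) ^+ 2 / (2 * e) * (2 * e) = (L * d) ^+ 2 by rewrite divfK// lt0r_neq0.
  rewrite -(ler_pM2r e2); move: hE h; set E := _ / (2 * e); set y := L * d; nra.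
have tot : (bernstein N (fun k => e / 2 + c * V k)).[x] <= e.
  rewrite bernstein_lin bernstein_const bernstein_var subrr expr0n add0r.
  have -> : c * (N%:R * x * (1 - x)) = (L ^+ 2 / (e ^+ 2)) / N%:R * (x * (1 - x)) * (e / 2).
    rewrite /c; field; by rewrite !lt0r_neq0.
  have h1 : L ^+ 2 / e ^+ 2 / N%:R <= 1 by rewrite ler_pdivrMr// mul1r ltW.
  have h0 : 0 <= L ^+ 2 / e ^+ 2 / N%:R by rewrite !divr_ge0// ?sqr_ge0// ltW.
  have h2 : 0 <= x * (1 - x) <= 1 by apply/andP; split; nra.
  have : L ^+ 2 / e ^+ 2 / N%:R * (x * (1 - x)) <= 1.
    by case/andP: h2 => ? ?; rewrite mulr_ile1.
  have : 0 < e / 2 by rewrite divr_gt0.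
  nra.
rewrite ler_norml; apply/andP; split.
- suff : (bernstein N (fun k => f (k%:R / N%:R))).[x] <= f x + e by lra.
  apply: le_trans (_ : (bernstein N (fun k => f x + 1 * (e / 2 + c * V k))).[x] <= _).
    apply: bernstein_le => // k /key; rewrite ler_norml => /andP[h _]; lra.
  by rewrite bernstein_lin bernstein_const mul1r lerD2l.
- suff : f x <= (bernstein N (fun k => f (k%:R / N%:R))).[x] + e by lra.
  apply: le_trans (_ : (bernstein N (fun k => f (k%:R / N%:R) + 1 * (e / 2 + c * V k))).[x] <= _).
    rewrite -{1}(bernstein_const N (f x) x).
    apply: bernstein_le => // k /key; rewrite ler_norml => /andP[_ h]; lra.
  by rewrite bernstein_lin mul1r lerD2l.
Qed.

Lemma derive1n_horner n P : derive1n n (horner P) = horner P^`(n).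
Proof. by elim: n => // n IH; rewrite derive1nS IH derivnS derivE. Qed.

Lemma rsmooth_horner P : rsmooth (horner P).
Proof. by move=> n x; rewrite derive1n_horner; exact: derivable_horner. Qed.

Lemma poly_approx0 f (r e : R) : rsmooth f -> 0 < r -> 0 < e ->
  exists P, forall x, `|x| <= r -> `|f x - P.[x]| < e.
Proof.
move=> sf r0 e0.
have [C C0 hC] := continuous_bounded (- r) r (rsmooth_continuous (rsmooth_derive1 sf)).
pose g t := f (2 * r * t + - r).
have hg x y : 0 <= x <= 1 -> 0 <= y <= 1 -> `|g x - g y| <= (C * (2 * r)) * `|x - y|.
  move=> /andP[x0 x1] /andP[y0 y1]; rewrite /g.
  have H z : 0 <= z -> z <= 1 -> - r <= 2 * r * z + - r <= r.
    by move=> z0 z1; apply/andP; split; nra.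
  apply: le_trans (mvt_lipschitz (fun z => rsmooth_is_derive z sf) hC (H _ x0 x1) (H _ y0 y1)) _.
  rewrite -[C * (2 * r) * _]mulrA; apply: ler_wpM2l; first exact: ltW.
  have -> : 2 * r * x + - r - (2 * r * y + - r) = 2 * r * (x - y) by ring.
  by rewrite normrM (ger0_norm (_ : 0 <= 2 * r))// mulr_ge0// ltW.
have L0 : 0 <= C * (2 * r) by rewrite !mulr_ge0// ltW.
have e2 : 0 < e / 2 by rewrite divr_gt0.
have [P hP] := bernstein_approx e2 L0 hg.
exists (P \Po ((2 * r)^-1%:P * ('X + r%:P))) => x; rewrite ler_norml => /andP[x1 x2].
have r2 : 0 < 2 * r by rewrite mulr_gt0.
pose t := (2 * r)^-1 * (x + r).
have -> : (P \Po ((2 * r)^-1%:P * ('X + r%:P))).[x] = P.[t] by rewrite horner_comp !hornerE.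
have -> : f x = g t by rewrite /g /t mulVKf ?lt0r_neq0// addrK.
apply: le_lt_trans (hP t _) _; last by rewrite ltr_pdivrMr// ltr_pMr// ltr1n.
rewrite /t mulrC ler_pdivlMr// mul0r ler_pdivrMr// mul1r; apply/andP; split; lra.
Qed.

Lemma antiderivp P (c : R) : exists Q : {poly R}, Q^`() = P /\ Q.[0] = c.
Proof.
exists (c%:P + \poly_(i < (size P).+1) (if i == 0%N then 0 else P`_i.-1 / i%:R)); split.
  rewrite derivD derivC add0r; apply/polyP => i; rewrite coef_deriv coef_poly ltnS.
  case: ltnP => [hi|hi]; last by rewrite mul0rn nth_default.
  by rewrite /= -[_ *+ _]mulr_natr -mulrA mulVf ?mulr1// pnatr_eq0.
by rewrite hornerD hornerC horner_coef0 coef_poly /= addr0.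
Qed.

(** The derivative is approximated first, to precision e / (2r), and the approximation is integrated
    from 0; the mean value inequality then controls the function itself. *)
Lemma poly_approx m f (r e : R) : rsmooth f -> 0 < r -> 0 < e ->
  exists P, forall j x, (j <= m)%N -> `|x| <= r -> `|derive1n j f x - P^`(j).[x]| < e.
Proof.
elim: m f e => [|m IH] f e sf r0 e0.
  have [P hP] := poly_approx0 sf r0 e0; exists P => j x; rewrite leqn0 => /eqP-> hx.
  exact: hP.
pose e' := Num.min e (e / (2 * r)).
have e'0 : 0 < e' by rewrite lt_min e0 divr_gt0 ?mulr_gt0.
have [P' hP'] := IH _ _ (rsmooth_derive1 sf) r0 e'0.
have [P [P'E P0]] := antiderivp P' (f 0).
have hd x : `|x| <= r -> `|derive1 f x - P'.[x]| < e'.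
  by move=> hx; have := hP' 0%N x (leq0n _) hx.
exists P => -[|j] x jm hx; last first.
  rewrite derivSn P'E; have := hP' j x jm hx.
  rewrite /derive1n -iterSr => h; apply: lt_le_trans h _.
  by rewrite ge_min lexx.
have Dh (z : R) : is_derive z 1 (fun z => f z - P.[z]) (derive1 f z - P'.[z]).
  by rewrite -P'E; exact: (is_deriveB (rsmooth_is_derive z sf) (is_derive_poly P z)).
have hr z : (`|z| <= r) = (- r <= z <= r) by rewrite ler_norml.
have hd' z : - r <= z <= r -> `|derive1 f z - P'.[z]| <= e' by rewrite -hr => /hd/ltW.
have x0 : - r <= 0 <= r by rewrite oppr_le0 ltW.
have := mvt_lipschitz Dh hd' _ x0 => /(_ x); rewrite -hr => /(_ hx).
rewrite P0 subrr subr0 [x - 0]subr0 /= => h; apply: le_lt_trans h _.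
apply: le_lt_trans (_ : e / (2 * r) * r < _).
  apply: ler_pM => //; first exact: ltW.
  by rewrite /e' ge_min lexx orbT.
by rewrite invfM mulrA divfK ?lt0r_neq0// ltr_pdivrMr// ltr_pMr// ltr1n.
Qed.

End Approximation.

(** * Smooth cut-offs and antiderivatives *)

Section SmoothFunctions.
Variable R : realType.
Implicit Types (f g : R -> R) (P : {poly R}).

Fixpoint Ck n f : Prop := (forall x : R, derivable f x 1) /\
  (if n is n'.+1 then Ck n' (derive1 f) else True).

Lemma rsmooth_Ck f : rsmooth f <-> forall n, Ck n f.
Proof.
split=> [sf n|h n x].
  elim: n f sf => [|n IH] f sf; split=> //; try exact: (sf 0%N).
  exact/IH/rsmooth_derive1.
elim: n f h => [|n IH] f h; first by have [] := h 0%N.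
rewrite /derive1n iterSr; apply: IH => m; by have [] := h m.+1.
Qed.

Lemma Ck_S n f : Ck n.+1 f -> Ck n f.
Proof. by elim: n f => [|n IH] f [df hf]; split=> //; exact: IH. Qed.

Lemma is_derive_derive1 f (x : R) df : is_derive x 1 f df -> derive1 f x = df.
Proof. by move=> h; rewrite derive1E derive_val. Qed.

Lemma derivable_is_derive f (x : R) : derivable f x 1 -> is_derive x 1 f (derive1 f x).
Proof. by move=> h; split=> //; rewrite derive1E. Qed.

Lemma CkD n f g : Ck n f -> Ck n g -> Ck n (fun x => f x + g x).
Proof.
elim: n f g => [|n IH] f g [df hf] [dg hg].
  by split=> // x; exact: (derivableD (df x) (dg x)).
have D x := is_deriveD (derivable_is_derive (df x)) (derivable_is_derive (dg x)).
split; first by move=> x; have [] := D x.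
have -> : derive1 (fun x => f x + g x) = fun x => derive1 f x + derive1 g x.
  by apply/funext => x; exact: is_derive_derive1 (D x).
exact: IH.
Qed.

Lemma CkM n f g : Ck n f -> Ck n g -> Ck n (fun x => f x * g x).
Proof.
elim: n f g => [|n IH] f g cf cg; have [df hf] := cf; have [dg hg] := cg.
  by split=> // x; exact: (derivableM (df x) (dg x)).
have D x := is_deriveM (derivable_is_derive (df x)) (derivable_is_derive (dg x)).
split; first by move=> x; have [] := D x.
have -> : derive1 (fun x => f x * g x) = fun x => f x * derive1 g x + g x * derive1 f x.
  by apply/funext => x; exact: is_derive_derive1 (D x).
by apply: CkD; apply: IH => //; exact: Ck_S.
Qed.

Lemma rsmoothM f g : rsmooth f -> rsmooth g -> rsmooth (fun x => f x * g x).
Proof. by move=> /rsmooth_Ck hf /rsmooth_Ck hg; apply/rsmooth_Ck => n; exact: CkM. Qed.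

(* [flat P] is P(1/x) exp(-1/x) on the positive half-line, and this family is
   closed under derivation. *)
Definition flat P (x : R) : R := if 0 < x then P.[x^-1] * expR (- x^-1) else 0.

Definition flat_deriv P : {poly R} := 'X ^+ 2 * (P - P^`()).

(** For y = 1/x, the exponential of y exceeds y^(i+2) / (i+2)!. The exponent 2 makes the difference
    quotient at 0 tend to 0. *)
Lemma flat_small P : exists2 C, 0 < C & forall x, `|flat P x| <= C * x ^+ 2.
Proof.
pose N := (size P).+2.
pose S := \sum_(i < size P) `|P`_i|.
have S0 : 0 <= S by apply: sumr_ge0.
pose F := (\sum_(i < size P) `|P`_i| * (i.+2)`!%:R + 1).
have F0 : 0 < F by rewrite ltr_wpDl// sumr_ge0// => i _; rewrite mulr_ge0.
exists F => // x; rewrite /flat; case: ltP => x0; last first.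
  by rewrite normr0 mulr_ge0 ?sqr_ge0// ltW.
set y := x^-1; have y0 : 0 < y by rewrite invr_gt0.
rewrite normrM (ger0_norm (expR_ge0 _)) horner_coef.
apply: le_trans (_ : \sum_(i < size P) `|P`_i| * y ^+ i * expR (- y) <= _).
  rewrite -mulr_suml ler_wpM2r ?expR_ge0//; apply: le_trans (ler_norm_sum _ _ _) _.
  by apply: ler_sum => i _; rewrite normrM normrX (gtr0_norm y0).
have key i : y ^+ i * expR (- y) <= (i.+2)`!%:R * x ^+ 2.
  rewrite expRN ler_pdivrMr ?expR_gt0//.
  have h := expR_ge1Dxn i.+1 (ltW y0).
  have f0 : 0 < (i.+2)`!%:R :> R by rewrite ltr0n fact_gt0.
  have x2 : 0 < x ^+ 2 by rewrite exprn_gt0.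
  have : y ^+ i.+2 / (i.+2)`!%:R <= expR y by apply: le_trans h; rewrite lerDr.
  rewrite ler_pdivrMr// => h2.
  have -> : y ^+ i = y ^+ i.+2 * x ^+ 2.
    by rewrite -addn2 exprD -mulrA -exprMn mulVf ?lt0r_neq0// expr1n mulr1.
  by rewrite [leRHS]mulrAC ler_pM2r// [leRHS]mulrC.
rewrite /F mulrDl mul1r; apply: (@le_trans _ _ (\sum_(i < size P) `|P`_i| * (i.+2)`!%:R * x ^+ 2)).
  by apply: ler_sum => i _; rewrite -!mulrA ler_wpM2l// key.
by rewrite -mulr_suml lerDl sqr_ge0.
Qed.

Lemma is_derive_flat P (x : R) : is_derive x 1 (flat P) (flat (flat_deriv P) x).
Proof.
case: (ltgtP x 0) => x0.
- rewrite {2}/flat ltNge (ltW x0) /=.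
  apply: (near_eq_is_derive _ (is_derive_cst (0 : R) x 1)).
  by near=> z; rewrite /flat ltNge (_ : z <= 0)//; apply: ltW; near: z; exact: lt_nbhsl.
- rewrite {2}/flat x0.
  have Di : is_derive x 1 (fun y : R => y^-1) (- x ^- 2).
    by have := is_deriveV (lt0r_neq0 x0) (is_derive_id x (1:R)); rewrite /GRing.scale/= mulr1.
  have DP := is_derive1_comp (is_derive_poly P x^-1) Di.
  have De := @is_derive1_comp R expR (- (fun y : R => y^-1)) x _ _ (is_derive_expR (- x^-1)) (is_deriveN Di).
  have DM := is_deriveM DP De.
  apply: (near_eq_is_derive (f := (horner P \o GRing.inv) * (expR \o - (fun y => y^-1)))).
    near=> z; rewrite /flat (_ : 0 < z)//; near: z; exact: lt_nbhsr.
  apply: is_derive_eq DM _.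
  by rewrite /GRing.scale/= /flat_deriv !hornerE /= -exprVn; ring.
- rewrite x0 {2}/flat ltxx; apply/is_derive1_caratheodory.
  have [C C0 hC] := flat_small P.
  exists (fun z => flat P z / z); split.
  + move=> z; rewrite subr0 {2}/flat ltxx subr0.
    have [->|z0] := eqVneq z 0; first by rewrite mulr0 /flat ltxx.
    by rewrite divfK.
  + have cv : (fun z : R => C * `|z|) @ (0 : R) --> (0 : R).
      have h : (fun z : R => `|z|) @ (0 : R) --> `|0 : R|.
        by apply: (@cvg_norm _ _ _ _ _ id); exact: cvg_id.
      have := cvgM (@cvg_cst _ C _ _ _) h.
      by rewrite normr0 mulr0 => h'; exact: h'.
    rewrite /prop_for /continuous_at (_ : flat P 0 / 0 = 0); last by rewrite /flat ltxx mul0r.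
    apply/cvgr0Pnorm_lt => e e0; have /cvgr0Pnorm_lt/(_ e e0) := cv.
    apply: filterS => z; apply: le_lt_trans.
    have [->|z0] := eqVneq z 0; first by rewrite /flat ltxx mul0r !normr0 mulr0 normr0.
    rewrite normrM normfV ler_pdivrMr ?normr_gt0// normrM normr_id.
    apply: le_trans (hC z) _.
    by rewrite (gtr0_norm C0) -mulrA -expr2 real_normK ?num_real.
  + by rewrite {1}/flat ltxx mul0r.
Unshelve. all: by end_near. Qed.

Lemma rsmooth_flat P : rsmooth (flat P).
Proof.
apply/rsmooth_Ck => n; elim: n P => [|n IH] P; split=> //; try by move=> x; have [] := is_derive_flat P x.
have -> : derive1 (flat P) = flat (flat_deriv P); last exact: IH.
by apply/funext => x; exact: is_derive_derive1 (is_derive_flat P x).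
Qed.

Definition rbump (x : R) := flat 1 (1 * x + 1) * flat 1 (-1 * x + 1).

Lemma rsmooth_rbump : rsmooth rbump.
Proof. by apply: rsmoothM; apply: rsmooth_affine; exact: rsmooth_flat. Qed.

Lemma rbump0 : rbump 0 != 0.
Proof.
rewrite /rbump !mulr0 add0r /flat ltr01 !hornerE.
by rewrite /= mulr1 mulf_neq0 ?lt0r_neq0 ?expR_gt0.
Qed.

Lemma rbump_out x : 1 < `|x| -> rbump x = 0.
Proof.
rewrite lter_normr => /orP[h|h]; rewrite /rbump.
  by rewrite [X in _ * X]/flat ltNge (_ : -1 * x + 1 <= 0) ?mulr0//; lra.
by rewrite /flat ltNge (_ : 1 * x + 1 <= 0) ?mul0r//; lra.
Qed.

Lemma antiderivative_left f (c : R) : continuous f -> (forall x, x < c -> f x = 0) ->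
  exists2 F, (forall x : R, is_derive x 1 F (f x)) & forall x, x < c -> F x = 0.
Proof.
move=> cf hf; pose a := c - 1.
pose F x := (\int[lebesgue_measure]_(t in `[a, x]) f t)%R.
have F0 x : x < c -> F x = 0.
  move=> xc; rewrite /F; under eq_Rintegral => t.
    rewrite inE /= in_itv/= => /andP[_ tx]; rewrite hf; last exact: le_lt_trans tx xc.
    over.
  by rewrite Rintegral_cst// mul0r.
exists F => // x; have [xc|cx] := ltP x c.
  rewrite hf//; apply: (near_eq_is_derive _ (is_derive_cst (0 : R) x 1)).
  by near=> z; rewrite F0//; near: z; exact: lt_nbhsl.
have ax : a < x by rewrite /a (lt_le_trans _ cx)// ltrBlDr ltrDl.
have xu : x < x + 1 by rewrite ltrDl.
have intf : lebesgue_measure.-integrable `[a, x + 1] (EFin \o f).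
  by apply: continuous_compact_integrable; [exact: segment_compact|exact: continuous_subspaceT].
have [d1 d2] := continuous_FTC1_closed xu intf ax (cf x).
by split=> //; rewrite -derive1E.
Unshelve. all: by end_near. Qed.

Lemma antiderivative_right f (c : R) : continuous f -> (forall x, c < x -> f x = 0) ->
  exists2 F, (forall x : R, is_derive x 1 F (f x)) & forall x, c < x -> F x = 0.
Proof.
move=> cf hf; pose g x := - f (- x).
have cg : continuous g.
  move=> x; apply: cvgN; apply: (@continuous_comp _ _ _ -%R f); first exact: opp_continuous.
  exact: cf.
have hg x : x < - c -> g x = 0 by move=> h; rewrite /g hf ?oppr0// ltrNr.
have [G dG G0] := antiderivative_left cg hg.
exists (fun x => G (- x)); last by move=> x xc; rewrite G0// ltrN2.
move=> x; apply: is_derive_eq (is_derive1_comp (dG (- x)) (is_deriveN (is_derive_id x (1:R)))) _.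
by rewrite /g opprK mulrN1 opprK.
Qed.

Lemma rsmooth_antiderivative f F : rsmooth f -> (forall x : R, is_derive x 1 F (f x)) ->
  rsmooth F /\ derive1 F = f.
Proof.
move=> sf dF; have e : derive1 F = f by apply/funext => x; exact: is_derive_derive1 (dF x).
split=> //; case=> [|n] x; first by have [] := dF x.
by rewrite /derive1n iterSr e; exact: sf.
Qed.

End SmoothFunctions.

Local Open Scope complex_scope.

(** * Polynomials as test functions *)

Section PolynomialTests.
Variable R : realType.
Implicit Types (A B : {poly R}) (P G : {poly R[i]}) (phi : testfun R) (T : functional R).

Definition cpoly A B : {poly R[i]} :=
  map_poly (real_complex R) A + 'i *: map_poly (real_complex R) B.

Lemma complexE' (x y : R) : x +i* y = x%:C + 'i * y%:C.
Proof. by rewrite [LHS]complexE. Qed.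

Lemma horner_cpoly A B x : (cpoly A B).[x%:C] = A.[x] +i* B.[x].
Proof. by rewrite hornerD hornerZ !horner_map complexE'. Qed.

Lemma cpoly_onto P : exists A B, P = cpoly A B.
Proof.
exists (\poly_(i < size P) complex.Re P`_i), (\poly_(i < size P) complex.Im P`_i).
by apply/polyP => i; rewrite coefD coefZ !coef_map/= -complexE.
Qed.

Lemma deriv_cpoly A B : (cpoly A B)^`() = cpoly A^`() B^`().
Proof. by rewrite derivD derivZ !deriv_map. Qed.

Lemma polytest_subproof P : (fun x : R => P.[x%:C] : R[i]^o) \in @smooth_fun R.
Proof.
have [A [B ->]] := cpoly_onto P; apply/smooth_funP; split.
- rewrite (_ : (fun x => _) = horner A); first exact: rsmooth_horner.
  by apply/funext => x; rewrite horner_cpoly.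
- rewrite (_ : (fun x => _) = horner B); first exact: rsmooth_horner.
  by apply/funext => x; rewrite horner_cpoly.
Qed.

Definition polytest P : testfun R := TestFun (polytest_subproof P).

Lemma cderiven_cpoly n A B x :
  cderiven n (polytest (cpoly A B)) x = A^`(n).[x] +i* B^`(n).[x].
Proof.
rewrite /cderiven -!derive1n_horner; congr (derive1n _ _ _ +i* derive1n _ _ _);
by apply/funext => y /=; rewrite horner_cpoly.
Qed.

Lemma test_deriv_poly P : test_deriv (polytest P) = polytest P^`().
Proof.
have [A [B ->]] := cpoly_onto P; apply/val_inj/funext => x.
by rewrite [LHS]cderiven_cpoly !derivn1 deriv_cpoly /= horner_cpoly.
Qed.

Lemma test_derivn_poly n P : iter n (@test_deriv R) (polytest P) = polytest P^`(n).
Proof. by elim: n => // n IH; rewrite iterS IH test_deriv_poly derivnS. Qed.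

Lemma test_affine_poly (c d : rat) P :
  test_affine (ratr c) (ratr d) (polytest P) = polytest (affp c d P).
Proof.
apply/val_inj/funext => x /=; rewrite horner_affp; congr (P.[_]).
by rewrite rmorphD rmorphM/= !(fmorph_rat (real_complex R)).
Qed.

Lemma polytest_linear c P G : polytest (c *: P + G) = c *: polytest P + polytest G.
Proof. by apply/val_inj/funext => x /=; rewrite hornerD hornerZ. Qed.

Lemma norm_complex_lt (x y e : R) : `|x| < e / 2 -> `|y| < e / 2 -> `|x +i* y| < e%:C.
Proof.
move=> hx hy; rewrite complexE'; apply: le_lt_trans (ler_normD _ _) _.
have Ni : `|'i : R[i]| = 1 by rewrite normc_def/= expr0n expr1n add0r sqrtr1.
rewrite normrM Ni mul1r.
have N (z : R) : `|z%:C| = (`|z|)%:C by rewrite normc_def/= expr0n addr0 sqrtr_sqr.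
by rewrite !N -rmorphD/= ltcR [e]splitr ltrD.
Qed.

Lemma poly_dense phi m (r e : R) : 0 < e -> exists P, forall j x, (j <= m)%N -> `|x| <= r ->
  `|cderiven j (polytest P) x - cderiven j phi x| < e%:C.
Proof.
move=> e0; have [sr si] := tf_smooth phi.
have r0 : 0 < `|r| + 1 :> R by rewrite ltr_wpDl.
have e2 : 0 < e / 2 by rewrite divr_gt0.
have [A hA] := poly_approx m sr r0 e2; have [B hB] := poly_approx m si r0 e2.
exists (cpoly A B) => j x jm hx.
have hx' : `|x| <= `|r| + 1.
  by rewrite (le_trans hx)// (le_trans (ler_norm _))// lerDl.
rewrite cderiven_cpoly distrC; apply: norm_complex_lt; first exact: hA.
exact: hB.
Qed.

(** Continuity at [phi] involves finitely many derivatives on a bounded interval, so one polynomial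
    can be close to [phi] for both functionals at once. *)
Lemma test_continuous_eq T1 T2 : test_continuous T1 -> test_continuous T2 ->
  (forall P, T1 (polytest P) = T2 (polytest P)) -> T1 = T2.
Proof.
move=> h1 h2 h; apply/funext => phi; apply/eqP; rewrite -subr_eq0 -normr_le0.
apply/negPn/negP => hn.
have n0 : 0 < `|T1 phi - T2 phi| by rewrite normr_gt0 -normr_le0.
have [e e0 ee] : exists2 e : R, 0 < e & `|T1 phi - T2 phi| = (e + e)%:C.
  exists (complex.Re `|T1 phi - T2 phi| / 2); rewrite -?splitr.
    by move: n0; rewrite ltcE /= => /andP[_ h0]; rewrite divr_gt0.
  by apply/esym/RRe_real; rewrite ger0_real.
have [m1 [r1 [d1 [d10 H1]]]] := h1 phi e e0.
have [m2 [r2 [d2 [d20 H2]]]] := h2 phi e e0.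
have d0 : 0 < Num.min d1 d2 by rewrite lt_min d10.
have [P hP] := poly_dense phi (maxn m1 m2) (Num.max r1 r2) d0.
have K1 := H1 (polytest P); have K2 := H2 (polytest P).
have {}K1 : `|T1 (polytest P) - T1 phi| < e%:C.
  apply: K1 => j x jm xr; apply: lt_le_trans (hP j x _ _) _.
  - by rewrite leq_max jm.
  - by rewrite le_max xr.
  - by rewrite lecR ge_min lexx.
have {}K2 : `|T2 (polytest P) - T2 phi| < e%:C.
  apply: K2 => j x jm xr; apply: lt_le_trans (hP j x _ _) _.
  - by rewrite leq_max jm orbT.
  - by rewrite le_max xr orbT.
  - by rewrite lecR ge_min lexx orbT.
have : `|T1 phi - T2 phi| < (e + e)%:C.
  rewrite -(subrKA (T1 (polytest P))) {2}h; apply: le_lt_trans (ler_normD _ _) _.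
  by rewrite rmorphD ltrD// distrC.
by rewrite ee ltxx.
Qed.

End PolynomialTests.

(** * Test functions and the end points of the support *)

Section TestFunctionCalculus.
Variable R : realType.
Implicit Types (phi psi : testfun R) (T : functional R).

Notation iterD n phi := (iter n (@test_deriv R) phi).

Lemma cderiven_test_deriv j phi x : cderiven j (test_deriv phi) x = cderiven j.+1 phi x.
Proof. by rewrite /cderiven /derive1n !iterSr. Qed.

Lemma cderiven_iter j n phi x : cderiven j (iterD n phi) x = cderiven (n + j) phi x.
Proof.
elim: n j phi => // n IH j phi.
by rewrite iterSr IH cderiven_test_deriv.
Qed.

Lemma cderiven0 phi x : cderiven 0 phi x = phi x.
Proof. by rewrite /cderiven /=; case: (phi x). Qed.

Lemma iterD_val n phi x : iterD n phi x = cderiven n phi x.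
Proof. by rewrite -cderiven0 cderiven_iter addn0. Qed.

Lemma test_continuous_deriv T n : test_continuous T ->
  test_continuous (fun phi => T (iterD n phi)).
Proof.
move=> hT phi0 e e0; have [m [r [d [d0 h]]]] := hT (iterD n phi0) e e0.
exists (n + m)%N, r, d; split=> // phi hphi; apply: h => j x jm xr.
by rewrite !cderiven_iter; apply: hphi => //; rewrite leq_add2l.
Qed.

Lemma test_continuous_eval (x0 : R) : test_continuous (fun phi => phi x0).
Proof.
move=> phi0 e e0; exists 0%N, `|x0|, e; split=> // phi h.
by have := h 0%N x0 (leqnn _) (lexx _); rewrite !cderiven0.
Qed.

Lemma complex_norm_bound (z : R[i]) : exists2 C : R, 0 < C & `|z| < C%:C.
Proof.
exists (complex.Re `|z| + 1).
  have : 0 <= `|z| := normr_ge0 z.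
  by rewrite lecE /= => /andP[_ h]; rewrite ltr_wpDl.
have {1}-> : `|z| = (complex.Re `|z|)%:C by rewrite RRe_real// ger0_real.
by rewrite ltcR ltrDl.
Qed.

Lemma test_continuousZ T c : test_continuous T -> test_continuous (fun phi => c * T phi).
Proof.
move=> hT phi0 e e0; have [C C0 hC] := complex_norm_bound c.
have [m [r [d [d0 h]]]] := hT phi0 (e / C) (divr_gt0 e0 C0).
exists m, r, d; split=> // phi /h {}h; rewrite -mulrBr normrM.
have -> : e%:C = C%:C * (e / C)%:C :> R[i] by rewrite -rmorphM/= mulrC divfK// lt0r_neq0.
by apply: ltr_pM.
Qed.

Lemma test_continuousD T1 T2 : test_continuous T1 -> test_continuous T2 ->
  test_continuous (fun phi => T1 phi + T2 phi).
Proof.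
move=> h1 h2 phi0 e e0; have e2 : 0 < e / 2 by rewrite divr_gt0.
have [m1 [r1 [d1 [d10 H1]]]] := h1 phi0 _ e2.
have [m2 [r2 [d2 [d20 H2]]]] := h2 phi0 _ e2.
exists (maxn m1 m2), (Num.max r1 r2), (Num.min d1 d2); split; first by rewrite lt_min d10.
move=> phi h; rewrite [e]splitr rmorphD/= opprD addrACA.
apply: le_lt_trans (ler_normD _ _) _; apply: ltrD.
- apply: H1 => j x jm xr; apply: lt_le_trans (h j x _ _) _.
  + by rewrite leq_max jm.
  + by rewrite le_max xr.
  + by rewrite lecR ge_min lexx.
- apply: H2 => j x jm xr; apply: lt_le_trans (h j x _ _) _.
  + by rewrite leq_max jm orbT.
  + by rewrite le_max xr orbT.
  + by rewrite lecR ge_min lexx orbT.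
Qed.

Lemma test_continuous_sum n (T : nat -> functional R) :
  (forall i, (i < n)%N -> test_continuous (T i)) ->
  test_continuous (fun phi => \sum_(i < n) T i phi).
Proof.
elim: n => [|n IH] h.
  move=> phi0 e e0; exists 0%N, 0, 1; split=> // phi _.
  by rewrite !big_ord0 subrr normr0 ltcR.
have h1 := IH (fun i hi => h i (leqW hi)).
have h2 := test_continuousD h1 (h n (ltnSn n)).
by move=> phi0 e e0; have := h2 phi0 e e0 => -[m [r [d [d0 H]]]];
  exists m, r, d; split=> // phi /H; rewrite !big_ord_recr.
Qed.

Lemma test_deriv_near0 phi (x : R) : (\forall y \near x, phi y = 0) ->
  \forall y \near x, test_deriv phi y = 0.
Proof.
move=> h0; have := nbhs_interior h0; apply: filterS => y hy.
have D (f : R -> R) : (\forall z \near y, 0 = f z) -> derive1 f y = 0.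
  move=> h; apply: is_derive_derive1.
  exact: (near_eq_is_derive h (is_derive_cst (0 : R) y 1)).
rewrite [LHS]/(cderiven 1 phi y) /cderiven /= !D//; apply: filterS hy => z ->//.
Qed.

Lemma iterD_near0 n phi (x : R) : (\forall y \near x, phi y = 0) -> iterD n phi x = 0.
Proof.
move=> h; suff : \forall y \near x, iterD n phi y = 0 by move/nbhs_singleton.
by elim: n => // n IH; exact: test_deriv_near0.
Qed.

Lemma test_antideriv (dir : bool) (c : R) phi :
  (forall x, (if dir then x < c else c < x) -> phi x = 0) ->
  exists2 psi, test_deriv psi = phi & forall x, (if dir then x < c else c < x) -> psi x = 0.
Proof.
have [sr si] := tf_smooth phi.
have H (f : R -> R) : rsmooth f -> (forall x, (if dir then x < c else c < x) -> f x = 0) ->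
    exists F, [/\ rsmooth F, derive1 F = f & forall x, (if dir then x < c else c < x) -> F x = 0].
  move=> sf f0; have cf := rsmooth_continuous sf.
  have [F dF F0] : exists2 F, (forall x : R, is_derive x 1 F (f x)) &
      forall x, (if dir then x < c else c < x) -> F x = 0.
    by case: dir f0; [exact: antiderivative_left|exact: antiderivative_right].
  by have [sF dF'] := rsmooth_antiderivative sf dF; exists F.
move=> phi0.
have [F [sF dF F0]] := H _ sr (fun x hx => congr1 (@complex.Re R) (phi0 x hx)).
have [G [sG dG G0]] := H _ si (fun x hx => congr1 (@complex.Im R) (phi0 x hx)).
have hs : (fun x => F x +i* G x : R[i]^o) \in @smooth_fun R by apply/smooth_funP.
exists (TestFun hs); last by move=> x hx /=; rewrite F0 ?G0.
apply/val_inj/funext => x; rewrite [LHS]/(cderiven 1 _ x) /cderiven /=.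
rewrite -[derive1 _ x]/(derive1 F x) -[X in _ +i* X]/(derive1 G x) dF dG.
by case: (phi x).
Qed.

(** The functional F(0, ..., k) is known explicitly on u-th derivatives only. Test functions that
    vanish on one side are such derivatives, with the vanishing kept on that side. *)
Lemma test_antiderivn n (dir : bool) (c : R) phi :
  (forall x, (if dir then x < c else c < x) -> phi x = 0) ->
  exists2 psi, iterD n psi = phi & forall x, (if dir then x < c else c < x) -> psi x = 0.
Proof.
elim: n phi => [|n IH] phi h; first by exists phi.
have [psi1 e1 h1] := test_antideriv h; have [psi e2 h2] := IH psi1 h1.
by exists psi => //; rewrite iterS e2.
Qed.

Lemma test_supp_out phi x : ~ test_supp phi x -> phi x = 0.
Proof.
move=> h; apply/eqP/negPn/negP => hx; apply: h.
exact: (@subset_closure _ [set x | phi x != 0]).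
Qed.

Lemma compact_supp_side (dir : bool) phi (c : R) : compact (test_supp phi) ->
  test_supp phi `<=` [set x | if dir then c < x else x < c] ->
  exists2 c', (if dir then c < c' else c' < c) &
    forall x, (if dir then x < c' else c' < x) -> phi x = 0.
Proof.
move=> cs sc; have [e|/set0P ne] := eqVneq (test_supp phi) set0.
  have z x : phi x = 0 by apply: test_supp_out; rewrite e.
  by case: {sc} dir; [exists (c + 1)|exists (c - 1)] => //; rewrite ?ltrBlDr ltrDl.
have cid : {within test_supp phi, continuous (id : R -> R)}.
  by apply: continuous_subspaceT => x; exact: cvg_id.
case: dir sc => sc.
- have [m ms hm] := compact_EVT_min ne cs cid; exists m; first by apply: sc; rewrite inE in ms.
  move=> x xm; apply: test_supp_out => xs.
  by have := hm x; rewrite inE => /(_ xs); rewrite leNgt xm.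
- have [m ms hm] := compact_EVT_max ne cs cid; exists m; first by apply: sc; rewrite inE in ms.
  move=> x xm; apply: test_supp_out => xs.
  by have := hm x; rewrite inE => /(_ xs); rewrite leNgt xm.
Qed.

Definition bump_subproof : (fun x : R => (rbump x)%:C : R[i]^o) \in @smooth_fun R.
Proof.
apply/smooth_funP; split; first exact: rsmooth_rbump.
exact: rsmooth0.
Qed.

Definition bump : testfun R := TestFun bump_subproof.

(** Otherwise the n-th derivative is zero everywhere, and so, one after the other, are the lower
    ones: each is constant and vanishes at 2. *)
Lemma bump_derivn n : exists2 x, `|x| <= 1 & iterD n bump x != 0.
Proof.
have out m x : 1 < `|x| -> iterD m bump x = 0.
  move=> x1; apply: iterD_near0.
  have : \forall y \near x, 1 < `|y|.
    have := @norm_continuous R R x => /(_ [set z | 1 < z]) h.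
    by apply: h; exact: lt_nbhsr.
  by apply: filterS => y hy; rewrite /= rbump_out.
apply: contrapT => h.
have z x : iterD n bump x = 0.
  apply/eqP/negPn/negP => hx; apply: h; exists x => //.
  by rewrite leNgt; apply/negP => /(out n)/eqP; apply/negP.
have {z} : forall x, iterD 0 bump x = 0.
  clear h; elim: n out z => [//|n IH] out z; apply: IH => // x.
  have D (f : R -> R) : rsmooth f -> derive1 f = (fun=> 0) -> f 2 = 0 -> f x = 0.
    move=> sf df f2; pose a := `|x| + 2.
    have hx : - a <= x <= a by rewrite -ler_norml lerDl.
    have h2 : - a <= 2 <= a by rewrite -ler_norml ger0_norm// lerDr.
    have := @mvt_lipschitz R f (derive1 f) (- a) a 0 (fun y => rsmooth_is_derive y sf) _ x 2 hx h2.
    rewrite f2 subr0 mul0r normr_le0 => /(_ _)/eqP; apply => y _.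
    by rewrite df normr0.
  have [sr si] := tf_smooth (iterD n bump).
  have o2 : iterD n bump 2 = 0 by apply: out; rewrite ger0_norm// ltr1n.
  apply/eqP; rewrite eq_complex; apply/andP; split; apply/eqP; apply: (D (fun y => _ (iterD n bump y))) => //;
    rewrite ?o2//; apply/funext => y.
    exact: (congr1 (@complex.Re R) (z y)).
  exact: (congr1 (@complex.Im R) (z y)).
move=> /(_ 0) /= /(congr1 (@complex.Re R)) /=.
by move/eqP; rewrite (negbTE (rbump0 R)).
Qed.

Lemma iterD_affine n (c d : R) phi x :
  iterD n (test_affine c d phi) x = (c ^+ n)%:C * iterD n phi (c * x + d).
Proof.
rewrite !iterD_val; have [sr si] := tf_smooth phi.
have E (f : R -> R) : rsmooth f ->
    derive1n n (fun y => f (c * y + d)) x = c ^+ n * derive1n n f (c * x + d).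
  by move=> sf; rewrite derive1n_affine.
rewrite [LHS](congr2 (fun u v => u +i* v) (E _ sr) (E _ si)).
by apply/eqP; rewrite eq_complex /= !mul0r subr0 addr0 !eqxx.
Qed.

Lemma local_bump n (s : R) : exists phi, [/\ iterD n phi s != 0,
  forall x, 1 / 2 < `|x - s| -> phi x = 0 &
  forall m, compact (test_supp (iterD m phi)) /\
    test_supp (iterD m phi) `<=` [set x | `|x - s| <= 1 / 2]].
Proof.
have [x0 hx0 nz] := bump_derivn n.
(* The map sends s to x0, and |x - s| > 1/2 gives |4 (x - s) + x0| > 2 - 1, outside of the support
   of the bump. *)
pose phi := test_affine 4 (x0 - 4 * s) bump.
have out x : 1 / 2 < `|x - s| -> phi x = 0.
  move=> hx; rewrite /= rbump_out//.
  have -> : 4 * x + (x0 - 4 * s) = 4 * (x - s) + x0 by ring.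
  have := ler_normB (4 * (x - s) + x0) x0; rewrite addrK normrM ger0_norm// => h.
  by lra.
have outm m x : 1 / 2 < `|x - s| -> iterD m phi x = 0.
  move=> x1; apply: iterD_near0.
  have : \forall y \near x, 1 / 2 < `|y - s|.
    have c1 : {for x, continuous (fun y : R => `|y - s|)}.
      by apply: cvg_norm; apply: cvgB; [exact: cvg_id|exact: cvg_cst].
    by apply: (c1 [set z | 1 / 2 < z]); exact: lt_nbhsr.
  by apply: filterS => y; exact: out.
exists phi; split=> //.
  rewrite iterD_affine mulf_eq0 negb_or; apply/andP; split.
    by rewrite -[0]/((0:R)%:C) (inj_eq (@complexI R)) expf_neq0.
  by have -> : 4 * s + (x0 - 4 * s) = x0 by ring.
move=> m.
have cl : test_supp (iterD m phi) `<=` `[s - 1 / 2, s + 1 / 2].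
  have cI : closed [set` `[s - 1 / 2, s + 1 / 2]] by exact: interval_closed.
  rewrite /test_supp [X in _ `<=` X](closure_id _).1//; apply: closure_subset => x /= hx.
  rewrite in_itv/=; have : `|x - s| <= 1 / 2.
    by rewrite leNgt; apply: contra hx => h; rewrite outm.
  by rewrite ler_norml => /andP[h1 h2]; apply/andP; split; lra.
split.
  apply: subclosed_compact cl; [exact: closed_closure|exact: segment_compact].
move=> x /cl; rewrite /= in_itv/= => /andP[h1 h2].
by rewrite ler_norml; apply/andP; split; lra.
Qed.

End TestFunctionCalculus.

(** * The ends of the support are the extreme nonzero coefficients *)

Section Ends.
Variables (R : realType) (T : functional R) (B : nat -> R[i]) (k n u : nat) (g : R[i]).

Notation iterD n phi := (iter n (@test_deriv R) phi).

Hypothesis g0 : g != 0.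
Hypothesis TE : forall phi,
  T (iterD u phi) = g * \sum_(i < k.+1) B i * iterD n phi i%:R.

Lemma vanishes_side (dir : bool) (e : nat) :
  (forall i, (if dir then e < i else i < e)%N -> B i = 0) ->
  vanishes_on T [set x | if dir then e%:R < x else x < e%:R].
Proof.
move=> hB phi cs hs; have [c ec hc] := compact_supp_side cs hs.
have [psi <- hpsi] := test_antiderivn u hc.
rewrite TE big1 ?mulr0// => i _.
have [/hB->|ie] := boolP (if dir then e < i else i < e)%N; first by rewrite mul0r.
rewrite iterD_near0 ?mulr0//; case: dir {hB hs hc} ec hpsi ie; rewrite -leqNgt => ec hpsi ie.
- have ic : i%:R < c by apply: le_lt_trans ec; rewrite ler_nat.
  by near=> z; apply: hpsi; near: z; exact: lt_nbhsl.
- have ic : c < i%:R by apply: lt_le_trans ec _; rewrite ler_nat.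
  by near=> z; apply: hpsi; near: z; exact: lt_nbhsr.
Unshelve. all: by end_near. Qed.

(** On the u-th derivative of a bump around e that reaches no other integer, only the term of [B e]
    survives. *)
Lemma not_vanishes_near (e : nat) (U : set R) : (e <= k)%N -> B e != 0 ->
  [set x : R | `|x - e%:R| <= 1 / 2] `<=` U -> ~ vanishes_on T U.
Proof.
move=> ek Be hU hT; have [phi [nz _ hphi]] := local_bump n (e%:R : R).
have [cs hs] := hphi u; have := hT _ cs (subset_trans hs hU).
have ek1 : (e < k.+1)%N by [].
rewrite TE (bigD1 (Ordinal ek1))//= big1 ?addr0.
  by move/eqP; rewrite !mulf_eq0 (negbTE g0) (negbTE Be) (negbTE nz).
move=> i; rewrite -val_eqE /= => ie; rewrite [X in _ * X]test_supp_out ?mulr0//.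
have [_ h] := hphi n; move=> /h /=.
have : 1 <= `|i%:R - e%:R : R|.
  case: (ltngtP i e) ie => // ie _.
    by rewrite distrC -natrB ?(ltnW ie)// normr_nat ler1n subn_gt0.
  by rewrite -natrB ?(ltnW ie)// normr_nat ler1n subn_gt0.
by lra.
Qed.

Lemma left_end_index (s kl : nat) : (s <= k)%N ->
  (forall i, (i < s)%N -> B i = 0) -> B s != 0 -> is_left_end T kl%:Z -> kl = s.
Proof.
move=> sk hB Bs [v1 v2]; apply/eqP; rewrite eqn_leq; apply/andP; split.
  rewrite leqNgt; apply/negP => h; apply: (not_vanishes_near sk Bs _ v1) => x /=.
  rewrite ler_norml => /andP[_].
  have : s%:R + 1 <= (kl%:Z%:~R : R) by rewrite -pmulrn natr1 ler_nat.
  by lra.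
by rewrite -lez_nat; apply: v2; rewrite -pmulrn; apply: (@vanishes_side false s).
Qed.

Lemma right_end_index (e kr : nat) : (e <= k)%N ->
  (forall i, (e < i)%N -> B i = 0) -> B e != 0 -> is_right_end T kr%:Z -> kr = e.
Proof.
move=> sk hB Bs [v1 v2]; apply/eqP; rewrite eqn_leq; apply/andP; split.
  by rewrite -lez_nat; apply: v2; rewrite -pmulrn; apply: (@vanishes_side true e).
rewrite leqNgt; apply/negP => h; apply: (not_vanishes_near sk Bs _ v1) => x /=.
rewrite ler_norml => /andP[h1 _].
have : (kr%:Z%:~R : R) + 1 <= e%:R by rewrite -pmulrn natr1 ler_nat.
by lra.
Qed.

End Ends.

(** * B-splines as divided differences *)

Section DividedDifference.
Variable K : fieldType.
Implicit Types (a : nat -> K) (f : K -> K).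

Definition divdiff q a f : K := \sum_(i < q.+1) f (a i) / node_prod (fun j : 'I_q.+1 => a j) i.

Lemma node_prod_recl q a (i : 'I_q.+1) :
  node_prod (fun j : 'I_q.+2 => a j) (lift ord0 i) =
  (a i.+1 - a 0%N) * node_prod (fun j : 'I_q.+1 => a j.+1) i.
Proof.
rewrite /node_prod big_mkcond big_ord_recl /=; congr (_ * _).
by rewrite [RHS]big_mkcond; apply: eq_bigr => j _; rewrite (inj_eq lift_inj).
Qed.

Lemma node_prod_recr q a (i : 'I_q.+1) :
  node_prod (fun j : 'I_q.+2 => a j) (widen_ord (leqnSn _) i) =
  (a i - a q.+1) * node_prod (fun j : 'I_q.+1 => a j) i.
Proof.
rewrite /node_prod big_mkcond big_ord_recr /= ifT; last first.
  by rewrite -val_eqE /= neq_ltn ltn_ord orbT.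
by rewrite mulrC [X in _ = _ * X]big_mkcond.
Qed.

Lemma divdiff_mul_first q a f : (forall i, (i <= q)%N -> a i.+1 != a 0%N) ->
  divdiff q.+1 a (fun t => (t - a 0%N) * f t) = divdiff q (fun i => a i.+1) f.
Proof.
move=> ha; rewrite /divdiff big_ord_recl /= subrr !mul0r add0r.
apply: eq_bigr => i _; rewrite node_prod_recl invfM mulrACA divff ?mul1r//.
by rewrite subr_eq0 ha// -ltnS.
Qed.

Lemma divdiff_mul_last q a f : (forall i, (i <= q)%N -> a i != a q.+1) ->
  divdiff q.+1 a (fun t => (t - a q.+1) * f t) = divdiff q a f.
Proof.
move=> ha; rewrite /divdiff big_ord_recr /= subrr !mul0r addr0.
apply: eq_bigr => i _; rewrite node_prod_recr invfM mulrACA divff ?mul1r//.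
by rewrite subr_eq0 ha// -ltnS.
Qed.

Lemma divdiff_linear q a (c : K) f g :
  divdiff q a (fun t => c * f t + g t) = c * divdiff q a f + divdiff q a g.
Proof.
rewrite /divdiff mulr_sumr -big_split; apply: eq_bigr => i _.
by rewrite mulrDl mulrA.
Qed.

End DividedDifference.

Lemma derivn_mulXsubC (K : comNzRingType) (P : {poly K}) (c : K) n :
  (('X - c%:P) * P)^`(n.+1) = ('X - c%:P) * P^`(n.+1) + P^`(n) *+ n.+1.
Proof.
elim: n => [|n IH]; first by rewrite derivn1 derivM derivXsubC mul1r addrC.
by rewrite derivnS IH derivD derivM derivXsubC derivMn -!derivnS mul1r mulrS; ring.
Qed.

Section BSpline.
Variable R : realType.
Implicit Types (a : nat -> R) (f h : R -> R).

(** Enough for integrability against any continuous function, and satisfied by the indicator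
    function of order 1, which is not continuous. *)
Definition cbounded f := measurable_fun setT f /\
  exists L M : R, (forall t, L < `|t| -> f t = 0) /\ forall t, `|f t| <= M.

Lemma cboundedM h f : continuous h -> cbounded f -> cbounded (fun t => h t * f t).
Proof.
move=> ch [mf [L [M [hL hM]]]]; split.
  by apply: measurable_funM => //; exact: continuous_measurable_fun.
have [C C0 hC] := continuous_bounded (- L) L ch.
exists L, (C * M); split=> [t /hL->|t]; first by rewrite mulr0.
have [/hL->|tL] := ltP L `|t|.
  by rewrite mulr0 normr0 mulr_ge0 ?(ltW C0)// (le_trans _ (hM 0)).
by rewrite normrM ler_pM// hC// -ler_norml.
Qed.

Lemma cboundedD f h : cbounded f -> cbounded h -> cbounded (fun t => f t + h t).
Proof.
move=> [mf [L [M [hL hM]]]] [mh [L' [M' [hL' hM']]]]; split.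
  exact: measurable_funD.
exists (Num.max L L'), (M + M'); split=> t.
  by rewrite gt_max => /andP[/hL-> /hL'->]; rewrite addr0.
by apply: le_trans (ler_normD _ _) _; exact: lerD.
Qed.

Lemma cbounded_integrable f : cbounded f ->
  lebesgue_measure.-integrable setT (EFin \o f).
Proof.
move=> [mf [L [M [hL hM]]]].
have M0 : 0 <= M by rewrite (le_trans _ (hM 0)).
have := @integrable_indic_itv R (- L) L true false => /=.
move=> /(integrableZl measurableT M); apply: le_integrable => //.
  exact/measurable_EFinP.
move=> t _; rewrite /= lee_fin normrM (ger0_norm M0) indicE.
have [/hL->|tL] := ltP L `|t|; first by rewrite normr0 mulr_ge0.
by rewrite mem_set ?normr1 ?mulr1//= in_itv/= -ler_norml.
Qed.

Lemma bsplineS q a t : bspline q.+2 a t =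
  (t - a 0%N) / (a q.+1 - a 0%N) * bspline q.+1 a t +
  (a q.+2 - t) / (a q.+2 - a 1%N) * bspline q.+1 (fun i => a i.+1) t.
Proof. by []. Qed.

Lemma continuous_affine (c d : R) : continuous (fun t : R => c * t + d).
Proof. by apply: is_derive_continuous => x; exact: is_derive_affine. Qed.

Lemma bspline_cbounded q a : cbounded (bspline q.+1 a).
Proof.
elim: q a => [|q IH] a.
  split; first exact: measurable_indic.
  exists (`|a 0%N| + `|a 1%N|), 1; split=> t; last first.
    by rewrite /= indicE; case: (_ \in _); rewrite ?normr0 ?normr1.
  move=> ht; rewrite /= indicE memNset//= in_itv/= => /andP[h1 h2].
  move: ht; rewrite ltNge ler_norml => /negP; apply; apply/andP; split.
    by have := ler_norm (- a 0%N); rewrite normrN; have := normr_ge0 (a 1%N); lra.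
  by have := ler_norm (a 1%N); have := normr_ge0 (a 0%N); lra.
have c1 u v : continuous (fun t : R => (t - u) / v).
  rewrite (_ : (fun t => _) = (fun t => v^-1 * t + (- (v^-1 * u)))).
    exact: continuous_affine.
  by apply/funext => t; ring.
have c2 u v : continuous (fun t : R => (u - t) / v).
  rewrite (_ : (fun t => _) = (fun t => (- v^-1) * t + (v^-1 * u))).
    exact: continuous_affine.
  by apply/funext => t; ring.
exact: (cboundedD (cboundedM (c1 (a 0%N) (a q.+1 - a 0%N)) (IH a))
  (cboundedM (c2 (a q.+2) (a q.+2 - a 1%N)) (IH (fun i => a i.+1)))).
Qed.

Lemma bspline_mul_integrable q a h : continuous h ->
  lebesgue_measure.-integrable setT (EFin \o (fun t => bspline q.+1 a t * h t)).
Proof.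
move=> ch; rewrite (_ : (fun t => _) = (fun t => h t * bspline q.+1 a t)).
  exact/cbounded_integrable/cboundedM/bspline_cbounded.
by apply/funext => t; rewrite mulrC.
Qed.

Lemma continuous_horner (p : {poly R}) : continuous (horner p).
Proof. by apply: rsmooth_continuous; exact: rsmooth_horner. Qed.

Lemma bspline1_integral a (p : {poly R}) : a 0%N < a 1%N ->
  \int[lebesgue_measure]_t (bspline 1 a t * p^`().[t]) = p.[a 1%N] - p.[a 0%N].
Proof.
move=> a01.
rewrite (_ : (fun t => _) = (horner p^`()) \_ `]a 0%N, a 1%N]); last first.
  by apply/funext => t; rewrite patchE /= indicE; case: (_ \in _); rewrite ?mul1r ?mul0r.
rewrite -Rintegral_mkcond Rintegral_itv_obnd_cbnd; last first.
  have ic : lebesgue_measure.-integrable `[a 0%N, a 1%N] (EFin \o horner p^`()).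
    apply: continuous_compact_integrable; first exact: segment_compact.
    by apply: continuous_subspaceT; exact: continuous_horner.
  apply: integrableS ic => //.
  by apply: subset_itvr; rewrite bnd_simp.
rewrite /Rintegral (@continuous_FTC2 _ (horner p^`()) (horner p))//.
- by apply: continuous_subspaceT; exact: continuous_horner.
- split; first by move=> x _; exact: derivable_horner.
  + exact/cvg_at_right_filter/continuous_horner.
  + exact/cvg_at_left_filter/continuous_horner.
- by move=> x _; rewrite derivE.
Qed.

(* In the induction step the [p^`()] terms of both halves of the recursion are
   divided differences over [a 1, ..., a q.+1], and they cancel. *)
Lemma bspline_divdiff q a (p : {poly R}) :
  (forall i j, (i < j <= q.+1)%N -> a i < a j) ->
  \int[lebesgue_measure]_t (bspline q.+1 a t * p^`(q.+1).[t]) =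
  (a q.+1 - a 0%N) * q`!%:R * divdiff q.+1 a (horner p).
Proof.
elim: q a p => [|q IH] a p ha.
  have a01 : a 0%N < a 1%N by exact: ha.
  have np1 (b : 'I_1 -> R) i : node_prod b i = 1.
    by rewrite /node_prod big1// => j; rewrite !ord1 eqxx.
  rewrite derivn1 bspline1_integral// /divdiff !big_ord_recl big_ord0 node_prod_recl np1 /node_prod.
  rewrite !big_mkcond !big_ord_recl !big_ord0 /= -[fintype.bump 0 0]/1%N fact0.
  have : a 1%N - a 0%N != 0 by rewrite subr_eq0 gt_eqF.
  have : a 0%N - a 1%N != 0 by rewrite subr_eq0 lt_eqF.
  by move=> h1 h2; field; rewrite h1 h2.
have ne i j : (i < j <= q.+2)%N -> a i != a j by move=> /ha h; rewrite lt_eqF.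
pose A1 := ('X - (a 0%N)%:P) * p^`() - p *+ q.+1.
pose A2 := ('X - (a q.+2)%:P) * p^`() - p *+ q.+1.
(* Each half of the recursion contains (X - c) p^(q+2). Writing it as a derivative of order q + 1
   puts it in the form of the induction hypothesis. *)
have dA c : (('X - c%:P) * p^`() - p *+ q.+1)^`(q.+1) = ('X - c%:P) * p^`(q.+2).
  by rewrite derivnB derivn_mulXsubC derivnMn -!derivSn addrK.
pose a' i := a i.+1.
have d1 : a q.+1 - a 0%N != 0 by rewrite subr_eq0 eq_sym ne//= leqnSn.
have d2 : a q.+2 - a 1%N != 0 by rewrite subr_eq0 eq_sym ne//=.
have -> : (fun t => bspline q.+2 a t * p^`(q.+2).[t]) = fun t =>
    (a q.+1 - a 0%N)^-1 * (bspline q.+1 a t * A1^`(q.+1).[t]) +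
    - (a q.+2 - a 1%N)^-1 * (bspline q.+1 a' t * A2^`(q.+1).[t]).
  apply/funext => t; rewrite bsplineS !dA !hornerM !hornerXsubC -/a'; ring.
have i1 := bspline_mul_integrable q a (@continuous_horner A1^`(q.+1)).
have i2 := bspline_mul_integrable q a' (@continuous_horner A2^`(q.+1)).
rewrite RintegralD//; [|exact: (integrableZl measurableT _ i1)|exact: (integrableZl measurableT _ i2)].
rewrite !RintegralZl// !IH; last 2 first.
- by move=> i j hij; apply: ha; lia.
- by move=> i j hij; apply: ha; lia.
have E b c : divdiff q.+1 b (horner (('X - c%:P) * p^`() - p *+ q.+1)) =
    divdiff q.+1 b (fun t => (t - c) * p^`().[t]) - q.+1%:R * divdiff q.+1 b (horner p).
  rewrite -[RHS]addrC -mulNr -divdiff_linear; apply: eq_bigr => i _; congr (_ / _).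
  by rewrite hornerD hornerN hornerMn hornerM hornerXsubC -mulr_natl mulNr addrC.
rewrite !E divdiff_mul_first; last by move=> i iq; rewrite eq_sym; apply: ne; clear -iq; lia.
rewrite (@divdiff_mul_last _ q a'); last by move=> i iq; apply: (ne i.+1); clear -iq; lia.
(* The recursion of divided differences, obtained from (t - a_0) - (t - a_(q+2)) = a_(q+2) - a_0. *)
have F : (a q.+2 - a 0%N) * divdiff q.+2 a (horner p) =
   divdiff q.+1 a' (horner p) - divdiff q.+1 a (horner p).
  rewrite -(@divdiff_mul_first _ q.+1 a); last by move=> i iq; rewrite eq_sym; apply: ne; clear -iq; lia.
  rewrite -(@divdiff_mul_last _ q.+1 a); last by move=> i iq; apply: ne; clear -iq; lia.
  rewrite -[RHS]addrC -[X in _ = X + _]mulN1r -divdiff_linear /divdiff mulr_sumr.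
  by apply: eq_bigr => i _; ring.
rewrite factS natrM [(a q.+2 - a 0%N) * _ * _]mulrAC F /a'.
by field; rewrite d1 d2.
Qed.

End BSpline.

(** * B-splines as distributions *)

Section BSplineDistribution.
Variable R : realType.
Implicit Types (a : nat -> R) (phi : testfun R) (T : functional R).

Lemma integral_mul_close (f : R -> R) : cbounded f ->
  exists L, forall e : R, 0 < e -> exists2 d : R, 0 < d &
  forall u v : R -> R, continuous u -> continuous v ->
    (forall x, `|x| <= L -> `|u x - v x| < d) ->
    `|\int[lebesgue_measure]_t (f t * u t) - \int[lebesgue_measure]_t (f t * v t)| < e.
Proof.
move=> bf; have [mf [L [M [hL hM]]]] := bf.
pose C := \int[lebesgue_measure]_t `|f t|.
have C0 : 0 <= C by apply: Rintegral_ge0 => t _.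
have iN : lebesgue_measure.-integrable setT (EFin \o (fun t => `|f t|)).
  exact: (integrable_abse (cbounded_integrable bf)).
exists L => e e0; exists (e / (C + 1)); first by rewrite divr_gt0// ltr_wpDl.
set d := e / _ => u v cu cv huv.
have im (h : R -> R) : continuous h ->
    lebesgue_measure.-integrable setT (EFin \o (fun t => f t * h t)).
  move=> ch; rewrite (_ : (fun t => _) = (fun t => h t * f t)).
    exact/cbounded_integrable/cboundedM.
  by apply/funext => t; rewrite mulrC.
have cB : continuous (fun t => u t - v t) by move=> t; apply: cvgB; [exact: cu|exact: cv].
rewrite -RintegralB//; [|exact: im|exact: im].
rewrite (_ : (fun t => _) = (fun t => f t * (u t - v t))); last first.
  by apply/funext => t; rewrite mulrBr.
apply: le_lt_trans (le_normr_Rintegral measurableT (im _ cB)) _.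
apply: (@le_lt_trans _ _ (d * C)).
  rewrite -RintegralZl//; apply: le_Rintegral => //.
  - exact: (integrable_abse (im _ cB)).
  - exact: (integrableZl measurableT d iN).
  move=> t _; rewrite normrM mulrC.
  have [/hL->|tL] := ltP L `|t|; first by rewrite normr0 !mulr0.
  by rewrite ler_wpM2r//; apply/ltW/huv.
rewrite /d mulrAC ltr_pdivrMr ?ltr_wpDl// ltr_pM2l//.
by rewrite ltrDl.
Qed.

Lemma re_im_close (z w : R[i]) (d : R) : `|z - w| < d%:C ->
  `|complex.Re z - complex.Re w| < d /\ `|complex.Im z - complex.Im w| < d.
Proof.
move=> h; rewrite -!raddfB; split; rewrite -ltcR.
  exact: le_lt_trans (normc_ge_Re _) h.
apply: le_lt_trans h.
have := normc_ge_Re ((z - w) * 'i%C); rewrite ReiNIm normrN normrM.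
by rewrite (_ : `|'i%C| = 1 :> R[i]) ?mulr1// normc_def/= expr0n expr1n add0r sqrtr1.
Qed.

Lemma bspline_dist_continuous r a : test_continuous (bspline_dist r a).
Proof.
case: r => [|r] phi0 e e0; first exact: (test_continuous_eval (a 0%N) phi0 e0).
have [L hL] := integral_mul_close (bspline_cbounded r a).
have e2 : 0 < e / 2 by rewrite divr_gt0.
have [d d0 hd] := hL _ e2.
exists 0%N, L, d; split=> // phi hphi.
have {}hphi x : `|x| <= L -> `|phi x - phi0 x| < d%:C.
  by move=> xL; have := hphi 0%N x (leqnn _) xL; rewrite !cderiven0.
have [sr si] := tf_smooth phi; have [sr0 si0] := tf_smooth phi0.
rewrite /bspline_dist /=; set A := Rintegral _ _ _; set B := Rintegral _ _ _.
set A' := Rintegral _ _ _; set B' := Rintegral _ _ _.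
rewrite (_ : A +i* B - (A' +i* B') = (A - A') +i* (B - B'))//.
apply: norm_complex_lt; apply: hd.
- exact: rsmooth_continuous sr.
- exact: rsmooth_continuous sr0.
- by move=> x /hphi /re_im_close[].
- exact: rsmooth_continuous si.
- exact: rsmooth_continuous si0.
- by move=> x /hphi /re_im_close[].
Qed.

Lemma bspline_dist_poly r a : (forall i j, (i < j <= r)%N -> a i < a j) ->
  exists2 C : R[i], C != 0 & forall P, bspline_dist r a (polytest P^`(r)) =
    C * \sum_(i < r.+1) P.[(a i)%:C] / node_prod (fun j : 'I_r.+1 => (a j)%:C) i.
Proof.
case: r => [|r] ha.
  exists 1; first exact: oner_neq0.
  move=> P; rewrite mul1r big_ord_recl big_ord0 /node_prod big1; last first.
    by move=> j; case: (j =P _) => //; rewrite (ord1 j) => h; case: h; apply: esym; exact: ord1.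
  by rewrite divr1 addr0.
exists ((a r.+1 - a 0%N) * r`!%:R)%:C.
  rewrite -[0]/((0:R)%:C) (inj_eq (@complexI R)) mulf_neq0//.
  by rewrite subr_eq0 gt_eqF// ha//= leqnn.
move=> P; have [A [B ->]] := cpoly_onto P.
have dE : (cpoly A B)^`(r.+1) = cpoly A^`(r.+1) B^`(r.+1).
  by elim: r.+1 => // n IH; rewrite !derivnS IH deriv_cpoly.
have E (p : {poly R}) (f : R -> R) : f =1 horner p^`(r.+1) ->
  \int[lebesgue_measure]_t (bspline r.+1 a t * f t) =
  (a r.+1 - a 0%N) * r`!%:R * divdiff r.+1 a (horner p).
  by move=> hf; rewrite -bspline_divdiff//; congr Rintegral; apply/funext => t; rewrite hf.
rewrite dE /bspline_dist.
rewrite [LHS](congr2 (fun u v => u +i* v) (E A _ _) (E B _ _)); last 2 first.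
- by move=> t /=; rewrite horner_cpoly.
- by move=> t /=; rewrite horner_cpoly.
rewrite complexE' !rmorphM/= -!mulrA [X in _ + X]mulrCA -mulrDr; congr (_ * _).
rewrite [X in _ + X]mulrCA -mulrDr; congr (_ * _).
rewrite /divdiff !rmorph_sum mulr_sumr -big_split; apply: eq_bigr => i _.
rewrite horner_cpoly complexE' mulrDl !rmorphM/= !fmorphV.
have -> : node_prod (fun j : 'I_r.+2 => (a j)%:C) i =
    (node_prod (fun j : 'I_r.+2 => a j) i)%:C.
  by rewrite /node_prod rmorph_prod; apply: eq_bigr => j _; rewrite rmorphB.
by rewrite mulrA.
Qed.

Lemma iter_dist_deriv n T phi :
  iter n (@dist_deriv R) T phi = (-1) ^+ n * T (iter n (@test_deriv R) phi).
Proof.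
elim: n phi => [|n IH] phi; first by rewrite mul1r.
by rewrite iterS {1}/dist_deriv IH iterSr exprS -mulrA mulN1r.
Qed.

End BSplineDistribution.

(** * Proof of the theorem *)

Section KnotRecords.
Variable k : nat.

Lemma knots_eq (a b : knots k) : (a : seq rat) = b -> a = b.
Proof.
case: a b => [a sa] [b sb] /= /val_inj e; case: _ / e sb => sb.
by rewrite (bool_irrelevance sa sb).
Qed.

Lemma knots_isknots (a : knots k) : isknots k a.
Proof. by rewrite /isknots size_tuple eqxx knots_sorted. Qed.

(** Makes F a function of plain lists, as the algebraic part expects. The default value is harmless,
    since the laws relating different lists concern only sorted lists of the right length. *)
Definition mk_knots (s : seq rat) : knots k :=
  match @idP (isknots k s) with
  | ReflectT h => @Knots k (Tuple (proj1 (andP h))) (proj2 (andP h))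
  | ReflectF _ => int_knots k
  end.

Lemma mk_knotsE s : isknots k s -> (mk_knots s : seq rat) = s.
Proof. by rewrite /mk_knots; case: {-}_ / idP. Qed.

Lemma mk_knotsK (a : knots k) : mk_knots a = a.
Proof. by apply/knots_eq/mk_knotsE/knots_isknots. Qed.

Lemma int_knotsE : (int_knots k : seq rat) = ints k.
Proof. by rewrite /= (map_comp (fun n : nat => n%:R : rat) val) val_enum_ord. Qed.

End KnotRecords.

Section PolynomialMoments.
Variables (R : realType) (k : nat) (F : knots k -> cs_distribution R).
Hypotheses (hF0 : exists a : knots k, (F a : functional R) <> 0)
  (hspan : span_condition F) (htrans : translation_invariant F)
  (hdil : dilation_invariant F).

Definition moment (s : seq rat) (P : {poly R[i]}) : R[i] := F (mk_knots k s) (polytest P).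

Lemma moment_knots (a : knots k) P : moment a P = F a (polytest P).
Proof. by rewrite /moment mk_knotsK. Qed.

Lemma moment_linear s c P G : moment s (c *: P + G) = c * moment s P + moment s G.
Proof. by rewrite /moment polytest_linear linearP. Qed.

Lemma moment_span (al : seq rat) (j : nat) : sorted <%R al -> size al = k.+2 ->
  (0 < j <= k)%N -> exists c d, forall P,
  moment (rem_at j al) P = c * moment (take k.+1 al) P + d * moment (behead al) P.
Proof.
case: j => // j sal zal jk.
have kal : isknots k.+1 al by rewrite /isknots zal eqxx.
have jal : (j.+1 < size al)%N by rewrite zal ltnS ltnW.
have kr : isknots k (rem_at j.+1 al) by exact: rem_at_isknots.
pose b := mk_knots k.+1 al; have bE : (b : seq rat) = al by exact: mk_knotsE.
have [|| c [d E]] := hspan (a := mk_knots k (rem_at j.+1 al)) (x := al`_j.+1) (b := b).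
- exists j => //; rewrite mk_knotsE// !nth_rem_at// ltnSn ltnn.
  by rewrite !sorted_nth_lt//= ?ltnSn// zal.
- rewrite bE mk_knotsE// perm_sym -cat1s perm_catCA /= -drop_nth//.
  by rewrite cat_take_drop.
exists c, d => P; rewrite /moment.
have -> : mk_knots k (take k.+1 al) = init_knots b.
  apply: knots_eq; rewrite mk_knotsE /= ?bE// /isknots size_takel ?zal//.
  by rewrite eqxx take_sorted.
have -> : mk_knots k (behead al) = tail_knots b.
  apply: knots_eq; rewrite mk_knotsE /= ?bE// /isknots size_behead zal eqxx.
  by rewrite -drop1 drop_sorted.
exact: (congr1 (fun f : functional R => f (polytest P)) E).
Qed.

Lemma moment_aff_weak (s : seq rat) (d t : rat) : isknots k s -> 0 < d ->
  exists c, forall P, moment (aff d t s) P = c * moment s (affp d t P).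
Proof.
move=> ks d0; set a := mk_knots k s.
have [c1 E1] := hdil a d0; have [c2 E2] := htrans (scale_knots d0 a) t.
exists (c2 * (c1 * (ratr d)%:C)) => P; rewrite /moment.
have -> : mk_knots k (aff d t s) = shift_knots t (scale_knots d0 a).
  by apply: knots_eq; rewrite mk_knotsE ?aff_isknots//= -map_comp mk_knotsE.
rewrite -[LHS]/((F _ : functional R) (polytest P)) E2 /GRing.scale/= /translate.
rewrite E1 /GRing.scale/= /dilate.
rewrite -!mulrA; congr (_ * (_ * (_ * F a _))).
rewrite -test_affine_poly; apply/val_inj/funext => x /=.
by rewrite addr0 mul1r.
Qed.

(** The invariance hypotheses allow the factor 0. In that case the inverse affine map shows that the
    moments of [s] vanish too, and the factor 1 works. *)
Lemma moment_aff (s : seq rat) (d t : rat) : isknots k s -> 0 < d ->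
  exists2 c, c != 0 & forall P, moment (aff d t s) P = c * moment s (affp d t P).
Proof.
move=> ks d0; have [c E] := moment_aff_weak t ks d0.
have [c0|c0] := eqVneq c 0; last by exists c.
have i0 : 0 < d^-1 by rewrite invr_gt0.
have [c' E'] := moment_aff_weak (- (t / d)) (aff_isknots t d0 ks) i0.
exists 1 => [|P]; first exact: oner_neq0.
by rewrite -{2}(affK t s (lt0r_neq0 d0)) E' !E c0 !mul0r !mulr0.
Qed.

Lemma test_continuous0 : test_continuous (0 : functional R).
Proof. by move=> phi e e0; exists 0%N, 0, 1; split=> // psi _; rewrite subrr normr0 ltcR. Qed.

(** The knots of any [a] lie on a common grid, so its moments are combinations of moments of
    [ints k]. If these vanished, F would be zero by density. *)
Lemma moment_neq0 : exists P, moment (ints k) P != 0.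
Proof.
have [a Fa] := hF0; apply: contrapT => h; apply: Fa.
have z P : moment (ints k) P = 0.
  by apply/eqP/negPn/negP => hP; apply: h; exists P.
apply: test_continuous_eq; [exact: dist_cont|exact: test_continuous0|] => P.
rewrite -[LHS]moment_knots.
have [D [L [N [D0 hD]]]] := common_grid a.
have [c ->] := mu_gridq moment_span moment_aff D0 (knots_isknots a) hD.
by rewrite big1// => j _; rewrite z mulr0.
Qed.

End PolynomialMoments.

Theorem theorem2p2 (R : realType) (k : nat) (F : knots k -> cs_distribution R)
    (kl kr : nat)
    (hk : (1 <= k)%N)
    (hF0 : exists a : knots k, (F a : functional R) <> 0)
    (hsupp : support_condition F)
    (hspan : span_condition F)
    (htrans : translation_invariant F)
    (hdil : dilation_invariant F)
    (hkl : is_left_end (F (int_knots k)) kl%:Z)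
    (hkr : is_right_end (F (int_knots k)) kr%:Z)
    (hmax : (maxn kl (k - kr) <= 2)%N) :
  exists n : nat, forall a : knots k,
    exists c : R[i], c != 0 /\
      (F a : functional R) =
        c *: iter n (@dist_deriv R)
               (bspline_dist (kr - kl) (fun j => real_knot R a (kl + j))).
Proof.
have mS := moment_span hspan; have mA := moment_aff htrans hdil.
have mL := moment_linear F.
have [B [Q1 [u [n [g [BE Q11 Bs Bd [g0 gE]]]]]]] :=
  mu_symbol mL mS mA (moment_neq0 hF0 hspan htrans hdil).
(* Both sides are continuous in [phi] and agree on polynomials by [gE]. This explicit form is needed
   on all test functions, since k_l and k_r are defined by supports. *)
have TE phi : F (int_knots k) (iter u (@test_deriv R) phi) =
    g * \sum_(i < k.+1) B`_i * iter n (@test_deriv R) phi i%:R.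
  move: phi; suff E : (fun phi => F (int_knots k) (iter u (@test_deriv R) phi)) =
      (fun phi => g * \sum_(i < k.+1) B`_i * iter n (@test_deriv R) phi i%:R) :> functional R.
    by move=> phi; exact: (congr1 (fun f : functional R => f phi) E).
  apply: test_continuous_eq.
  - exact: test_continuous_deriv (dist_cont _).
  - apply: test_continuousZ.
    apply: (@test_continuous_sum _ _ (fun i phi => B`_i * iter n (@test_deriv R) phi i%:R)) => i _.
    apply: test_continuousZ; apply: (@test_continuous_deriv _ (fun phi => phi i%:R)).
    exact: test_continuous_eval.
  - move=> P; rewrite !test_derivn_poly -moment_knots int_knotsE gE; congr (_ * _).
    rewrite (horner_opE _ _ Bs); apply: eq_bigr => i _.
    by rewrite add0r /= rmorph_nat.
have B0 : B != 0.
  rewrite BE mulf_neq0//; first by apply: contraNneq Q11 => ->; rewrite horner0.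
  by rewrite expf_neq0// -polyC1 polyXsubC_eq0.
have sB : (0 < size B)%N by rewrite size_poly_gt0.
have Be : B`_(size B).-1 != 0 by rewrite -lead_coefE lead_coef_eq0.
have [s Bs0 smin] : exists2 s, B`_s != 0 & forall i, B`_i != 0 -> (s <= i)%N.
  by case: (@ex_minnP (fun i => B`_i != 0)); [exists (size B).-1|move=> s hs hm; exists s].
have lt_s i : (i < s)%N -> B`_i = 0.
  by move=> h; apply/eqP/negPn/negP => /smin; rewrite leqNgt h.
have gt_e i : ((size B).-1 < i)%N -> B`_i = 0.
  by move=> h; rewrite nth_default// -(prednK sB).
have se := smin _ Be.
have ek : ((size B).-1 <= k)%N by rewrite -ltnS prednK.
have kls : kl = s := left_end_index g0 TE (leq_trans se ek) lt_s Bs0 hkl.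
have kre : kr = (size B).-1 := right_end_index g0 TE ek gt_e Be hkr.
rewrite -kls -kre in lt_s gt_e se ek Be Bs0.
have [r rE] : exists r, kr = (kl + r)%N by exists (kr - kl)%N; rewrite subnKC.
rewrite rE in hmax gt_e Be ek *.
have [hs2 hr2] : (kl <= 2)%N /\ (k - (kl + r) <= 2)%N by apply/andP; rewrite -geq_max.
have hout i : (i < kl)%N || (kl + r < i)%N -> B`_i = 0 by case/orP => [/lt_s|/gt_e].
have dd := mu_divided_difference mS mA hk BE Q11 Bs Bd g0 gE ek hs2 hr2 hout Bs0 Be.
exists n => a; rewrite addKn.
have [kap kap0 kapE] := dd a (knots_isknots a).
have mono i j : (i < j <= r)%N -> real_knot R a (kl + i) < real_knot R a (kl + j).
  move=> /andP[ij jr]; rewrite ltr_rat; apply: sorted_nth_lt; first exact: knots_sorted.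
  by rewrite size_tuple ltn_add2l ij ltnS (leq_trans _ ek)// leq_add2l.
have [C C0 hC] := bspline_dist_poly mono.
(* [kap] and [C] scale the divided difference in F(a) and in the B-spline; the sign undoes that of
   the n-fold distributional derivative. *)
exists (kap / C * (-1) ^+ n); split.
  by rewrite !mulf_neq0 ?invr_eq0// signr_eq0.
have signK (c x : R[i]) : c * (-1) ^+ n * ((-1) ^+ n * x) = c * x.
  by rewrite mulrA -[X in X * x]mulrA -expr2 sqrr_sign mulr1.
apply: test_continuous_eq.
- exact: dist_cont.
- rewrite (_ : _ *: _ = fun phi => kap / C * bspline_dist r (fun j => real_knot R a (kl + j))
    (iter n (@test_deriv R) phi)).
    exact/test_continuousZ/test_continuous_deriv/bspline_dist_continuous.
  apply/funext => phi; rewrite -[LHS]/(_ * iter n (@dist_deriv R) _ phi) iter_dist_deriv.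
  exact: signK.
(* Both sides are known on r-th derivatives, and every polynomial is one. *)
move=> G; have [P <-] := derivn_surj r G.
rewrite -[RHS]/(_ * iter n (@dist_deriv R) _ _) iter_dist_deriv.
rewrite signK.
rewrite test_derivn_poly (_ : P^`(r)^`(n) = P^`(n)^`(r)); last by rewrite /derivn -!iterD addnC.
rewrite hC -[LHS]moment_knots kapE.
rewrite mulrA divfK// mulr_sumr; apply: eq_bigr => i _.
have -> : (fun j : 'I_r.+1 => (real_knot R a (kl + j))%:C) = knot_node R[i] kl a.
  by apply/funext => j; rewrite /knot_node -(fmorph_rat (real_complex R)).
by rewrite mulrAC mulrA /knot_node -(fmorph_rat (real_complex R)).
Qed.
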